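(* Let $n\ge1$ and let $\mathcal G$ be an ind-group. (1) Let $\phi:\operatorname{Aut}(\mathbb A^n)\to\mathcal G$ be a homomorphism of ind-groups. Then either $\phi$ factors through $\operatorname{jac}:\operatorname{Aut}(\mathbb A^n)\to\Bbbk^*$, or $\phi$ is a closed immersion, i.e. $\phi(\operatorname{Aut}(\mathbb A^n))\subseteq\mathcal G$ is a closed ind-subgroup and $\phi:\operatorname{Aut}(\mathbb A^n)\to\phi(\operatorname{Aut}(\mathbb A^n))$ is an isomorphism of ind-groups. (2) Every nontrivial homomorphism $\operatorname{SAut}(\mathbb A^n)\to\mathcal G$ of ind-groups is a closed immersion.
   Context: The base field $\Bbbk$ is algebraically closed of characteristic zero; varieties are over $\Bbbk$. An ind-variety is a set $\mathcal V$ with an ascending filtration $\mathcal V_0\subseteq\mathcal V_1\subseteq\cdots$, $\mathcal V=\bigcup_k\mathcal V_k$, such that each $\mathcal V_k$ is an algebraic variety and $\mathcal V_k$ is Zariski-closed in $\mathcal V_{k+1}$. A subset $S\subseteq\mathcal V$ is closed if $S\cap\mathcal V_k$ is closed in $\mathcal V_k$ for all $k$; a closed subset is itself an ind-variety with filtration $S\cap\mathcal V_k$. A morphism $\phi:\mathcal V\to\mathcal W$ of ind-varieties is a map such that for every $k$ there is an $m$ with $\phi(\mathcal V_k)\subseteq\mathcal W_m$ and $\mathcal V_k\to\mathcal W_m$ a morphism of varieties. An ind-group is an ind-variety with a group structure such that multiplication and inversion are morphisms; homomorphisms (isomorphisms) of ind-groups are group homomorphisms (isomorphisms) that are morphisms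 (isomorphisms) of ind-varieties. $\operatorname{Aut}(\mathbb A^n)$ is the ind-group of polynomial automorphisms $\mathbf f=(f_1,\dots,f_n)$ of $\mathbb A^n=\Bbbk^n$: $\operatorname{End}(\mathbb A^n)=\Bbbk[x_1,\dots,x_n]^n$ is filtered by finite-dimensional subspaces, and $\operatorname{Aut}(\mathbb A^n)$ is identified with the closed subset $\{(\alpha,\beta)\mid\alpha\circ\beta=\beta\circ\alpha=\operatorname{id}\}$ of $\operatorname{End}(\mathbb A^n)\times\operatorname{End}(\mathbb A^n)$. The homomorphism $\operatorname{jac}:\operatorname{Aut}(\mathbb A^n)\to\Bbbk^*$ is $\operatorname{jac}(\mathbf f)=\det\left(\frac{\partial f_i}{\partial x_j}\right)_{(i,j)}$, and $\operatorname{SAut}(\mathbb A^n):=\ker(\operatorname{jac})$, a closed normal subgroup. A homomorphism of ind-groups $\phi:\mathcal H\to\mathcal G$ is a closed immersion if $\phi(\mathcal H)\subseteq\mathcal G$ is a closed ind-subgroup and $\phi:\mathcal H\to\phi(\mathcal H)$ is an isomorphism of ind-groups. A homomorphism is nontrivial if it is not the constant map to $e$. *)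

(* Defs.v *)
From HB Require Import structures.
From mathcomp Require Import all_boot all_algebra.
From mathcomp Require Import boolp classical_sets.
From mathcomp Require Import mpoly.

Set Implicit Arguments.
Unset Strict Implicit.
Unset Printing Implicit Defensive.

Import GRing.Theory.
Local Open Scope ring_scope.
Local Open Scope classical_set_scope.

(* Varieties are spaces with functions, as in Serre's FAC.  All objects are
   subsets of an ambient type [T].  A regular function on an open set [U] is a
   function on [T] of which only the restriction to [U] matters; likewise a map
   is a function between ambient types of which only the restriction to the
   carrier matters. *)

Section Varieties.
Variable k : fieldType.

Record kspace (T : Type) := KSpace {
  carrier : set T;
  kopen : set (set T);
  kreg : set T -> set (T -> k)
}.

Section OneSpace.
Variables (T : Type) (X : kspace T).

Definition kclosed (Z : set T) : Prop :=
  Z `<=` carrier X /\ kopen X (carrier X `\` Z).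

(* [kopen] is a topology on the carrier, [kreg] a sheaf of functions. *)
Record is_kspace : Prop := IsKSpace {
  kopen_sub : forall U, kopen X U -> U `<=` carrier X;
  kopenT : kopen X (carrier X);
  kopenI : forall U V, kopen X U -> kopen X V -> kopen X (U `&` V);
  kopen_bigcup : forall F : set (set T),
    F `<=` kopen X -> kopen X (\bigcup_(U in F) U);
  kreg_open : forall U f, kreg X U f -> kopen X U;
  kreg_restr : forall U V f,
    kreg X U f -> kopen X V -> V `<=` U -> kreg X V f;
  kreg_glue : forall U f, kopen X U ->
    (forall x, U x -> exists V h,
       [/\ kreg X V h, V x, V `<=` U & forall y, V y -> f y = h y]) ->
    kreg X U f
}.

End OneSpace.

Definition kmorphism (T1 T2 : Type) (X : kspace T1) (Y : kspace T2)
    (f : T1 -> T2) : Prop :=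
  [/\ forall x, carrier X x -> carrier Y (f x),
      forall V, kopen Y V -> kopen X (carrier X `&` f @^-1` V)
    & forall V h, kreg Y V h -> kreg X (carrier X `&` f @^-1` V) (h \o f)].

Definition kiso (T1 T2 : Type) (X : kspace T1) (Y : kspace T2)
    (f : T1 -> T2) : Prop :=
  kmorphism X Y f /\
  exists g : T2 -> T1,
    [/\ kmorphism Y X g,
        forall x, carrier X x -> g (f x) = x
      & forall y, carrier Y y -> f (g y) = y].

(* The structure induced on [S] by a map [e] to [Y] that is injective on [S]:
   the one for which [S] is identified with the subspace [e @` S] of [Y]. *)
Definition kinduced (T T' : Type) (S : set T) (e : T -> T') (Y : kspace T') :
    kspace T :=
  let C := S `&` e @^-1` carrier Y in
  let op := [set W | exists2 V, kopen Y V & W = C `&` e @^-1` V] in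
  KSpace C op
    (fun W => [set f | op W /\ forall x, W x -> exists V h,
       [/\ kreg Y V h, V (e x) & forall y, W y -> V (e y) -> f y = h (e y)]]).

Definition ksub (T : Type) (X : kspace T) (S : set T) : kspace T :=
  kinduced S id X.

(* Functions (x, y) |-> \sum_i f_i(x) g_i(y) on [U `*` V]. *)
Definition ktensor (T1 T2 : Type) (X : kspace T1) (Y : kspace T2)
    (U : set T1) (V : set T2) (h : T1 * T2 -> k) : Prop :=
  exists (m : nat) (f : 'I_m -> T1 -> k) (g : 'I_m -> T2 -> k),
    (forall i, kreg X U (f i) /\ kreg Y V (g i)) /\
    h = fun p => \sum_(i < m) f i p.1 * g i p.2.

(* The product of varieties: its topology has as a basis the nonvanishing
   loci of the functions [ktensor] on products of open sets, and its regular
   functions are locally quotients of these. *)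
Definition kprod (T1 T2 : Type) (X : kspace T1) (Y : kspace T2) :
    kspace (T1 * T2) :=
  let C := carrier X `*` carrier Y in
  let op := [set W | W `<=` C /\ forall p, W p -> exists U V h,
    [/\ kopen X U, kopen Y V, ktensor X Y U V h, (U `*` V) p /\ h p != 0
      & forall q, (U `*` V) q -> h q != 0 -> W q]] in
  KSpace C op
    (fun W => [set f | op W /\ forall p, W p -> exists U V h h',
       [/\ kopen X U, kopen Y V, ktensor X Y U V h /\ ktensor X Y U V h',
           (U `*` V) p /\ h' p != 0
         & forall q, W q -> (U `*` V) q -> h' q != 0 -> f q = h q / h' q]]).

(* The affine space with coordinates indexed by [I], Zariski topology. *)
Definition poly_eval (I : finType) (p : {mpoly k[#|I|]}) (v : {ffun I -> k}) :
  k := p.@[fun i => v (enum_val i)].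

Definition affine_space (I : finType) : kspace {ffun I -> k} :=
  let op := [set U : set {ffun I -> k} | exists P : set {mpoly k[#|I|]},
    U = [set v | exists2 p, P p & poly_eval p v != 0]] in
  KSpace setT op
    (fun U => [set f | op U /\ forall x, U x -> exists p q,
       poly_eval q x != 0 /\
       forall y, U y -> poly_eval q y != 0 ->
         f y = poly_eval p y / poly_eval q y]).

Definition is_affine (T : Type) (X : kspace T) : Prop :=
  exists (I : finType) (Z : set {ffun I -> k}) (e : T -> {ffun I -> k}),
    kclosed (affine_space I) Z /\ kiso X (ksub (affine_space I) Z) e.

(* Varieties need be neither affine nor irreducible. *)
Definition is_variety (T : Type) (X : kspace T) : Prop :=
  [/\ is_kspace X,
      exists (m : nat) (U : 'I_m -> set T),
        (forall i, kopen X (U i) /\ is_affine (ksub X (U i))) /\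
        carrier X = \bigcup_(i in setT) U i
    & kclosed (kprod X X) [set p | carrier X p.1 /\ p.1 = p.2]].

Definition indspace (T : Type) := nat -> kspace T.

Definition ind_carrier (T : Type) (V : indspace T) : set T :=
  \bigcup_(d in setT) carrier (V d).

(* [V d] is a closed subvariety of [V d.+1]. *)
Definition is_indvariety (T : Type) (V : indspace T) : Prop :=
  forall d, [/\ is_variety (V d), kclosed (V d.+1) (carrier (V d))
              & V d = ksub (V d.+1) (carrier (V d))].

Definition ind_closed (T : Type) (V : indspace T) (S : set T) : Prop :=
  S `<=` ind_carrier V /\ forall d, kclosed (V d) (S `&` carrier (V d)).

Definition ind_sub (T : Type) (V : indspace T) (S : set T) : indspace T :=
  fun d => ksub (V d) S.

Definition ind_induced (T T' : Type) (S : set T) (e : T -> T')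
    (V : indspace T') : indspace T := fun d => kinduced S e (V d).

Definition ind_prod (T1 T2 : Type) (V : indspace T1) (W : indspace T2) :
  indspace (T1 * T2) := fun d => kprod (V d) (W d).

Definition ind_morphism (T1 T2 : Type) (V : indspace T1) (W : indspace T2)
    (f : T1 -> T2) : Prop :=
  forall d, exists m, kmorphism (V d) (W m) f.

Definition ind_iso (T1 T2 : Type) (V : indspace T1) (W : indspace T2)
    (f : T1 -> T2) : Prop :=
  ind_morphism V W f /\
  exists g : T2 -> T1,
    [/\ ind_morphism W V g,
        forall x, ind_carrier V x -> g (f x) = x
      & forall y, ind_carrier W y -> f (g y) = y].

(* The underlying group of an ind-group is a subgroup of the ambient group
   [gT].  Closure under the operations is part of their being morphisms. *)
Definition is_indgroup (gT : groupType) (G : indspace gT) : Prop :=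
  [/\ is_indvariety G, ind_carrier G 1%g,
      ind_morphism (ind_prod G G) G (fun p => (p.1 * p.2)%g)
    & ind_morphism G G (fun x => (x^-1)%g)].

Definition ind_hom (hT gT : groupType) (H : indspace hT) (G : indspace gT)
    (phi : hT -> gT) : Prop :=
  ind_morphism H G phi /\
  forall x y, ind_carrier H x -> ind_carrier H y ->
    phi (x * y)%g = (phi x * phi y)%g.

Definition ind_group_iso (hT gT : groupType) (H : indspace hT)
    (G : indspace gT) (phi : hT -> gT) : Prop :=
  ind_hom H G phi /\ ind_iso H G phi.

Definition closed_ind_subgroup (gT : groupType) (G : indspace gT)
    (S : set gT) : Prop :=
  [/\ ind_closed G S, S 1%g, forall x y, S x -> S y -> S (x * y)%g
    & forall x, S x -> S (x^-1)%g].

Definition closed_immersion (hT gT : groupType) (H : indspace hT)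
    (G : indspace gT) (phi : hT -> gT) : Prop :=
  let S := phi @` ind_carrier H in
  closed_ind_subgroup G S /\ ind_group_iso H (ind_sub G S) phi.

Definition nontrivial_hom (hT gT : groupType) (H : indspace hT)
    (phi : hT -> gT) : Prop :=
  exists2 x, ind_carrier H x & phi x <> 1%g.

End Varieties.

Section MultiplicativeGroup.
Variable k : fieldType.

Record kstar := KStar { kstar_val :> k; kstar_neq0 : kstar_val != 0 }.

HB.instance Definition _ := [isSub for kstar_val].
HB.instance Definition _ := [Choice of kstar by <:].

Definition kstar_mul (x y : kstar) : kstar :=
  KStar (mulf_neq0 (kstar_neq0 x) (kstar_neq0 y)).

Lemma kstar_inv_subproof (x : kstar) : (x : k)^-1 != 0.
Proof. by rewrite invr_eq0 kstar_neq0. Qed.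

Definition kstar_inv (x : kstar) : kstar := KStar (kstar_inv_subproof x).
Definition kstar_one : kstar := KStar (oner_neq0 k).

Lemma kstar_mulA : associative kstar_mul.
Proof. by move=> x y z; apply: val_inj; rewrite /= mulrA. Qed.
Lemma kstar_mul1 : left_id kstar_one kstar_mul.
Proof. by move=> x; apply: val_inj; rewrite /= mul1r. Qed.
Lemma kstar_mulr1 : right_id kstar_one kstar_mul.
Proof. by move=> x; apply: val_inj; rewrite /= mulr1. Qed.
Lemma kstar_mulV : left_inverse kstar_one kstar_inv kstar_mul.
Proof. by move=> x; apply: val_inj; rewrite /= mulVf ?kstar_neq0. Qed.
Lemma kstar_mulrV : right_inverse kstar_one kstar_inv kstar_mul.
Proof. by move=> x; apply: val_inj; rewrite /= mulfV ?kstar_neq0. Qed.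

HB.instance Definition _ := isGroup.Build kstar
  kstar_mulA kstar_mul1 kstar_mulr1 kstar_mulV kstar_mulrV.

(* An open subvariety of the affine line. *)
Definition Gm : indspace k kstar :=
  fun _ => kinduced setT (fun x : kstar => [ffun=> val x])
             (affine_space k 'I_1).

End MultiplicativeGroup.

Section PolynomialAutomorphisms.
Variables (k : fieldType) (n : nat).

Definition endo := n.-tuple {mpoly k[n]}.

Definition endo_comp (f g : endo) : endo := [tuple tnth f i \mPo g | i < n].
Definition endo_id : endo := [tuple 'X_i | i < n].

Lemma endo_compE (f g : endo) i :
  tnth (endo_comp f g) i = tnth f i \mPo g.
Proof. by rewrite tnth_mktuple. Qed.

Lemma comp_mpoly_comp (p : {mpoly k[n]}) (f g : endo) :
  (p \mPo f) \mPo g = p \mPo endo_comp f g.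
Proof.
elim/mpolyind: p => [|c m p _ _ IH]; first by rewrite !comp_mpoly0.
rewrite !comp_mpolyD IH !comp_mpolyZ; congr (c *: _ + _).
rewrite !comp_mpolyX rmorph_prod; apply: eq_bigr => i _.
by rewrite rmorphXn /= endo_compE.
Qed.

Lemma endo_compA : associative endo_comp.
Proof.
by move=> f g h; apply: eq_from_tnth => i; rewrite !endo_compE comp_mpoly_comp.
Qed.

Lemma endo_comp_idl : left_id endo_id endo_comp.
Proof.
move=> f; apply: eq_from_tnth => i.
by rewrite endo_compE tnth_mktuple comp_mpolyXU -tnth_nth.
Qed.

Lemma endo_comp_idr : right_id endo_id endo_comp.
Proof.
by move=> f; apply: eq_from_tnth => i; rewrite endo_compE comp_mpoly_id.
Qed.

(* An automorphism is the pair of itself and its inverse. *)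
Record autA := AutA {
  autA_val :> endo * endo;
  autA_subproof : (endo_comp autA_val.1 autA_val.2 == endo_id) &&
                  (endo_comp autA_val.2 autA_val.1 == endo_id)
}.

HB.instance Definition _ := [isSub for autA_val].
HB.instance Definition _ := [Choice of autA by <:].

Lemma autAr (f : autA) : endo_comp f.1 f.2 = endo_id.
Proof. by case/andP: (autA_subproof f) => /eqP. Qed.
Lemma autAl (f : autA) : endo_comp f.2 f.1 = endo_id.
Proof. by case/andP: (autA_subproof f) => _ /eqP. Qed.

Lemma autA_mul_subproof (f g : autA) :
  let p := (endo_comp f.1 g.1, endo_comp g.2 f.2) in
  (endo_comp p.1 p.2 == endo_id) && (endo_comp p.2 p.1 == endo_id).
Proof.
apply/andP; split; apply/eqP => /=.
  by rewrite -endo_compA [endo_comp g.1 _]endo_compA autAr endo_comp_idl autAr.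
by rewrite -endo_compA [endo_comp f.2 _]endo_compA autAl endo_comp_idl autAl.
Qed.

Lemma autA_inv_subproof (f : autA) :
  let p := (f.2, f.1) in
  (endo_comp p.1 p.2 == endo_id) && (endo_comp p.2 p.1 == endo_id).
Proof. by rewrite /= autAr autAl !eqxx. Qed.

Lemma autA_one_subproof :
  let p := (endo_id, endo_id) in
  (endo_comp p.1 p.2 == endo_id) && (endo_comp p.2 p.1 == endo_id).
Proof. by rewrite /= endo_comp_idl eqxx. Qed.

Definition autA_mul (f g : autA) : autA := AutA (autA_mul_subproof f g).
Definition autA_inv (f : autA) : autA := AutA (autA_inv_subproof f).
Definition autA_one : autA := AutA autA_one_subproof.

Lemma autA_mulA : associative autA_mul.
Proof. by move=> f g h; apply: val_inj; rewrite /= !endo_compA. Qed.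
Lemma autA_mul1 : left_id autA_one autA_mul.
Proof.
move=> f; apply: val_inj; rewrite /= endo_comp_idl endo_comp_idr.
by case: (val f).
Qed.
Lemma autA_mulr1 : right_id autA_one autA_mul.
Proof.
move=> f; apply: val_inj; rewrite /= endo_comp_idl endo_comp_idr.
by case: (val f).
Qed.
Lemma autA_mulV : left_inverse autA_one autA_inv autA_mul.
Proof. by move=> f; apply: val_inj; rewrite /= autAl. Qed.
Lemma autA_mulrV : right_inverse autA_one autA_inv autA_mul.
Proof. by move=> f; apply: val_inj; rewrite /= autAr. Qed.

HB.instance Definition _ := isGroup.Build autA
  autA_mulA autA_mul1 autA_mulr1 autA_mulV autA_mulrV.

(* The filtration of the endomorphisms by degree: [endo_coefs d f] lists the
   coefficients of [f] of degree at most [d]. *)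
Definition endo_coefs (d : nat) (f : endo) :
    {ffun 'I_n * 'X_{1..n < d.+1} -> k} :=
  [ffun p : 'I_n * 'X_{1..n < d.+1} => (tnth f p.1)@_(p.2)].

Definition EndA : indspace k endo :=
  fun d => kinduced [set f : endo | forall i, (msize (tnth f i) <= d.+1)%N]
             (endo_coefs d) (affine_space k ('I_n * 'X_{1..n < d.+1})%type).

Definition Aut : indspace k autA :=
  ind_induced setT autA_val (ind_prod EndA EndA).

Definition jacobian (f : endo) : {mpoly k[n]} :=
  \det (\matrix_(i < n, j < n) (tnth f i)^`M(j)).

Lemma mderivXU i j : ('X_i : {mpoly k[n]})^`M(j) = (i == j)%:R.
Proof.
rewrite mderivX mnm1E; case: eqVneq => [->|_]; last by rewrite scale0r.
by rewrite -{1}[U_(j)%MM]add0m addmK mpolyX0 scale1r.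
Qed.

Lemma mderiv_comp (p : {mpoly k[n]}) (g : endo) j :
  (p \mPo g)^`M(j) = \sum_(i < n) (p^`M(i) \mPo g) * (tnth g i)^`M(j).
Proof.
pose D (q : {mpoly k[n]}) := \sum_(i < n) (q^`M(i) \mPo g) * (tnth g i)^`M(j).
have DZD c q r : D (c *: q + r) = c *: D q + D r.
  rewrite /D scaler_sumr -big_split /=; apply: eq_bigr => i _.
  by rewrite mderivD mderivZ comp_mpolyD comp_mpolyZ mulrDl scalerAl.
have DM q r : D (q * r) = D q * (r \mPo g) + (q \mPo g) * D r.
  rewrite /D mulr_suml mulr_sumr -big_split /=; apply: eq_bigr => i _.
  by rewrite mderivM comp_mpolyD !rmorphM mulrDl -!mulrA [X in _ * X + _]mulrC.
have D1 : D 1 = 0.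
  by rewrite /D big1 // => i _; rewrite -mpolyC1 mderivC comp_mpoly0 mul0r.
have D0 : D 0 = 0.
  by rewrite /D big1 // => i _; rewrite mderiv0 comp_mpoly0 mul0r.
have DX i : D 'X_i = (tnth g i)^`M(j).
  rewrite /D (bigD1 i) //= mderivXU eqxx rmorph1 mul1r.
  rewrite big1 ?addr0 // => l /negPf nli.
  by rewrite mderivXU eq_sym nli rmorph0 mul0r.
rewrite -[RHS]/(D p); elim/mpolyind: p => [|c m p _ _ IH].
  by rewrite D0 comp_mpoly0 mderiv0.
rewrite DZD comp_mpolyD mderivD IH comp_mpolyZ mderivZ; congr (c *: _ + _).
rewrite mpolyXE_id; elim/big_rec: _ => [|i q _ IHq].
  by rewrite D1 comp_mpoly1 -mpolyC1 mderivC.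
rewrite DM rmorphM mderivM IHq; congr (_ * _ + _ * _).
elim: (m i) => [|e IHe]; first by rewrite !expr0 D1 rmorph1 -mpolyC1 mderivC.
by rewrite !exprS DM rmorphM mderivM IHe DX /= comp_mpolyXU -tnth_nth.
Qed.

Lemma jacobian_id : jacobian endo_id = 1.
Proof.
rewrite /jacobian -[RHS](@det1 _ n); congr (\det _).
by apply/matrixP => i j; rewrite !mxE tnth_mktuple mderivXU.
Qed.

Lemma jacobian_comp (f g : endo) :
  jacobian (endo_comp f g) = (jacobian f \mPo g) * jacobian g.
Proof.
rewrite /jacobian -det_map_mx -det_mulmx; congr (\det _).
apply/matrixP => i j; rewrite !mxE endo_compE mderiv_comp.
by apply: eq_bigr => l _; rewrite !mxE.
Qed.

Lemma jacobian_autA (f : autA) :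
  (jacobian f.1 == ((jacobian f.1)@_0)%:MP) && ((jacobian f.1)@_0 != 0).
Proof.
have := mpoly_intro_unit (etrans (esym (jacobian_comp f.2 f.1))
          (etrans (congr1 jacobian (autAl f)) jacobian_id)).
by case/andP => ->; rewrite unitfE.
Qed.

Lemma jac_subproof (f : autA) : (jacobian f.1)@_0 != 0.
Proof. by case/andP: (jacobian_autA f). Qed.

(* The Jacobian determinant is constant by [jacobian_autA], hence equal to
   its coefficient at 0. *)
Definition jac (f : autA) : kstar k := KStar (jac_subproof f).

Lemma jacE (f : autA) : jacobian f.1 = (jac f : k)%:MP.
Proof. by case/andP: (jacobian_autA f) => /eqP. Qed.

Definition SAut : indspace k autA := ind_sub Aut [set f | jac f = 1%g].

End PolynomialAutomorphisms.

Definition factors_through_jac (k : fieldType) (n : nat) (gT : groupType)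
    (G : indspace k gT) (phi : autA k n -> gT) : Prop :=
  exists2 psi : kstar k -> gT,
    ind_hom (Gm k) G psi & forall f, phi f = psi (jac f).

(* Main.v *)
(* Let [phi] be a homomorphism to [G], regular on each piece of the filtration.

   If [phi] is trivial on all translations, the velocities at [1] of the curves
   that [phi] maps to curves with zero velocity form a linear space of vector
   fields, stable under conjugation; from the constant fields it grows to all
   divergence-free fields.  In characteristic zero a curve with zero velocity
   everywhere is constant, so [phi] is constant along the curves of [SAut].
   The curve [s^-1 f (s x)] joins [f] to its linear part at [0], and a curve in
   [SL_n] joins that to the identity: [phi] is trivial on [SAut], and on [Aut]
   it factors through [jac].

   Otherwise let [u] be a curve with [u 0 = 1] and velocity the field [x_j d_i]
   or the constant field [d_i].  The velocity at [0] of [phi (f^-1 u f)] is a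
   regular function of [phi f].  It determines the velocity of [f^-1 u f]:
   combinations of such fields that [phi] kills form a translation-stable space,
   and if it were not zero it would contain a constant field, hence [phi] would
   kill a translation, and by conjugation with [SL_n] all of them.  The
   velocities of the [f^-1 u f] are the inverse Jacobian matrix of [f] and its
   product with [f_j]; they yield [f], of bounded degree, as a regular function
   of [phi f], and this makes [phi] a closed immersion.

   The fields [x_j d_i] with [i <> j] have divergence zero, so this covers all
   cases except [SAut] of the affine line.  Its elements are the translations,
   and for a regular function [h] on [G] near [1] the function [h (phi(t) y)]
   of [t] is rational with coefficients regular in [y]; for [y = phi(s)] it is
   a translate by [s] of a fixed rational function, from which [s] is recovered
   by linear algebra. *)
Require Import Defs.
From HB Require Import structures.
From mathcomp Require Import all_boot all_algebra.
From mathcomp Require Import boolp classical_sets.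
From mathcomp Require Import perm mpoly ring.

Set Implicit Arguments.
Unset Strict Implicit.
Unset Printing Implicit Defensive.

Import GRing.Theory.
Local Open Scope ring_scope.
Local Open Scope classical_set_scope.

(** * Spaces with functions *)

(** Tangent spaces of [G] are never formed. A tangent vector is a finite combination
    [\sum_j a j * der (s j) (h \o c j)] of derivatives along rational curves, tested on all
    functions [h] regular near the point, on every piece of the filtration; injectivity of the
    differential of [phi] on certain velocities is then a statement about linear relations.
    Regularity of the inverse comes from it by a finiteness argument. For [g] in [G d], the velocity
    at 1 of [g^-1 * phi (u t) * g] has finitely many coordinates in one chart around 1, good for all
    [g] at once since every such curve passes through 1 at [t = 0]. Hence there are finitely many
    [f_r] such that, for [g = phi f], these coordinates are a combination of those for the [f_r],
    with coefficients linear in the coordinates and so regular in [g]. Injectivity transports the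
    relation to vector fields: those of all [f] with [phi f] in [G d] lie in the span of finitely
    many fixed ones, which yields the degree bound together with the regularity. *)

Section GoodSpaces.
Variable k : fieldType.

(* The properties of a variety that its products and subspaces inherit: the
   regular functions form rings, with open nonvanishing loci on which they are
   invertible. *)
Record is_ringed (T : Type) (X : kspace k T) : Prop := IsRinged {
  ringed_space : is_kspace X;
  ringed_cst : forall U c, kopen X U -> kreg X U (fun=> c);
  ringed_add : forall U f g,
    kreg X U f -> kreg X U g -> kreg X U (fun x => f x + g x);
  ringed_mul : forall U f g,
    kreg X U f -> kreg X U g -> kreg X U (fun x => f x * g x);
  ringed_neq0 : forall U f,
    kreg X U f -> kopen X [set x | U x /\ f x != 0];
  ringed_inv : forall U f,
    kreg X U f -> kreg X [set x | U x /\ f x != 0] (fun x => (f x)^-1)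
}.

Section Basic.
Variables (T : Type) (X : kspace k T).
Hypothesis Xs : is_kspace X.

Lemma kopen_local W :
  (forall x, W x -> exists V, [/\ kopen X V, V x & V `<=` W]) -> kopen X W.
Proof.
move=> WP; suff -> : W = \bigcup_(V in [set V | kopen X V /\ V `<=` W]) V.
  by apply: kopen_bigcup => // V [].
apply/seteqP; split => [x /WP[V [oV Vx VW]]|x [V [_ VW] /VW //]].
by exists V.
Qed.

Lemma kopen0 : kopen X set0.
Proof. by apply: kopen_local => x []. Qed.

Lemma kreg_eq U f g : kreg X U f -> (forall x, U x -> f x = g x) -> kreg X U g.
Proof.
move=> fU fg; apply: kreg_glue => // [|x Ux]; first exact: kreg_open fU.
by exists U, f; split => // y Uy; rewrite fg.
Qed.

Lemma kreg_local U f :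
  (forall x, U x -> exists V h,
     [/\ kreg X V h, V x, V `<=` U & forall y, V y -> f y = h y]) ->
  kreg X U f.
Proof.
move=> H; apply: kreg_glue => //; apply: kopen_local => x /H[V [h [hV Vx VU _]]].
by exists V; split => //; apply: kreg_open hV.
Qed.

Lemma kclosedP Z : kclosed X Z <-> Z `<=` carrier X /\
  forall x, carrier X x -> ~ Z x ->
    exists V, [/\ kopen X V, V x & forall y, V y -> ~ Z y].
Proof.
split=> [[ZX oZ]|[ZX H]]; split => //.
  by move=> x Cx Zx; exists (carrier X `\` Z); split => // y [].
apply: kopen_local => x [Cx Zx]; have [V [oV Vx VZ]] := H x Cx Zx.
by exists V; split => // y Vy; split; [apply: kopen_sub Vy|apply: VZ].
Qed.

End Basic.

Section Ringed.
Variables (T : Type) (X : kspace k T).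
Hypothesis Xr : is_ringed X.
Let Xs := ringed_space Xr.

Lemma ringed_opp U f : kreg X U f -> kreg X U (fun x => - f x).
Proof.
move=> fU; apply: (kreg_eq Xs (f := fun x => (-1) * f x)) => [|x _].
  by apply: (ringed_mul Xr) => //; apply: (ringed_cst Xr) => //; apply: kreg_open fU.
by rewrite mulN1r.
Qed.

Lemma ringed_sub U f g :
  kreg X U f -> kreg X U g -> kreg X U (fun x => f x - g x).
Proof. by move=> fU gU; apply: (ringed_add Xr) => //; apply: ringed_opp. Qed.

Lemma ringed_exp U f d : kreg X U f -> kreg X U (fun x => f x ^+ d).
Proof.
move=> fU; elim: d => [|d IHd].
  by apply: (ringed_cst Xr) => //; apply: kreg_open fU.
by apply: (kreg_eq Xs (ringed_mul Xr fU IHd)) => x _; rewrite exprS.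
Qed.

Lemma ringed_sum (I : Type) (r : seq I) (P : pred I) U (F : I -> T -> k) :
  kopen X U -> (forall i, kreg X U (F i)) ->
  kreg X U (fun x => \sum_(i <- r | P i) F i x).
Proof.
move=> oU FU; elim: r => [|i r IHr].
  by apply: (kreg_eq Xs (ringed_cst Xr 0 oU)) => x _; rewrite big_nil.
case Pi: (P i); last by apply: (kreg_eq Xs IHr) => x _; rewrite big_cons Pi.
by apply: (kreg_eq Xs (ringed_add Xr (FU i) IHr)) => x _; rewrite big_cons Pi.
Qed.

Lemma ringed_prod (I : Type) (r : seq I) (P : pred I) U (F : I -> T -> k) :
  kopen X U -> (forall i, kreg X U (F i)) ->
  kreg X U (fun x => \prod_(i <- r | P i) F i x).
Proof.
move=> oU FU; elim: r => [|i r IHr].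
  by apply: (kreg_eq Xs (ringed_cst Xr 1 oU)) => x _; rewrite big_nil.
case Pi: (P i); last by apply: (kreg_eq Xs IHr) => x _; rewrite big_cons Pi.
by apply: (kreg_eq Xs (ringed_mul Xr (FU i) IHr)) => x _; rewrite big_cons Pi.
Qed.

Lemma ringed_meval n (p : {mpoly k[n]}) U (c : 'I_n -> T -> k) :
  kopen X U -> (forall i, kreg X U (c i)) ->
  kreg X U (fun x => p.@[fun i => c i x]).
Proof.
move=> oU cU; under eq_fun do rewrite mevalE.
apply: ringed_sum => // m; apply: (ringed_mul Xr); first exact: (ringed_cst Xr).
by apply: ringed_prod => // i; apply: ringed_exp.
Qed.

Lemma ringed_div U f g : kreg X U f -> kreg X U g ->
  kreg X [set x | U x /\ g x != 0] (fun x => f x / g x).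
Proof.
move=> fU gU; apply: (ringed_mul Xr) => //; last exact: (ringed_inv Xr).
by apply: (kreg_restr Xs fU) => //; [apply: (ringed_neq0 Xr)|move=> x []].
Qed.

Lemma ringed_det U n (A : T -> 'M[k]_n) :
  kopen X U -> (forall i j, kreg X U (fun x => A x i j)) ->
  kreg X U (fun x => \det (A x)).
Proof.
move=> oU AU; rewrite /determinant.
apply: ringed_sum => // s; apply: (ringed_mul Xr); first exact: (ringed_cst Xr).
by apply: ringed_prod.
Qed.

Lemma ringed_adj U n (A : T -> 'M[k]_n) i j :
  kopen X U -> (forall i j, kreg X U (fun x => A x i j)) ->
  kreg X U (fun x => (\adj (A x)) i j).
Proof.
move=> oU AU; under eq_fun do rewrite mxE /cofactor.
apply: (ringed_mul Xr) => //; first exact: (ringed_cst Xr).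
by apply: ringed_det => // a b; under eq_fun do rewrite !mxE.
Qed.

End Ringed.

Section AffineSpace.
Variable I : finType.
Local Notation aff := (affine_space k I).

Lemma affine_openP (U : set {ffun I -> k}) : kopen aff U <->
  (forall v, U v -> exists2 p : {mpoly k[#|I|]}, poly_eval p v != 0 &
     forall w, poly_eval p w != 0 -> U w).
Proof.
split=> [[P ->] v [p Pp pv]|H]; first by exists p => // w pw; exists p.
exists [set p | forall w, poly_eval p w != 0 -> U w].
by apply/seteqP; split => [v /H[p pv pU]|v [p pU /pU//]]; exists p.
Qed.

Lemma poly_evalM (p q : {mpoly k[#|I|]}) v :
  poly_eval (p * q) v = poly_eval p v * poly_eval q v.
Proof. exact: mevalM. Qed.

Lemma affine_kspace : is_kspace aff.
Proof.
split=> //.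
- apply/affine_openP => v _; exists 1 => //.
  by rewrite /poly_eval meval1 oner_neq0.
- move=> U V /affine_openP oU /affine_openP oV; apply/affine_openP.
  move=> v [/oU[p pv pU] /oV[q qv qV]]; exists (p * q).
    by rewrite poly_evalM mulf_neq0.
  by move=> w; rewrite poly_evalM mulf_eq0 negb_or => /andP[/pU ? /qV ?].
- move=> F FO; apply/affine_openP => v [U FU Uv].
  have /affine_openP/(_ v Uv)[p pv pU] := FO _ FU.
  by exists p => // w /pU ?; exists U.
- by move=> U f [].
- move=> U V f [oU fU] oV VU; split => // x /VU/fU[p [q [qx H]]].
  by exists p, q; split => // y /VU; apply: H.
- move=> U f oU H; split => // x Ux.
  have [V [h [[/affine_openP oV hV] Vx VU fh]]] := H x Ux.
  have [c cx cV] := oV x Vx; have [p [q [qx hpq]]] := hV x Vx.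
  (* The extra factor [c] makes nonvanishing of the denominator imply membership in [V], where the
     fraction represents [h]. *)
  exists (p * c), (q * c); rewrite poly_evalM mulf_neq0 //; split => // y Uy.
  rewrite !poly_evalM mulf_eq0 negb_or => /andP[qy cy].
  by rewrite fh ?hpq //; [rewrite -mulf_div divff // mulr1|exact: cV..].
Qed.

Lemma affine_neq0 U f :
  kreg aff U f -> kopen aff [set x | U x /\ f x != 0].
Proof.
move=> [/affine_openP oU fU]; apply/affine_openP => v [Uv fv].
have [c cv cU] := oU v Uv; have [p [q [qv fpq]]] := fU v Uv.
have pv : poly_eval p v != 0.
  by apply: contraNneq fv => pv; rewrite fpq // pv mul0r.
exists (c * (p * q)); first by rewrite !poly_evalM !mulf_neq0.
move=> w; rewrite !poly_evalM !mulf_eq0 !negb_or => /andP[/cU Uw /andP[pw qw]].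
by split => //; rewrite fpq // mulf_neq0 ?invr_neq0.
Qed.

Lemma affine_ringed : is_ringed aff.
Proof.
split.
- exact: affine_kspace.
- move=> U c oU; split => // x Ux; exists c%:MP, 1.
  rewrite /poly_eval meval1 oner_neq0; split => // y _ _.
  by rewrite meval1 mevalC divr1.
- move=> U f g [oU fU] [_ gU]; split => // x Ux.
  have [p [q [qx fpq]]] := fU x Ux; have [p' [q' [qx' gpq]]] := gU x Ux.
  exists (p * q' + p' * q), (q * q'); rewrite poly_evalM mulf_neq0 //.
  split => // y Uy; rewrite poly_evalM mulf_eq0 negb_or => /andP[qy qy'].
  by rewrite fpq // gpq // addf_div // /poly_eval mevalD !mevalM.
- move=> U f g [oU fU] [_ gU]; split => // x Ux.
  have [p [q [qx fpq]]] := fU x Ux; have [p' [q' [qx' gpq]]] := gU x Ux.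
  exists (p * p'), (q * q'); rewrite poly_evalM mulf_neq0 //.
  split => // y Uy; rewrite !poly_evalM mulf_eq0 negb_or => /andP[qy qy'].
  by rewrite fpq // gpq // mulf_div.
- exact: affine_neq0.
- move=> U f fU; split; first exact: affine_neq0.
  move=> x [Ux fx]; have [p [q [qx fpq]]] := fU.2 x Ux.
  have px : poly_eval p x != 0.
    by apply: contraNneq fx => px; rewrite fpq // px mul0r.
  exists (q * q), (p * q); rewrite poly_evalM mulf_neq0 //; split => // y.
  case=> Uy fy; rewrite !poly_evalM mulf_eq0 negb_or => /andP[py qy].
  by rewrite fpq // invf_div -mulf_div divff // mulr1.
Qed.

Lemma affine_coord (i : I) : kreg aff setT (fun v => v i).
Proof.
split; first exact: kopenT affine_kspace.
move=> x _; exists 'X_(enum_rank i), 1; rewrite /poly_eval meval1 oner_neq0.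
by split => // y _ _; rewrite mevalXU enum_rankK meval1 divr1.
Qed.

End AffineSpace.

Section Induced.
Variables (T T' : Type) (S : set T) (e : T -> T') (Y : kspace k T').
Local Notation X := (kinduced S e Y).

Lemma kinduced_openP : is_kspace Y -> forall W, kopen X W <->
  W `<=` carrier X /\ (forall x, W x -> exists V,
    [/\ kopen Y V, V (e x) & forall y, carrier X y -> V (e y) -> W y]).
Proof.
move=> Ys W; split=> [[V oV ->]|[WX H]]; first by split=> [x|x] [Cx Vx] //; exists V.
exists (\bigcup_(V in [set V | kopen Y V /\
          forall y, carrier X y -> V (e y) -> W y]) V).
  by apply: kopen_bigcup => // V [].
apply/seteqP; split=> [x Wx|x [Cx [V [_ VW] Vx]]]; last exact: VW.
split; first exact: WX.
by have [V [oV Vx VW]] := H x Wx; exists V.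
Qed.

Lemma kinduced_kspace : is_kspace Y -> is_kspace X.
Proof.
move=> Ys; have oP := kinduced_openP Ys.
have regP U f : kopen X U -> (forall x, U x -> exists V h,
    [/\ kreg Y V h, V (e x) & forall y, U y -> V (e y) -> f y = h (e y)]) ->
  kreg X U f by [].
split.
- by move=> U /oP[].
- apply/oP; split => // x Cx; exists (carrier Y); split; first exact: kopenT.
    by case: Cx.
  by [].
- move=> U V /oP[UX oU] /oP[VX oV]; apply/oP; split => [x [/UX]//|x [Ux Vx]].
  have [U' [oU' Ux' UU]] := oU x Ux; have [V' [oV' Vx' VV]] := oV x Vx.
  exists (U' `&` V'); split => //; first exact: kopenI.
  by move=> y Cy [/UU ? /VV ?]; split; auto.
- move=> F FO; apply/oP; split => [x [U /FO/oP[UX _] /UX //]|x [U FU Ux]].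
  have /oP[_ /(_ x Ux)[V [oV Vx VU]]] := FO _ FU.
  by exists V; split => // y Cy Vy; exists U => //; apply: VU.
- by move=> U f [].
- move=> U V f [oU fU] oV VU; apply: regP => // x /VU/fU[W [h [hW Wx fh]]].
  by exists W, h; split => // y /VU; apply: fh.
- move=> U f oU H; apply: regP => // x Ux.
  have [V [h [[/oP[_ oV] hV] Vx VU fh]]] := H x Ux.
  have [W [h' [hW Wx hh]]] := hV x Vx; have [V' [oV' Vx' V'V]] := oV x Vx.
  exists (W `&` V'), h'; split => //.
    apply: (kreg_restr Ys hW) => [|y [] //]; apply: kopenI => //.
    exact: kreg_open hW.
  move=> y Uy [Wy Vy].
  have Cy : carrier X y by case/oP: oU => UX _; exact: UX.
  have Vy' := V'V y Cy Vy; rewrite fh // hh //.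
Qed.

Lemma kinduced_ringed : is_ringed Y -> is_ringed X.
Proof.
move=> Yr; have Ys := ringed_space Yr; have oP := kinduced_openP Ys.
have restr V U h : kreg Y V h -> kopen Y U -> kreg Y (V `&` U) h.
  move=> hV oU; apply: (kreg_restr Ys hV) => [|y [] //].
  by apply: kopenI => //; apply: kreg_open hV.
have restrl V U h : kreg Y V h -> kopen Y U -> kreg Y (U `&` V) h.
  by move=> hV oU; rewrite setIC; apply: restr.
have neq0 U f : kreg X U f -> kopen X [set x | U x /\ f x != 0].
  move=> [/oP[UX oU] fU]; apply/oP; split => [x [/UX]//|x [Ux fx]].
  have [V [h [hV Vx fh]]] := fU x Ux; have [V' [oV' Vx' VU]] := oU x Ux.
  exists ([set y | V y /\ h y != 0] `&` V'); split.
  - by apply: kopenI => //; apply: ringed_neq0.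
  - by split => //; split => //; rewrite -fh.
  - by move=> y Cy [[Vy hy] Vy']; have Uy := VU y Cy Vy'; rewrite /= fh.
split => //.
- exact: kinduced_kspace.
- move=> U c oU; split => // x Ux; exists (carrier Y), (fun=> c); split => //.
    by apply: ringed_cst => //; exact: kopenT.
  by have /oP[UX _] := oU; case: (UX x Ux).
- move=> U f g [oU fU] [_ gU]; split => // x Ux.
  have [V [h [hV Vx fh]]] := fU x Ux; have [V' [h' [hV' Vx' gh]]] := gU x Ux.
  exists (V `&` V'), (fun y => h y + h' y); split => //.
    by apply: ringed_add => //; [apply: restr|apply: restrl] => //;
       [exact: kreg_open hV'|exact: kreg_open hV].
  by move=> y Uy [Vy Vy']; rewrite fh // gh.
- move=> U f g [oU fU] [_ gU]; split => // x Ux.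
  have [V [h [hV Vx fh]]] := fU x Ux; have [V' [h' [hV' Vx' gh]]] := gU x Ux.
  exists (V `&` V'), (fun y => h y * h' y); split => //.
    by apply: ringed_mul => //; [apply: restr|apply: restrl] => //;
       [exact: kreg_open hV'|exact: kreg_open hV].
  by move=> y Uy [Vy Vy']; rewrite fh // gh.
- move=> U f fU; split; first exact: neq0.
  move=> x [Ux fx]; have [V [h [hV Vx fh]]] := fU.2 x Ux.
  exists [set y | V y /\ h y != 0], (fun y => (h y)^-1); split.
  - exact: ringed_inv.
  - by rewrite /= -fh.
  - by move=> y [Uy fy] [Vy hy]; rewrite fh.
Qed.

End Induced.

Section Product.
Variables (T1 T2 : Type) (X : kspace k T1) (Y : kspace k T2).
Hypotheses (Xr : is_ringed X) (Yr : is_ringed Y).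
Let Xs := ringed_space Xr.
Let Ys := ringed_space Yr.

(** Arbitrary finite index types allow sums and products of tensors to be indexed by sum and product
    types. *)
Lemma ktensor_fin (J : finType) U V (f : J -> T1 -> k) (g : J -> T2 -> k) h :
  (forall j, kreg X U (f j)) -> (forall j, kreg Y V (g j)) ->
  (forall p, h p = \sum_j f j p.1 * g j p.2) -> ktensor X Y U V h.
Proof.
move=> fU gV hE; exists #|J|, (fun i => f (enum_val i)), (fun i => g (enum_val i)).
split=> //; apply: funext => p; rewrite hE (reindex (@enum_val J predT)) //=.
by exists enum_rank => j _; [exact: enum_valK|exact: enum_rankK].
Qed.

Lemma ktensor_cst U V c : kopen X U -> kopen Y V -> ktensor X Y U V (fun=> c).
Proof.
move=> oU oV.
apply: (@ktensor_fin unit _ _ (fun _ _ => c) (fun _ _ => 1)) => [_|_|p].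
- exact: ringed_cst.
- exact: ringed_cst.
- by rewrite (big_pred1 tt) ?mulr1 // => -[].
Qed.

Lemma ktensor_fst U V f : kreg X U f -> kopen Y V ->
  ktensor X Y U V (fun p => f p.1).
Proof.
move=> fU oV.
apply: (@ktensor_fin unit _ _ (fun _ => f) (fun _ _ => 1)) => [_ //|_|p].
- exact: ringed_cst.
- by rewrite (big_pred1 tt) ?mulr1 // => -[].
Qed.

Lemma ktensor_snd U V g : kopen X U -> kreg Y V g ->
  ktensor X Y U V (fun p => g p.2).
Proof.
move=> oU gV.
apply: (@ktensor_fin unit _ _ (fun _ _ => 1) (fun _ => g)) => [_|_ //|p].
- exact: ringed_cst.
- by rewrite (big_pred1 tt) ?mul1r // => -[].
Qed.

Lemma ktensor_restr U V U' V' h : ktensor X Y U V h ->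
  kopen X U' -> U' `<=` U -> kopen Y V' -> V' `<=` V -> ktensor X Y U' V' h.
Proof.
move=> [m [f [g [H ->]]]] oU UU oV VV; exists m, f, g; split => // i.
have [fU gV] := H i.
by split; [apply: (kreg_restr Xs fU)|apply: (kreg_restr Ys gV)].
Qed.

Lemma ktensor_add U V h h' : ktensor X Y U V h -> ktensor X Y U V h' ->
  ktensor X Y U V (fun p => h p + h' p).
Proof.
move=> [m [f [g [H ->]]]] [m' [f' [g' [H' ->]]]].
apply: (@ktensor_fin ('I_m + 'I_m')%type _ _
  (fun j => match j with inl i => f i | inr i => f' i end)
  (fun j => match j with inl i => g i | inr i => g' i end)).
- by case=> i; [case: (H i)|case: (H' i)].
- by case=> i; [case: (H i)|case: (H' i)].
- by move=> p; rewrite big_sumType.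
Qed.

Lemma ktensor_mul U V h h' : ktensor X Y U V h -> ktensor X Y U V h' ->
  ktensor X Y U V (fun p => h p * h' p).
Proof.
move=> [m [f [g [H ->]]]] [m' [f' [g' [H' ->]]]].
apply: (@ktensor_fin ('I_m * 'I_m')%type _ _
  (fun j x => f j.1 x * f' j.2 x) (fun j y => g j.1 y * g' j.2 y)).
- by move=> j; apply: ringed_mul => //; [case: (H j.1)|case: (H' j.2)].
- by move=> j; apply: ringed_mul => //; [case: (H j.1)|case: (H' j.2)].
- move=> p; rewrite -(pair_bigA _ (fun i j => f i p.1 * f' j p.1 * (g i p.2 * g' j p.2))) /=.
  rewrite big_distrl /=; apply: eq_bigr => i _; rewrite big_distrr /=.
  by apply: eq_bigr => j _; rewrite mulrACA.
Qed.

Lemma kprod_open_rect U V : kopen X U -> kopen Y V -> kopen (kprod X Y) (U `*` V).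
Proof.
move=> oU oV; split.
  by move=> p [/(kopen_sub Xs oU) ? /(kopen_sub Ys oV)].
move=> p UVp; exists U, V, (fun=> 1); split => //; first exact: ktensor_cst.
by rewrite oner_neq0.
Qed.

Lemma ktensor_reg U V h : kopen X U -> kopen Y V ->
  ktensor X Y U V h -> kreg (kprod X Y) (U `*` V) h.
Proof.
move=> oU oV hT; split; first exact: kprod_open_rect.
move=> p UVp; exists U, V, h, (fun=> 1); split => //.
- by split => //; apply: ktensor_cst.
- by rewrite oner_neq0.
- by move=> q _ _ _; rewrite divr1.
Qed.

Lemma kprod_kspace : is_kspace (kprod X Y).
Proof.
split.
- by move=> U [].
- by apply: kprod_open_rect; exact: kopenT.
- move=> W W' [WC oW] [WC' oW']; split => [p [/WC]//|p [Wp Wp']].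
  have [U [V [h [oU oV hT [UVp hp] HW]]]] := oW p Wp.
  have [U' [V' [h' [oU' oV' hT' [UVp' hp'] HW']]]] := oW' p Wp'.
  exists (U `&` U'), (V `&` V'), (fun q => h q * h' q).
  have oUU : kopen X (U `&` U') by apply: kopenI.
  have oVV : kopen Y (V `&` V') by apply: kopenI.
  split => //.
  + apply: ktensor_mul.
      by apply: (ktensor_restr hT) => // ? [].
    by apply: ktensor_restr hT' _ _ _ _ => // ? [].
  + split; last by rewrite mulf_neq0.
    by case: UVp UVp' => ? ? [? ?]; do 2?split.
  + move=> q [[? ?] [? ?]]; rewrite mulf_eq0 negb_or => /andP[hq hq'].
    by split; [apply: HW|apply: HW'].
- move=> F FO; split => [p [U /FO[UC _] /UC //]|p [W FW Wp]].
  have [_ /(_ p Wp)[U [V [h [oU oV hT UVp HW]]]]] := FO _ FW.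
  by exists U, V, h; split => // q UVq hq; exists W => //; apply: HW.
- by move=> U f [].
- move=> W W' f [oW fW] oW' WW; split => // p /WW/fW.
  move=> [U [V [h [h' [oU oV hT UVp H]]]]].
  by exists U, V, h, h'; split => // q /WW; apply: H.
- move=> W f oW H; split => // p Wp.
  have [W' [h [[[_ oW'] hW'] Wp' WW fh]]] := H p Wp.
  have [U [V [h1 [oU oV hT [UVp hp] HW]]]] := oW' p Wp'.
  have [U' [V' [h2 [h3 [oU' oV' [hT2 hT3] [UVp' hp'] HW']]]]] := hW' p Wp'.
  have oUU : kopen X (U `&` U') by apply: kopenI.
  have oVV : kopen Y (V `&` V') by apply: kopenI.
  exists (U `&` U'), (V `&` V'), (fun q => h2 q * h1 q), (fun q => h3 q * h1 q).
  split => //.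
  + by split; apply: ktensor_mul;
      [apply: (ktensor_restr hT2)|apply: (ktensor_restr hT)
      |apply: (ktensor_restr hT3)|apply: (ktensor_restr hT)] => // ? [].
  + split; last by rewrite mulf_neq0.
    by case: UVp UVp' => ? ? [? ?]; do 2?split.
  + move=> q Wq [[? ?] [? ?]]; rewrite mulf_eq0 negb_or => /andP[hq' hq].
    have Wq' : W' q by apply: HW.
    by rewrite fh // HW' // -mulf_div divff // mulr1.
Qed.

Lemma kprod_ringed : is_ringed (kprod X Y).
Proof.
have oP := kprod_kspace.
(* A normal form in which one denominator cuts out both a neighbourhood inside [W] and the locus
   where the fraction represents [f]. *)
have open W f : kreg (kprod X Y) W f -> forall p, W p ->
    exists U V h h', [/\ kopen X U, kopen Y V,
      ktensor X Y U V h /\ ktensor X Y U V h', (U `*` V) p /\ h' p != 0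
      & forall q, (U `*` V) q -> h' q != 0 -> W q /\ f q = h q / h' q].
  move=> [[_ oW] fW] p Wp.
  have [U [V [h1 [oU oV hT [UVp hp] HW]]]] := oW p Wp.
  have [U' [V' [h2 [h3 [oU' oV' [hT2 hT3] [UVp' hp'] HW']]]]] := fW p Wp.
  have oUU : kopen X (U `&` U') by apply: kopenI.
  have oVV : kopen Y (V `&` V') by apply: kopenI.
  exists (U `&` U'), (V `&` V'), (fun q => h2 q * h1 q), (fun q => h3 q * h1 q).
  split => //.
  + by split; apply: ktensor_mul;
      [apply: (ktensor_restr hT2)|apply: (ktensor_restr hT)
      |apply: (ktensor_restr hT3)|apply: (ktensor_restr hT)] => // ? [].
  + split; last by rewrite mulf_neq0.
    by case: UVp UVp' => ? ? [? ?]; do 2?split.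
  + move=> q [[? ?] [? ?]]; rewrite mulf_eq0 negb_or => /andP[hq' hq].
    have Wq' : W q by apply: HW.
    by rewrite HW' // -mulf_div divff // mulr1.
have both W f g : kreg (kprod X Y) W f -> kreg (kprod X Y) W g ->
  forall p, W p -> exists U V h h' l, [/\ kopen X U, kopen Y V,
      [/\ ktensor X Y U V h, ktensor X Y U V h' & ktensor X Y U V l],
      (U `*` V) p /\ l p != 0
      & forall q, (U `*` V) q -> l q != 0 -> f q = h q / l q /\ g q = h' q / l q].
  move=> fW gW p Wp.
  have [U [V [h [l [oU oV [hT lT] [UVp lp] HW]]]]] := open _ _ fW p Wp.
  have [U' [V' [h' [l' [oU' oV' [hT' lT'] [UVp' lp'] HW']]]]] := open _ _ gW p Wp.
  have oUU : kopen X (U `&` U') by apply: kopenI.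
  have oVV : kopen Y (V `&` V') by apply: kopenI.
  have R g' : ktensor X Y U V g' -> ktensor X Y (U `&` U') (V `&` V') g'.
    by move=> gT; apply: (ktensor_restr gT) => // ? [].
  have R' g' : ktensor X Y U' V' g' -> ktensor X Y (U `&` U') (V `&` V') g'.
    by move=> gT; apply: (ktensor_restr gT) => // ? [].
  exists (U `&` U'), (V `&` V'), (fun q => h q * l' q), (fun q => l q * h' q),
    (fun q => l q * l' q).
  split => //.
  + by split; apply: ktensor_mul; auto.
  + split; last by rewrite mulf_neq0.
    by case: UVp UVp' => ? ? [? ?]; do 2?split.
  + move=> q [[? ?] [? ?]]; rewrite mulf_eq0 negb_or => /andP[lq lq'].
    have [|//|_ ->] := HW q; first by split.
    have [|//|_ ->] := HW' q; first by split.
    by rewrite -[X in _ = X /\ _]mulf_div -[X in _ /\ _ = X]mulf_div !divff // mulr1 mul1r.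
split => //.
- move=> W c oW; split => // p Wp.
  exists (carrier X), (carrier Y), (fun=> c), (fun=> 1).
  have [oX oY] : kopen X (carrier X) /\ kopen Y (carrier Y).
    by split; exact: kopenT.
  split => //; first by split; apply: ktensor_cst.
    by rewrite oner_neq0; split => //; case: oW => WC _; exact: WC.
  by move=> q _ _ _; rewrite divr1.
- move=> W f g fW gW; split; first exact: kreg_open fW.
  move=> p Wp.
  have [U [V [h [h' [l [oU oV [hT hT' lT] UVp H]]]]]] := both W f g fW gW p Wp.
  exists U, V, (fun q => h q + h' q), l; split => //.
    by split => //; apply: ktensor_add.
  by move=> q _ UVq lq; have [-> ->] := H q UVq lq; rewrite mulrDl.
- move=> W f g fW gW; split; first exact: kreg_open fW.
  move=> p Wp.
  have [U [V [h [h' [l [oU oV [hT hT' lT] [UVp lp] H]]]]]] := both W f g fW gW p Wp.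
  exists U, V, (fun q => h q * h' q), (fun q => l q * l q); split => //.
  + by split => //; apply: ktensor_mul.
  + by rewrite mulf_neq0.
  + move=> q _ UVq; rewrite mulf_eq0 negb_or => /andP[lq _].
    by have [-> ->] := H q UVq lq; rewrite mulf_div.
- move=> W f fW; have WC : W `<=` carrier (kprod X Y) by case: fW => -[].
  split=> [p [/WC]//|p [Wp fp]].
  have [U [V [h [h' [oU oV [hT hT'] [UVp hp'] H]]]]] := open W f fW p Wp.
  exists U, V, (fun q => h q * h' q); split => //; first exact: ktensor_mul.
    split => //; rewrite mulf_neq0 //; apply: contraNneq fp => hp.
    by have [_ ->] := H p UVp hp'; rewrite hp mul0r.
  move=> q UVq; rewrite mulf_eq0 negb_or => /andP[hq hq'].
  have [Wq fq] := H q UVq hq'; split => //.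
  by rewrite fq mulf_neq0 ?invr_neq0.
- move=> W f fW.
  have WC : W `<=` carrier (kprod X Y) by case: fW => -[].
  have H1 p : W p -> f p != 0 -> exists U V h h', [/\ kopen X U, kopen Y V,
      ktensor X Y U V h /\ ktensor X Y U V h',
      (U `*` V) p /\ h' p != 0
      & forall q, (U `*` V) q -> h' q != 0 -> [/\ W q, f q != 0 & (f q)^-1 = h q / h' q]].
    move=> Wp fp.
    have [U [V [h [h' [oU oV [hT hT'] [UVp hp'] H]]]]] := open W f fW p Wp.
    exists U, V, (fun q => h' q * h' q), (fun q => h q * h' q); split => //.
    + by split; apply: ktensor_mul.
    + split => //; rewrite mulf_neq0 //; apply: contraNneq fp => hp.
      by have [_ ->] := H p UVp hp'; rewrite hp mul0r.
    + move=> q UVq; rewrite mulf_eq0 negb_or => /andP[hq hq'].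
      have [Wq fq] := H q UVq hq'; split => //.
        by rewrite fq mulf_neq0 ?invr_neq0.
      by rewrite fq invf_div -mulf_div divff // mulr1.
  split.
    split=> [p [/WC]//|p [Wp fp]].
    have [U [V [h [h' [oU oV [hT hT'] [UVp hp'] H]]]]] := H1 p Wp fp.
    by exists U, V, h'; split => // q UVq hq; have [] := H q UVq hq.
  move=> p [Wp fp].
  have [U [V [h [h' [oU oV [hT hT'] [UVp hp'] H]]]]] := H1 p Wp fp.
  by exists U, V, h, h'; split => // q _ UVq hq; have [] := H q UVq hq.
Qed.

End Product.

End GoodSpaces.

(** * Morphisms and affine charts *)

Section Morphisms.
Variable k : fieldType.

Lemma kmorphism_comp T1 T2 T3 (X : kspace k T1) (Y : kspace k T2)
    (Z : kspace k T3) f g : is_kspace X ->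
  kmorphism X Y f -> kmorphism Y Z g -> kmorphism X Z (g \o f).
Proof.
move=> Xs [fC fo fr] [gC go gr].
have E V : carrier X `&` f @^-1` (carrier Y `&` g @^-1` V) =
    carrier X `&` (g \o f) @^-1` V.
  by apply/seteqP; split=> x; [move=> [? []]|move=> [? ?]; do 2?split; auto].
split=> [x /fC/gC //|V /go/fo|V h /gr/fr]; by rewrite E.
Qed.

Lemma kmorphism_id T (X : kspace k T) : is_kspace X -> kmorphism X X id.
Proof.
move=> Xs; have E V : V `<=` carrier X -> carrier X `&` id @^-1` V = V.
  by move=> VX; apply/seteqP; split=> x; [case|move=> Vx; split; auto].
split=> // [V oV|V h hV]; rewrite E //; first exact: kopen_sub oV.
by apply: (kopen_sub Xs); apply: kreg_open hV.
Qed.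

Lemma kmorphism_eq T1 T2 (X : kspace k T1) (Y : kspace k T2) f g :
  is_kspace X -> kmorphism X Y f -> (forall x, carrier X x -> f x = g x) ->
  kmorphism X Y g.
Proof.
move=> Xs [fC fo fr] fg.
have E V : carrier X `&` f @^-1` V = carrier X `&` g @^-1` V.
  by apply/seteqP; split=> x [Cx] /=; [rewrite fg|rewrite -fg].
split=> [x Cx|V /fo|V h /fr hr]; first by rewrite -fg //; apply: fC.
  by rewrite E.
rewrite E in hr; apply: (kreg_eq Xs hr) => x [Cx _] /=; by rewrite fg.
Qed.

Lemma kinduced_emb T T' (S : set T) (e : T -> T') (Y : kspace k T') :
  is_kspace Y -> kmorphism (kinduced S e Y) Y e.
Proof.
move=> Ys; split=> [x []//|V oV|V h hV]; first by exists V.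
split; first by exists V => //; apply: kreg_open hV.
by move=> x [Cx Vx]; exists V, h.
Qed.

(** Universal property of the induced structure: morphisms into it are tested after composition with
    [e]. *)
Lemma kmorphism_induced T T1 T2 (X : kspace k T) (S : set T1) (e : T1 -> T2)
    (Y : kspace k T2) f : is_kspace X -> is_kspace Y ->
  (forall x, carrier X x -> S (f x)) -> kmorphism X Y (e \o f) ->
  kmorphism X (kinduced S e Y) f.
Proof.
move=> Xs Ys fS [fC fo fr]; have C x : carrier X x -> carrier (kinduced S e Y) (f x).
  by move=> Cx; split; [exact: fS|exact: fC].
have O V : kopen (kinduced S e Y) V -> kopen X (carrier X `&` f @^-1` V).
  move=> [W oW ->]; rewrite (_ : _ `&` _ = carrier X `&` (e \o f) @^-1` W).
    exact: fo.
  by apply/seteqP; split=> x; [move=> [? []]|move=> [Cx Wx]; split => //; split => //; exact: C].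
split => // V h [oV hV]; apply: kreg_glue => //; first exact: O.
move=> x [Cx Vx]; have [W [h' [hW Wx hh]]] := hV _ Vx.
exists ((carrier X `&` f @^-1` V) `&` (carrier X `&` (e \o f) @^-1` W)), (h' \o (e \o f)).
split.
- apply: (kreg_restr Xs (fr W h' hW)); last by move=> y [].
  by apply: kopenI => //; [exact: O|apply: fo; apply: kreg_open hW].
- by [].
- by move=> y [].
- by move=> y [[_ Vy] [_ Wy]] /=; rewrite hh.
Qed.

Lemma ksub_incl T (Y : kspace k T) S : is_kspace Y -> kmorphism (ksub Y S) Y id.
Proof. exact: kinduced_emb. Qed.

Lemma kmorphism_sub T T1 (X : kspace k T) (Y : kspace k T1) S f :
  is_kspace X -> is_kspace Y -> (forall x, carrier X x -> S (f x)) ->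
  kmorphism X Y f -> kmorphism X (ksub Y S) f.
Proof. by move=> *; apply: kmorphism_induced. Qed.

Lemma kmorphism_affine T (X : kspace k T) (I : finType) (f : T -> {ffun I -> k}) :
  is_ringed X -> (forall i, kreg X (carrier X) (fun x => f x i)) ->
  kmorphism X (affine_space k I) f.
Proof.
move=> Xr fr; have Xs := ringed_space Xr.
have pr p : kreg X (carrier X) (fun x => poly_eval p (f x)).
  by apply: ringed_meval => //; exact: kopenT.
have O V : kopen (affine_space k I) V -> kopen X (carrier X `&` f @^-1` V).
  move=> /affine_openP oV; apply: kopen_local => // x [Cx Vx].
  have [p px pV] := oV _ Vx.
  exists [set x | carrier X x /\ poly_eval p (f x) != 0]; split => //.
    exact: ringed_neq0.
  by move=> y [Cy py]; split => //; exact: pV.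
split => // V h [oV hV]; apply: kreg_glue => //; first exact: O.
move=> x [Cx Vx]; have [p [q [qx hpq]]] := hV _ Vx.
exists ((carrier X `&` f @^-1` V) `&` [set x | carrier X x /\ poly_eval q (f x) != 0]).
exists (fun x => poly_eval p (f x) / poly_eval q (f x)); split.
- apply: (kreg_restr Xs (ringed_div Xr (pr p) (pr q))); last by move=> y [].
  by apply: kopenI => //; [exact: O|exact: ringed_neq0].
- by [].
- by move=> y [].
- by move=> y [[_ Vy] [_ qy]] /=; rewrite hpq.
Qed.

(** Universal property of the product. Tensors pull back to sums of products of regular functions,
    and locally every regular function on the product is a quotient of tensors. *)
Lemma kmorphism_pair T T1 T2 (X : kspace k T) (Y : kspace k T1)
    (Z : kspace k T2) f g : is_ringed X ->
  kmorphism X Y f -> kmorphism X Z g ->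
  kmorphism X (kprod Y Z) (fun x => (f x, g x)).
Proof.
move=> Xr [fC fo fr] [gC go gr]; have Xs := ringed_space Xr.
have hr U V h : kopen Y U -> kopen Z V -> ktensor Y Z U V h ->
    kreg X (carrier X `&` (fun x => (f x, g x)) @^-1` (U `*` V)) (fun x => h (f x, g x)).
  move=> oU oV [m [F [G [FG ->]]]].
  have E : carrier X `&` (fun x => (f x, g x)) @^-1` (U `*` V) =
      (carrier X `&` f @^-1` U) `&` (carrier X `&` g @^-1` V).
    by apply/seteqP; split=> x; [move=> [? []]|move=> [[? ?] [_ ?]]].
  have oE : kopen X ((carrier X `&` f @^-1` U) `&` (carrier X `&` g @^-1` V)).
    by apply: kopenI => //; [exact: fo|exact: go].
  rewrite E; apply: ringed_sum => // i; have [FU GV] := FG i.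
  apply: (ringed_mul Xr).
    by apply: (kreg_restr Xs (fr _ _ FU)) => // y [].
  by apply: (kreg_restr Xs (gr _ _ GV)) => // y [].
have O W : kopen (kprod Y Z) W -> kopen X (carrier X `&` (fun x => (f x, g x)) @^-1` W).
  move=> [WC oW]; apply: kopen_local => // x [Cx Wx].
  have [U [V [h [oU oV hT [UVx hx] HW]]]] := oW _ Wx.
  exists [set x | (carrier X `&` (fun x => (f x, g x)) @^-1` (U `*` V)) x /\ h (f x, g x) != 0].
  split => //; first by apply: (ringed_neq0 Xr); exact: hr.
  by move=> y [[Cy UVy] hy]; split => //; exact: HW.
split => [x Cx|//|W h [oW hW]]; first by split; [exact: fC|exact: gC].
apply: kreg_glue => //; first exact: O.
move=> x [Cx Wx]; have [U [V [h1 [h2 [oU oV [hT1 hT2] [UVx hx] H]]]]] := hW _ Wx.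
exists ((carrier X `&` (fun x => (f x, g x)) @^-1` W) `&`
  [set x | (carrier X `&` (fun x => (f x, g x)) @^-1` (U `*` V)) x /\ h2 (f x, g x) != 0]).
exists (fun x => h1 (f x, g x) / h2 (f x, g x)); split.
- apply: (kreg_restr Xs (ringed_div Xr (hr _ _ _ oU oV hT1) (hr _ _ _ oU oV hT2))).
    by apply: kopenI => //; [exact: O|apply: (ringed_neq0 Xr); exact: hr].
  by move=> y [].
- by [].
- by move=> y [].
- by move=> y [[_ Wy] [[_ UVy] hy]] /=; rewrite H.
Qed.

Lemma kmorphism_fst T1 T2 (X : kspace k T1) (Y : kspace k T2) :
  is_ringed X -> is_ringed Y -> kmorphism (kprod X Y) X fst.
Proof.
move=> Xr Yr; have Xs := ringed_space Xr; have Ys := ringed_space Yr.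
have oY := kopenT Ys.
have E V : V `<=` carrier X ->
    carrier (kprod X Y) `&` fst @^-1` V = V `*` carrier Y.
  move=> VX; apply/seteqP; split=> p; first by move=> [[]].
  by move=> [Vp Cp]; split => //; split => //; apply: VX.
split=> [p []//|V oV|V h hV].
  by rewrite E; [exact: kprod_open_rect|exact: kopen_sub].
have oV := kreg_open Xs hV.
rewrite E; last exact: kopen_sub.
by apply: ktensor_reg => //; apply: ktensor_fst.
Qed.

Lemma kmorphism_snd T1 T2 (X : kspace k T1) (Y : kspace k T2) :
  is_ringed X -> is_ringed Y -> kmorphism (kprod X Y) Y snd.
Proof.
move=> Xr Yr; have Xs := ringed_space Xr; have Ys := ringed_space Yr.
have oX := kopenT Xs.
have E V : V `<=` carrier Y ->
    carrier (kprod X Y) `&` snd @^-1` V = carrier X `*` V.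
  move=> VX; apply/seteqP; split=> p; first by move=> [[]].
  by move=> [Vp Cp]; split => //; split => //; apply: VX.
split=> [p []//|V oV|V h hV].
  by rewrite E; [exact: kprod_open_rect|exact: kopen_sub].
have oV := kreg_open Ys hV.
rewrite E; last exact: kopen_sub.
by apply: ktensor_reg => //; apply: ktensor_snd.
Qed.

Lemma kmorphism_cst T1 T2 (X : kspace k T1) (Y : kspace k T2) y0 :
  is_ringed X -> carrier Y y0 -> kmorphism X Y (fun=> y0).
Proof.
move=> Xr Cy0; have Xs := ringed_space Xr.
have O (V : set T2) : kopen X (carrier X `&` (fun=> y0) @^-1` V).
  have [Vy|Vy] := pselect (V y0).
    by rewrite (_ : _ `&` _ = carrier X); [exact: kopenT|by apply/seteqP; split=> x; [case|]].
  rewrite (_ : _ `&` _ = set0); first exact: kopen0.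
  by apply/seteqP; split=> x [].
by split => // V h _; apply: (ringed_cst Xr).
Qed.

Lemma kopen_sub_ksub T (X : kspace k T) S W : is_kspace X ->
  kopen X S -> kopen (ksub X S) W <-> kopen X W /\ W `<=` S.
Proof.
move=> Xs oS; split=> [[V oV ->]|[oW WS]].
  split; last by move=> x [[]].
  rewrite (_ : _ `&` _ = S `&` V); first exact: kopenI.
  apply/seteqP; split=> x; first by move=> [[]].
  by move=> [Sx Vx]; do 2?split => //; exact: (kopen_sub Xs oS).
exists W => //; apply/seteqP; split=> x; last by move=> [].
by move=> Wx; do 2?split; auto; exact: (kopen_sub Xs oW).
Qed.

Lemma kreg_sub_ksub T (X : kspace k T) S W h : is_kspace X ->
  kopen X S -> kreg (ksub X S) W h <-> kreg X W h /\ W `<=` S.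
Proof.
move=> Xs oS; split=> [[oW hW]|[hW WS]].
  have /(kopen_sub_ksub _ Xs oS)[oW' WS] := oW; split => //.
  apply: kreg_glue => // x Wx; have [V [h' [hV Vx hh]]] := hW x Wx.
  exists (W `&` V), h'; split => //; last by move=> y [Wy Vy]; exact: hh.
    apply: (kreg_restr Xs hV) => [|y []//].
    by apply: kopenI => //; exact: kreg_open hV.
have oW := kreg_open Xs hW.
split; first by apply/kopen_sub_ksub.
by move=> x Wx; exists W, h.
Qed.

Lemma kiso_ringed T1 T2 (X : kspace k T1) (Y : kspace k T2) f :
  is_kspace X -> is_ringed Y -> kiso X Y f -> is_ringed X.
Proof.
move=> Xs Yr [[fC fo fr] [g [[gC go gr] gf fg]]]; have Ys := ringed_space Yr.
have back U u v : kopen X U ->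
    kreg Y (carrier Y `&` g @^-1` U) v -> (forall x, U x -> v (f x) = u x) ->
    kreg X U u.
  move=> oU /fr vr vu.
  have E : carrier X `&` f @^-1` (carrier Y `&` g @^-1` U) = U.
    apply/seteqP; split=> x; first by move=> [Cx [_ /=]]; rewrite gf.
    move=> Ux; have Cx := kopen_sub Xs oU Ux; do 2?split => //; first exact: fC.
    by rewrite /= gf.
  by rewrite E in vr; exact: (kreg_eq Xs vr).
have UC U x : kopen X U -> U x -> carrier X x by move=> oU; exact: kopen_sub.
have neq0 U a : kreg X U a -> kopen X [set x | U x /\ a x != 0].
  move=> aU; have oU := kreg_open Xs aU.
  have /fo := ringed_neq0 Yr (gr _ _ aU); congr kopen; apply/seteqP; split=> x.
    by move=> [Cx [[_ /=]]]; rewrite gf.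
  by move=> [Ux ax]; have Cx := UC _ _ oU Ux; do 3?split => //=; rewrite ?gf //; exact: fC.
split => //.
- move=> U c oU; apply: (back _ _ (fun=> c)) => //.
  by apply: (ringed_cst Yr); exact: go.
- move=> U a b aU bU; have oU := kreg_open Xs aU.
  apply: (back _ _ (fun y => a (g y) + b (g y))) => //.
    by apply: (ringed_add Yr); [exact: gr aU|exact: gr bU].
  by move=> x Ux; rewrite gf //; exact: UC oU Ux.
- move=> U a b aU bU; have oU := kreg_open Xs aU.
  apply: (back _ _ (fun y => a (g y) * b (g y))) => //.
    by apply: (ringed_mul Yr); [exact: gr aU|exact: gr bU].
  by move=> x Ux; rewrite gf //; exact: UC oU Ux.
- move=> U a aU; have oU := kreg_open Xs aU.
  apply: (back _ _ (fun y => (a (g y))^-1)); first exact: neq0.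
    have := ringed_inv Yr (gr _ _ aU); congr kreg; apply/seteqP; split=> y.
      by move=> [[? ?]].
    by move=> [? []].
  by move=> x [Ux _]; rewrite gf //; exact: UC oU Ux.
Qed.

Lemma ringed_cover T (X : kspace k T) : is_kspace X ->
  (forall x, carrier X x -> exists U, [/\ kopen X U, U x & is_ringed (ksub X U)]) ->
  is_ringed X.
Proof.
move=> Xs cov.
have restr U W f : kreg X W f -> kopen X U -> kreg (ksub X U) (W `&` U) f.
  move=> fW oU; apply/kreg_sub_ksub => //; split; last by move=> x [].
  apply: (kreg_restr Xs fW) => [|x []//]; apply: kopenI => //.
  exact: kreg_open fW.
have loc W f : W `<=` carrier X ->
    (forall U, kopen X U -> is_ringed (ksub X U) -> kreg (ksub X U) (W `&` U) f) ->
    kreg X W f.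
  move=> WC H; apply: kreg_local => // x Wx.
  have [U [oU Ux Ur]] := cov x (WC x Wx); exists (W `&` U), f; split => //.
  by have /(kreg_sub_ksub _ _ Xs oU)[] := H U oU Ur.
have sub W f : kreg X W f -> W `<=` carrier X.
  by move=> fW; apply: (kopen_sub Xs); exact: kreg_open fW.
have EI W U (f : T -> k) : [set x | (W `&` U) x /\ f x != 0] = [set x | W x /\ f x != 0] `&` U.
  by apply/seteqP; split=> x; [move=> [[]]|move=> [[]]].
split => //.
- move=> U c oU; apply: loc => [|V oV Vr]; first exact: kopen_sub.
  apply: (ringed_cst Vr); apply/kopen_sub_ksub => //.
  by split; [exact: kopenI|move=> x []].
- move=> U f g fU gU; apply: loc => [|V oV Vr]; first exact: sub fU.
  by apply: (ringed_add Vr); apply: restr.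
- move=> U f g fU gU; apply: loc => [|V oV Vr]; first exact: sub fU.
  by apply: (ringed_mul Vr); apply: restr.
- move=> W f fW; apply: kopen_local => // x [Wx fx].
  have [U [oU Ux Ur]] := cov x (sub _ _ fW x Wx).
  exists [set x | (W `&` U) x /\ f x != 0]; split => //.
    by have /(kopen_sub_ksub _ Xs oU)[] := ringed_neq0 Ur (restr _ _ _ fW oU).
  by move=> y [[]].
- move=> W f fW; apply: loc => [x [Wx _]|V oV Vr]; first exact: sub fW x Wx.
  by rewrite -EI; apply: (ringed_inv Vr); apply: restr.
Qed.

Lemma is_affine_ringed T (X : kspace k T) : is_kspace X -> is_affine X -> is_ringed X.
Proof.
move=> Xs [I [Z [e [_ /kiso_ringed]]]]; apply => //.
by apply: kinduced_ringed; exact: affine_ringed.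
Qed.

(** [is_variety] only asks for a sheaf of functions; the ring operations come from the affine
    charts, where they are those of rational functions. *)
Lemma variety_ringed T (X : kspace k T) : is_variety X -> is_ringed X.
Proof.
move=> [Xs [m [U [HU CU]]] _]; apply: ringed_cover => // x.
rewrite CU => -[i _ Ux]; have [oU aU] := HU i; exists (U i); split => //.
by apply: is_affine_ringed => //; exact: kinduced_kspace.
Qed.

(** The form in which affine charts are used: the germ of a regular function at [x] is a quotient of
    polynomials in the coordinates, and the denominator alone cuts out, inside [U], a neighbourhood
    of [x] on which this holds. *)
Lemma variety_chart T (X : kspace k T) x : is_variety X -> carrier X x ->
  exists (I : finType) (U : set T) (c : T -> {ffun I -> k}),
    [/\ kopen X U /\ U x, forall i, kreg X U (fun y => c y i),
        forall y z, U y -> U z -> c y = c z -> y = z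
      & forall W h, kreg X W h -> W x -> exists p q : {mpoly k[#|I|]},
          poly_eval q (c x) != 0 /\ forall y, U y -> poly_eval q (c y) != 0 ->
            W y /\ h y = poly_eval p (c y) / poly_eval q (c y)].
Proof.
move=> [Xs [m [V [HV CV]]] _]; rewrite CV => -[i _ Ux].
have [oU [I [Z [e [_ [[eC eo er] [g [[gC go gr] ge eg]]]]]]]] := HV i.
have As := affine_kspace k I; have Zs := kinduced_kspace Z id As.
have UC y : V i y -> carrier (ksub X (V i)) y.
  by move=> Uy; split => //; exact: (kopen_sub Xs oU).
exists I, (V i), e; split => //.
- move=> j; have /er : kreg (ksub (affine_space k I) Z) (carrier (ksub (affine_space k I) Z)) (fun v => v j).
    split; first exact: (kopenT Zs).
    move=> v Zv; exists setT, (fun v : {ffun I -> k} => v j); split => //.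
    exact: affine_coord.
  move=> /(kreg_sub_ksub _ _ Xs oU)[hr _].
  rewrite (_ : _ `&` _ = V i) // in hr; apply/seteqP; split=> y; first by move=> [[]].
  by move=> Uy; have Cy := UC y Uy; split => //; exact: eC.
- by move=> y z Uy Uz eyz; rewrite -(ge y) ?eyz ?ge //; exact: UC.
- move=> W h hW Wx.
  have /gr[_ hZ] : kreg (ksub X (V i)) (W `&` V i) h.
    apply/kreg_sub_ksub => //; split; last by move=> y [].
    apply: (kreg_restr Xs hW) => [|y []//].
    by apply: kopenI => //; exact: kreg_open hW.
  have Cx := UC x Ux.
  have oWU : kopen (ksub (affine_space k I) Z)
      (carrier (ksub (affine_space k I) Z) `&` g @^-1` (W `&` V i)).
    apply: go; apply/kopen_sub_ksub => //; split; last by move=> y [].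
    by apply: kopenI => //; exact: kreg_open hW.
  have ex : (carrier (ksub (affine_space k I) Z) `&` g @^-1` (W `&` V i)) (e x).
    by split; [exact: eC|rewrite /preimage /= ge].
  have [A [h' [[/affine_openP oA hA] Ax hh]]] := hZ _ ex.
  have [B oB EB] := oWU; have Bx : B (e x) by move: ex; rewrite EB => -[].
  have [p [q [qx hpq]]] := hA _ Ax; have [r rx rA] := oA _ Ax.
  have /affine_openP/(_ _ Bx)[s sx sB] := oB.
  exists (p * (r * s)), (q * (r * s)); rewrite !poly_evalM !mulf_neq0 //.
  split => // y Uy; rewrite !poly_evalM !mulf_eq0 !negb_or => /andP[qy /andP[ry sy]].
  have Cy := UC y Uy.
  have ey : (carrier (ksub (affine_space k I) Z) `&` g @^-1` (W `&` V i)) (e y).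
    by rewrite EB; split; [exact: eC|exact: sB].
  have [_ []] := ey; rewrite ge // => Wy _; split => //.
  have := hh _ ey (rA _ ry); rewrite /= ge // => ->; rewrite hpq //; last exact: rA.
  by rewrite -mulf_div divff ?mulr1 // mulf_neq0.
Qed.

(** This locus is the preimage under [(f, g)] of the complement of the diagonal, open because [Y] is
    separated. *)
Lemma kmorphism_eq_closed T1 T2 (X : kspace k T1) (Y : kspace k T2) f g :
  is_ringed X -> is_variety Y -> kmorphism X Y f -> kmorphism X Y g ->
  kopen X [set x | carrier X x /\ f x <> g x].
Proof.
move=> Xr [_ _ [_ oD]] fM gM.
have [pC po _] := kmorphism_pair Xr fM gM.
have := po _ oD; congr kopen; apply/seteqP; split=> x.
  move=> [Cx [Cfg H]]; split => // fg; apply: H; split => //=.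
  by case: Cfg.
by move=> [Cx fg]; split => //; split; [exact: pC|case].
Qed.

End Morphisms.

(** * Ind-varieties and ind-groups *)

Section IndVarieties.
Variable k : fieldType.

Section Levels.
Variables (T : Type) (V : indspace k T).
Hypothesis Vi : is_indvariety V.

Lemma ind_variety d : is_variety (V d). Proof. by have [] := Vi d. Qed.
Lemma ind_ringed d : is_ringed (V d).
Proof. exact/variety_ringed/ind_variety. Qed.
Lemma ind_kspace d : is_kspace (V d).
Proof. exact/ringed_space/ind_ringed. Qed.

Lemma ind_incl d m : (d <= m)%N -> kmorphism (V d) (V m) id.
Proof.
move=> /subnK <-; elim: (m - d)%N => [|e IH]; first exact/kmorphism_id/ind_kspace.
rewrite addSn; apply: (kmorphism_comp (f := id) (g := id) (ind_kspace d) IH).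
have [_ _ {1}->] := Vi (e + d)%N; exact/ksub_incl/ind_kspace.
Qed.

(** Each piece carries the subspace structure of the next one, so a regular function on it is
    locally the restriction of a regular function on a larger piece. This is how test functions are
    moved up the filtration. *)
Lemma ind_extend d m W h x : (d <= m)%N -> kreg (V d) W h -> W x ->
  exists W' h', [/\ kreg (V m) W' h', W' x &
    forall y, carrier (V d) y -> W' y -> W y /\ h y = h' y].
Proof.
move=> /subnK <-; elim: (m - d)%N => [|e IH] hW Wx; first by exists W, h.
have [W1 [h1 [hW1 W1x hh]]] := IH hW Wx.
have [_ _ E] := Vi (e + d)%N; rewrite {1}E in hW1.
have [[W0 oW0 EW] hr] := hW1.
have [W2 [h2 [hW2 W2x hh2]]] := hr x W1x.
have Vs := ind_kspace (e.+1 + d)%N.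
exists (W2 `&` W0), h2; split.
- apply: (kreg_restr Vs hW2) => [|y []//]; apply: kopenI => //.
  exact: kreg_open hW2.
- by split => //; move: W1x; rewrite EW => -[].
- move=> y Cy [W2y W0y].
  have Cy' : carrier (V (e + d)%N) y by have [H _ _] := ind_incl (leq_addl e d); exact: H.
  have W1y : W1 y.
    rewrite EW; split => //; split => //=.
    by have [H _ _] := ind_incl (leqnSn (e + d)%N); exact: H.
  have [|Wy ->] := hh y Cy; first by [].
  by split => //; apply: hh2.
Qed.

Definition imorphism (T' : Type) (X : kspace k T') (f : T' -> T) : Prop :=
  exists m, kmorphism X (V m) f.

Lemma kmorphism_le T' (X : kspace k T') d m f : is_kspace X -> (d <= m)%N ->
  kmorphism X (V d) f -> kmorphism X (V m) f.
Proof. by move=> Xs dm fM; exact: (kmorphism_comp Xs fM (ind_incl dm)). Qed.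

End Levels.

Section Groups.
Variables (gT : groupType) (G : indspace k gT).
Hypothesis Gg : is_indgroup G.

Lemma indgroup_ind : is_indvariety G. Proof. by case: Gg. Qed.
Let Gi := indgroup_ind.

Variables (T : Type) (X : kspace k T).
Hypothesis Xr : is_ringed X.
Let Xs := ringed_space Xr.

Lemma imorphism_mul f g : imorphism G X f -> imorphism G X g ->
  imorphism G X (fun x => (f x * g x)%g).
Proof.
move=> [d fM] [e gM]; have [_ _ mulM _] := Gg.
have [m M] := mulM (maxn d e); exists m.
apply: (kmorphism_comp Xs _ M (f := fun x => (f x, g x))).
by apply: kmorphism_pair => //;
  [exact: kmorphism_le (leq_maxl _ _) fM|exact: kmorphism_le (leq_maxr _ _) gM].
Qed.

Lemma imorphism_inv f : imorphism G X f -> imorphism G X (fun x => (f x)^-1%g).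
Proof.
move=> [d fM]; have [_ _ _ invM] := Gg.
by have [m M] := invM d; exists m; exact: (kmorphism_comp Xs fM M).
Qed.

Lemma imorphism_cst y : ind_carrier G y -> imorphism G X (fun=> y).
Proof. by move=> [d _ Cy]; exists d; apply: kmorphism_cst. Qed.

End Groups.

End IndVarieties.

(** * Curves and derivations *)

Section Derivative.
Variable k : fieldType.
Hypothesis k0 : [pchar k] =i pred0.

Lemma natr_neq0 m : (m.+1%:R : k) != 0.
Proof. by have /pcharf0P -> := k0. Qed.

Lemma natr_inj : injective (fun m : nat => m%:R : k).
Proof.
move=> m n; wlog mn : m n / (m <= n)%N => [H|/eqP].
  by case/orP: (leq_total m n) => mn e; [apply: H|apply/esym/H].
rewrite eq_sym -subr_eq0 -natrB //; have /pcharf0P -> := k0.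
by rewrite subn_eq0 => nm; apply/eqP; rewrite eqn_leq mn nm.
Qed.

(** In characteristic zero the images of the first [size p] natural numbers are distinct roots, one
    more than the degree allows. *)
Lemma poly_eq0P (p : {poly k}) : (forall t, p.[t] = 0) -> p = 0.
Proof.
move=> p0; apply: contraTeq isT => pn0.
have := @max_poly_roots k p [seq m%:R | m <- iota 0 (size p)] pn0.
rewrite size_map size_iota ltnn; apply.
  by apply/allP => x _; rewrite rootE p0.
by rewrite map_inj_uniq ?iota_uniq //; exact: natr_inj.
Qed.

Lemma poly_eq_dense (p q c : {poly k}) : c != 0 ->
  (forall t, c.[t] != 0 -> p.[t] = q.[t]) -> p = q.
Proof.
move=> cn0 pq; apply/eqP; rewrite -subr_eq0; have : (p - q) * c == 0.
  apply/eqP/poly_eq0P => t; rewrite hornerM hornerD hornerN.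
  have [->|/pq ->] := eqVneq c.[t] 0; first by rewrite mulr0.
  by rewrite subrr mul0r.
by rewrite mulf_eq0 (negPf cn0) orbF.
Qed.

Lemma horner_neq0 (q : {poly k}) s : q.[s] != 0 -> q != 0.
Proof. by apply: contraNneq => ->; rewrite horner0. Qed.

Lemma poly_neq0P (c : {poly k}) : c != 0 -> exists t, c.[t] != 0.
Proof.
move=> cn0; apply: contrapT => H; case/eqP: cn0; apply: poly_eq0P => t.
by apply/eqP/negPn/negP => ct; apply: H; exists t.
Qed.

(** [q] serves both as denominator and as the description of a Zariski neighbourhood of [s] on which
    [r] is given by the fraction. *)
Definition rat_at (s : k) (r : k -> k) (p q : {poly k}) : Prop :=
  q.[s] != 0 /\ forall t, q.[t] != 0 -> r t = p.[t] / q.[t].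

Definition ratder (p q : {poly k}) (s : k) : k :=
  (p^`().[s] * q.[s] - p.[s] * q^`().[s]) / q.[s] ^+ 2.

Definition hasder (s : k) (r : k -> k) (d : k) : Prop :=
  exists p q, rat_at s r p q /\ d = ratder p q s.

(** Two fractions for the same germ agree at all but finitely many points, so [p * q' = p' * q] as
    polynomials. This identity and its derivative, evaluated at [s], give the equality of the two
    values of the quotient rule. *)
Lemma hasder_unique s r d d' : hasder s r d -> hasder s r d' -> d = d'.
Proof.
move=> [p [q [[qs rpq] ->]]] [p' [q' [[qs' rpq'] ->]]].
have E : p * q' = p' * q.
  apply: (@poly_eq_dense _ _ (q * q')).
    by rewrite mulf_neq0 //; [exact: horner_neq0 qs|exact: horner_neq0 qs'].
  move=> t; rewrite hornerM mulf_eq0 negb_or => /andP[qt qt'].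
  have := rpq t qt; rewrite (rpq' t qt') => /eqP; rewrite eqr_div //.
  by move=> /eqP e; rewrite !hornerM.
have E0 := congr1 (fun p => p.[s]) E; rewrite !hornerM in E0.
have E1 := congr1 (fun p => p^`().[s]) E; rewrite !derivM !hornerE in E1.
rewrite /ratder; apply/eqP; rewrite eqr_div ?expf_neq0 // -subr_eq0; apply/eqP.
move: p.[s] q.[s] p'.[s] q'.[s] p^`().[s] q^`().[s] p'^`().[s] q'^`().[s] E0 E1.
move=> P Q P1 Q1 Pd Qd P1d Q1d E0 E1.
transitivity (Q * Q1 * ((Pd * Q1 + P * Q1d) - (P1d * Q + P1 * Qd))
  - (Qd * Q1 + Q1d * Q) * (P * Q1 - P1 * Q)); first by ring.
by rewrite E0 E1 !subrr !mulr0 subrr.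
Qed.

(** A total function, with value 0 where [r] is not rational near [s], so that combinations of
    derivatives can be written without proofs of derivability. *)
Definition der (s : k) (r : k -> k) : k := xget 0 [set d | hasder s r d].

Lemma derE s r d : hasder s r d -> der s r = d.
Proof.
move=> h; apply: hasder_unique (h).
by have := @xgetPex _ 0 [set d | hasder s r d]; apply; exists d.
Qed.

Lemma hasder_der s r d : hasder s r d -> hasder s r (der s r).
Proof. by move=> h; rewrite (derE h). Qed.

Lemma hasder_local s r r' d (c : {poly k}) : c.[s] != 0 ->
  (forall t, c.[t] != 0 -> r t = r' t) -> hasder s r' d -> hasder s r d.
Proof.
move=> cs rr [p [q [[qs rpq] ->]]]; exists (p * c), (q * c); split.
  split; rewrite ?hornerM ?mulf_neq0 // => t.
  rewrite !hornerM mulf_eq0 negb_or => /andP[qt ct].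
  by rewrite rr // rpq // -mulf_div divff // mulr1.
rewrite /ratder !derivM !(hornerD, hornerM); field; by rewrite qs cs.
Qed.

Lemma hasder_cst s c : hasder s (fun=> c) 0.
Proof.
exists c%:P, 1; split.
  by split; rewrite ?hornerE ?oner_neq0 // => t; rewrite !hornerE divr1.
by rewrite /ratder -polyC1 !derivC !hornerC mul0r mulr0 subrr mul0r.
Qed.

Lemma hasder_id s : hasder s id 1.
Proof.
exists 'X, 1; split.
  by split; rewrite ?hornerE ?oner_neq0 // => t; rewrite !hornerE divr1.
by rewrite /ratder derivX -polyC1 derivC !hornerC mulr0 subr0 mul1r expr1n divr1.
Qed.

Lemma hasderD s r r' d d' : hasder s r d -> hasder s r' d' ->
  hasder s (fun t => r t + r' t) (d + d').
Proof.
move=> [p [q [[qs rpq] ->]]] [p' [q' [[qs' rpq'] ->]]].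
exists (p * q' + p' * q), (q * q'); split.
  split; rewrite ?hornerM ?mulf_neq0 // => t.
  rewrite hornerM mulf_eq0 negb_or => /andP[qt qt'].
  by rewrite rpq // rpq' // addf_div // !hornerE.
rewrite /ratder !derivD !derivM !(hornerD, hornerM); field; by rewrite qs qs'.
Qed.

Lemma hasderM s r r' d d' : hasder s r d -> hasder s r' d' ->
  hasder s (fun t => r t * r' t) (d * r' s + r s * d').
Proof.
move=> [p [q [[qs rpq] ->]]] [p' [q' [[qs' rpq'] ->]]].
exists (p * p'), (q * q'); split.
  split; rewrite ?hornerM ?mulf_neq0 // => t.
  rewrite hornerM mulf_eq0 negb_or => /andP[qt qt'].
  by rewrite rpq // rpq' // mulf_div !hornerE.
rewrite rpq // rpq' // /ratder !derivM !(hornerD, hornerM); field; by rewrite qs qs'.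
Qed.

Lemma hasder_sum (I : Type) (l : seq I) (P : pred I) s (r : I -> k -> k) (d : I -> k) :
  (forall i, hasder s (r i) (d i)) ->
  hasder s (fun t => \sum_(i <- l | P i) r i t) (\sum_(i <- l | P i) d i).
Proof.
move=> H; elim: l => [|i l IHl].
  by under eq_fun do rewrite big_nil; rewrite big_nil; exact: hasder_cst.
under eq_fun do rewrite big_cons; rewrite big_cons; case: (P i) => //.
exact: hasderD.
Qed.

Lemma hasder_div s r r' d d' : hasder s r d -> hasder s r' d' -> r' s != 0 ->
  hasder s (fun t => r t / r' t) ((d * r' s - r s * d') / r' s ^+ 2).
Proof.
move=> [p [q [[qs rpq] ->]]] [p' [q' [[qs' rpq'] ->]]] rs.
have ps' : p'.[s] != 0.
  by apply: contraNneq rs => ps'; rewrite rpq' // ps' mul0r.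
exists (p * (q' * q')), (q * (p' * q')); split.
  split; rewrite ?hornerM ?mulf_neq0 // => t.
  rewrite !hornerM !mulf_eq0 !negb_or => /andP[qt /andP[pt' qt']].
  by rewrite rpq // rpq' //; field; rewrite qt pt' qt'.
rewrite rpq // rpq' // /ratder !derivM !(hornerD, hornerM); field; by rewrite qs qs' ps'.
Qed.

Lemma hasder_shift s r d c : hasder (s + c) r d -> hasder s (fun t => r (t + c)) d.
Proof.
move=> [p [q [[qs rpq] ->]]]; exists (p \Po ('X + c%:P)), (q \Po ('X + c%:P)).
have E u t : (u \Po ('X + c%:P)).[t] = u.[t + c] by rewrite horner_comp !hornerE.
split; first by split=> [|t]; rewrite !E //; exact: rpq.
by rewrite /ratder !deriv_comp !hornerM !E derivD derivX derivC addr0 hornerC !mulr1.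
Qed.

(** Subtract the multiple of [q] that makes the difference u vanish at [s]; u satisfies the same
    relation u' q = u q'. If u had a zero of order m + 1 at [s], then u' q would vanish there to
    order exactly m in characteristic zero, but u q' to order at least m + 1. *)
Lemma deriv_ratio_cst (p q : {poly k}) s : q.[s] != 0 ->
  p^`() * q = p * q^`() -> p = (p.[s] / q.[s]) *: q.
Proof.
move=> qs E; set c := p.[s] / q.[s]; pose u := p - c *: q.
have us : root u s by rewrite rootE /u !hornerE /c mulfVK // subrr.
have {}E : u^`() * q = u * q^`().
  by rewrite /u derivB derivZ !mulrBl E -!scalerAl [q^`() * q]mulrC.
suff u0 : u = 0 by apply/eqP; rewrite -subr_eq0 -/u u0.
apply: contraTeq isT => un0.
have [m [v]] := multiplicity_XsubC u s; rewrite un0 /= => vs uE.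
case: m uE => [|m] uE; first by rewrite uE expr0 mulr1 (negPf vs) in us.
have /eqP : ('X - s%:P) ^+ m * ((v^`() * q - v * q^`()) * ('X - s%:P) + (v * q) *+ m.+1) = 0.
  have dE : u^`() = v^`() * (('X - s%:P) ^+ m * ('X - s%:P)) + v * (('X - s%:P) ^+ m * m.+1%:R).
    by rewrite uE derivM deriv_exp /= derivXsubC mul1r exprSr mulr_natr.
  move/eqP: E; rewrite -subr_eq0 => /eqP <-; rewrite dE uE exprSr -mulr_natr.
  move: ('X - s%:P) (m.+1%:R : {poly k}) (v^`()) (q^`()) => X N v' q'.
  by move: (X ^+ m) => M; ring.
rewrite mulf_eq0 expf_eq0 polyXsubC_eq0 andbF /= => /eqP /(congr1 (fun p => p.[s])).
rewrite horner0 !hornerE subrr mulr0 add0r hornerMn hornerM => /eqP.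
rewrite -mulr_natr !mulf_eq0 (negPf qs) (negPf (natr_neq0 m)) !orbF => vs0.
by rewrite rootE vs0 in vs.
Qed.

Lemma ratder_cst (p q : {poly k}) s : q.[s] != 0 ->
  (forall t, q.[t] != 0 -> ratder p q t = 0) ->
  forall t, q.[t] != 0 -> p.[t] / q.[t] = p.[s] / q.[s].
Proof.
move=> qs H t qt.
have E : p^`() * q = p * q^`().
  apply: (poly_eq_dense (horner_neq0 qs)) => u qu; have /eqP := H u qu.
  rewrite mulf_eq0 invr_eq0 expf_eq0 (negPf qu) orbF subr_eq0 => /eqP.
  by rewrite !hornerM.
by rewrite (deriv_ratio_cst qs E) !hornerZ mulfK // mulfK.
Qed.

End Derivative.

Section Line.
Variable k : fieldType.
Hypothesis k0 : [pchar k] =i pred0.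

Definition line (b : {poly k}) : kspace k k :=
  kinduced [set t : k | b.[t] != 0] (fun t => [ffun=> t]) (affine_space k 'I_1).

Lemma line_ringed b : is_ringed (line b).
Proof. by apply: kinduced_ringed; exact: affine_ringed. Qed.

Lemma line_kspace b : is_kspace (line b).
Proof. exact/ringed_space/line_ringed. Qed.

Lemma line_carrier b t : carrier (line b) t <-> b.[t] != 0.
Proof. by split=> [[]|bt]; [|split]. Qed.

Lemma line_coord b : kreg (line b) (carrier (line b)) id.
Proof.
split; first exact: (kopenT (line_kspace b)).
move=> t Ct; exists setT, (fun v : {ffun 'I_1 -> k} => v ord0); split => //.
  exact: affine_coord.
by move=> u _ _; rewrite ffunE.
Qed.

Lemma line_poly b (p : {poly k}) : kreg (line b) (carrier (line b)) (fun t => p.[t]).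
Proof.
have br := line_ringed b; have oT := kopenT (line_kspace b).
under eq_fun do rewrite horner_coef.
apply: (ringed_sum br) => // i; apply: (ringed_mul br); first exact: (ringed_cst br).
by apply: (ringed_exp br); exact: line_coord.
Qed.

Lemma poly_eval_diag (p : {mpoly k[#|'I_1|]}) :
  exists P : {poly k}, forall t, P.[t] = poly_eval p [ffun=> t].
Proof.
exists (mmap polyC (fun=> 'X) p) => t.
rewrite /poly_eval mevalE /mmap horner_sum.
apply: eq_bigr => m _; rewrite hornerM hornerC /mmap1 horner_prod; congr (_ * _).
by apply: eq_bigr => i _; rewrite ffunE hornerXn.
Qed.

Lemma line_openP b W s : kopen (line b) W -> W s ->
  exists q : {poly k}, q.[s] != 0 /\ forall t, q.[t] != 0 -> W t.
Proof.
move=> [V /affine_openP oV ->] [[/= bs _] Vs]; have [p ps pV] := oV _ Vs.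
have [P PE] := poly_eval_diag p; exists (P * b); rewrite hornerM mulf_neq0 ?PE //.
split => // t; rewrite hornerM mulf_eq0 negb_or PE => /andP[/pV Vt bt].
by [].
Qed.

Lemma line_regP b W r s : kreg (line b) W r -> W s ->
  exists p q : {poly k}, q.[s] != 0 /\
    forall t, q.[t] != 0 -> W t /\ r t = p.[t] / q.[t].
Proof.
move=> [oW rW] Ws; have [c [cs cW]] := line_openP oW Ws.
have [V [h [[/affine_openP oV hV] Vs rh]]] := rW s Ws.
have [p [q [qs hpq]]] := hV _ Vs; have [v vs vV] := oV _ Vs.
have [P PE] := poly_eval_diag p; have [Q QE] := poly_eval_diag q.
have [R RE] := poly_eval_diag v.
exists (P * (R * c)), (Q * (R * c)); rewrite !hornerM !mulf_neq0 ?QE ?RE //.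
split => // t; rewrite !hornerM !mulf_eq0 !negb_or QE RE => /andP[qt /andP[vt ct]].
have Wt := cW t ct; split => //; rewrite rh //; last exact: vV.
rewrite hpq //; last exact: vV.
by rewrite -mulf_div divff ?mulr1 ?PE ?mulf_neq0 // RE.
Qed.

Lemma line_hasder b W r s : kreg (line b) W r -> W s -> hasder s r (der s r).
Proof.
move=> rW Ws; have [p [q [qs H]]] := line_regP rW Ws.
apply: (hasder_der k0 (d := ratder p q s)); exists p, q; split => //.
by split => // t /H[].
Qed.

Lemma line_dense b r c : kreg (line b) (carrier (line b)) r ->
  b.[c] != 0 -> (forall t, b.[t] != 0 -> t != c -> r t = 0) -> r c = 0.
Proof.
move=> rW bc r0.
have [p [q [qc H]]] := line_regP rW (proj2 (line_carrier _ _) bc).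
have [_ ->] := H c qc.
suff -> : p = 0 by rewrite horner0 mul0r.
apply: (@poly_eq_dense _ k0 _ _ (q * ('X - c%:P))).
  by rewrite mulf_neq0 ?polyXsubC_eq0 // (horner_neq0 qc).
move=> t; rewrite hornerM mulf_eq0 negb_or => /andP[qt tc]; rewrite horner0.
have [[bt _] E] := H t qt; move/eqP: E; rewrite r0 //.
  by rewrite eq_sym mulf_eq0 invr_eq0 (negPf qt) orbF => /eqP.
by move: tc; rewrite !hornerE subr_eq0.
Qed.

End Line.

(** * Point derivations *)

Section PointDerivations.
Variable k : fieldType.
Hypothesis k0 : [pchar k] =i pred0.

(** Derivations of the local ring at [x], without forming germs: [D] is defined on all functions,
    and [pderiv_local] makes it depend only on the germ of a regular one. *)
Record pderiv (T : Type) (X : kspace k T) (x : T) (D : (T -> k) -> k) : Prop := PDeriv {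
  pderiv_add : forall W f g, kreg X W f -> kreg X W g -> W x ->
    D (fun y => f y + g y) = D f + D g;
  pderiv_mul : forall W f g, kreg X W f -> kreg X W g -> W x ->
    D (fun y => f y * g y) = D f * g x + f x * D g;
  pderiv_cst : forall c, D (fun=> c) = 0;
  pderiv_local : forall W f g, kreg X W f -> W x ->
    (forall y, W y -> f y = g y) -> D f = D g
}.

Lemma pderiv_push T1 T2 (X : kspace k T1) (Y : kspace k T2) x D f :
  carrier X x -> pderiv X x D -> kmorphism X Y f ->
  pderiv Y (f x) (fun h => D (h \o f)).
Proof.
move=> Cx [Da Dm Dc Dl] [_ _ fr]; split => //.
- by move=> W u v uW vW Wx; exact: (Da _ _ _ (fr _ _ uW) (fr _ _ vW)).
- by move=> W u v uW vW Wx; exact: (Dm _ _ _ (fr _ _ uW) (fr _ _ vW)).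
- by move=> W u v uW Wx uv; apply: (Dl _ _ _ (fr _ _ uW)) => // y [_ /uv].
Qed.

Lemma pderiv_curves (J : finType) T (X : kspace k T) x (a : J -> k)
    (b : J -> {poly k}) (s : J -> k) (c : J -> k -> T) :
  (forall j, kmorphism (line (b j)) X (c j)) -> (forall j, (b j).[s j] != 0) ->
  (forall j, c j (s j) = x) ->
  pderiv X x (fun h => \sum_j a j * der (s j) (h \o c j)).
Proof.
move=> cM bs cs.
have P W f j : kreg X W f -> W x -> hasder (s j) (f \o c j) (der (s j) (f \o c j)).
  move=> fW Wx; have [_ _ cr] := cM j.
  by apply: (line_hasder k0 (cr _ _ fW)); split; [exact/line_carrier|rewrite /preimage /= cs].
split.
- move=> W f g fW gW Wx; rewrite -big_split /=; apply: eq_bigr => j _.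
  by rewrite -mulrDr (derE k0 (hasderD (P _ _ j fW Wx) (P _ _ j gW Wx))).
- move=> W f g fW gW Wx; rewrite mulr_suml mulr_sumr -big_split /=.
  apply: eq_bigr => j _.
  rewrite (derE k0 (hasderM (P _ _ j fW Wx) (P _ _ j gW Wx))) /= cs mulrDr mulrA.
  by congr (_ + _); rewrite mulrCA.
- move=> u; rewrite big1 // => j _.
  by rewrite (derE k0 (hasder_cst (s j) u)) mulr0.
- move=> W f g fW Wx fg; apply: eq_bigr => j _; congr (_ * _).
  have [_ _ cr] := cM j.
  have Ws : (carrier (line (b j)) `&` c j @^-1` W) (s j).
    by split; [exact/line_carrier|rewrite /preimage /= cs].
  have [p [q [qs H]]] := line_regP (cr _ _ fW) Ws.
  apply/esym/(derE k0)/(hasder_local qs _ (P _ _ j fW Wx)) => t /H[[_ Wt] _].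
  by rewrite /= fg.
Qed.

Section Vanishing.
Variables (T : Type) (X : kspace k T) (x : T) (D : (T -> k) -> k).
Hypotheses (Xr : is_ringed X) (XD : pderiv X x D).
Let Xs := ringed_space Xr.

Lemma pderiv_meval0 n (p : {mpoly k[n]}) W (c : 'I_n -> T -> k) : W x ->
  (forall i, kreg X W (c i)) -> (forall i, D (c i) = 0) -> kopen X W ->
  D (fun y => p.@[fun i => c i y]) = 0.
Proof.
move=> Wx cW c0 oW.
pose Z f := kreg X W f /\ D f = 0.
have Zc u : Z (fun=> u) by split; [exact: (ringed_cst Xr)|exact: pderiv_cst XD u].
have Za f g : Z f -> Z g -> Z (fun y => f y + g y).
  move=> [fW f0] [gW g0]; split; first exact: (ringed_add Xr).
  by rewrite (pderiv_add XD fW gW Wx) f0 g0 addr0.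
have Zm f g : Z f -> Z g -> Z (fun y => f y * g y).
  move=> [fW f0] [gW g0]; split; first exact: (ringed_mul Xr).
  by rewrite (pderiv_mul XD fW gW Wx) f0 g0 mul0r mulr0 addr0.
suff [] : Z (fun y => p.@[fun i => c i y]) by [].
under eq_fun do rewrite mevalE.
elim: (msupp p) => [|m l IHl]; first by under eq_fun do rewrite big_nil.
under eq_fun do rewrite big_cons; apply: (Za _ _) => //; apply: (Zm _ _) => //.
elim: (index_enum _) => [|i r IHr]; first by under eq_fun do rewrite big_nil.
under eq_fun do rewrite big_cons; apply: (Zm _ _) => //.
elim: (m i) => [|e IHe]; first by under eq_fun do rewrite expr0.
by under eq_fun do rewrite exprS; apply: (Zm _ _).
Qed.

(** Applying [D] to [h * q = p], where both polynomials are killed, leaves [D h] times the nonzero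
    value of [q] at [x]. *)
Lemma pderiv_rational0 n (p q : {mpoly k[n]}) W V h (c : 'I_n -> T -> k) :
  W x -> (forall i, kreg X W (c i)) -> (forall i, D (c i) = 0) ->
  kreg X V h -> V x -> q.@[fun i => c i x] != 0 ->
  (forall y, W y -> V y -> q.@[fun i => c i y] != 0 ->
     h y = p.@[fun i => c i y] / q.@[fun i => c i y]) -> kopen X W ->
  D h = 0.
Proof.
move=> Wx cW c0 hV Vx qx hpq oW.
have oV := kreg_open Xs hV.
have pW : kreg X W (fun y => p.@[fun i => c i y]) by exact: ringed_meval.
have qW : kreg X W (fun y => q.@[fun i => c i y]) by exact: ringed_meval.
have oN := kopenI Xs (ringed_neq0 Xr qW) oV.
set N := _ `&` V in oN.
have hN : kreg X N h by apply: (kreg_restr Xs hV) => // y [].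
have qN : kreg X N (fun y => q.@[fun i => c i y]).
  by apply: (kreg_restr Xs qW) => // y [[]].
have Nx : N x by [].
have E : forall y, N y -> h y * q.@[fun i => c i y] = p.@[fun i => c i y].
  by move=> y [[Wy qy] Vy]; rewrite hpq // mulfVK.
have := pderiv_local XD (ringed_mul Xr hN qN) Nx E.
rewrite (pderiv_meval0 p Wx) // (pderiv_mul XD hN qN Nx).
rewrite (pderiv_meval0 q Wx) // mulr0 addr0 => /eqP.
by rewrite mulf_eq0 (negPf qx) orbF => /eqP.
Qed.

End Vanishing.

Lemma pderiv_affine0 (I : finType) (v : {ffun I -> k}) D :
  pderiv (affine_space k I) v D -> (forall i, D (fun w => w i) = 0) ->
  forall V h, kreg (affine_space k I) V h -> V v -> D h = 0.
Proof.
move=> vD D0 V h hV Vv; have [p [q [qv hpq]]] := hV.2 v Vv.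
apply: (pderiv_rational0 (affine_ringed k I) vD (p := p) (q := q) (W := setT)
  (c := fun i w => w (enum_val i)) _ _ _ hV Vv) => //.
- by move=> i; exact: affine_coord.
- by move=> y _; exact: hpq.
- exact: (kopenT (affine_kspace k I)).
Qed.

Lemma pderiv_induced0 T T' (S : set T) (e : T -> T') (Y : kspace k T') x D :
  is_ringed Y -> pderiv (kinduced S e Y) x D ->
  (forall V h, kreg Y V h -> V (e x) -> D (h \o e) = 0) ->
  forall W h, kreg (kinduced S e Y) W h -> W x -> D h = 0.
Proof.
move=> Yr xD D0 W h hW Wx; have [oW hr] := hW.
have [V [h' [hV Vx hh]]] := hr x Wx.
have Xs := kinduced_kspace S e (ringed_space Yr).
rewrite -(D0 V h' hV Vx).
apply: (pderiv_local xD (W := W `&` (carrier (kinduced S e Y) `&` e @^-1` V))).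
- apply: (kreg_restr Xs hW) => [|y []//]; apply: kopenI => //.
  by exists V => //; exact: (kreg_open (ringed_space Yr) hV).
- by do 2?split => //; exact: (kopen_sub Xs oW).
- by move=> y [Wy [_ Vy]]; exact: hh.
Qed.

Lemma pderiv_prod0 T1 T2 (X : kspace k T1) (Y : kspace k T2) p D :
  is_ringed X -> is_ringed Y -> pderiv (kprod X Y) p D ->
  (forall V h, kreg X V h -> V p.1 -> D (h \o fst) = 0) ->
  (forall V h, kreg Y V h -> V p.2 -> D (h \o snd) = 0) ->
  forall W h, kreg (kprod X Y) W h -> W p -> D h = 0.
Proof.
move=> Xr Yr pD D1 D2 W h hW Wp; have Ps := kprod_kspace Xr Yr.
have Pr := kprod_ringed Xr Yr.
have [U [V [h1 [h2 [oU oV [T1h T2h] [UVp hp] H]]]]] := hW.2 p Wp.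
have tens0 g : ktensor X Y U V g -> kreg (kprod X Y) (U `*` V) g /\ D g = 0.
  move=> gT; split; first exact: ktensor_reg.
  move: gT => [m [F [G [FG ->]]]].
  have oP : kopen (kprod X Y) (U `*` V) by exact: kprod_open_rect.
  have FU i : kreg (kprod X Y) (U `*` V) (fun q => F i q.1).
    by have [FU _] := FG i; apply: ktensor_reg => //; exact: ktensor_fst.
  have GV i : kreg (kprod X Y) (U `*` V) (fun q => G i q.2).
    by have [_ GV] := FG i; apply: ktensor_reg => //; exact: ktensor_snd.
  have FGr i := ringed_mul Pr (FU i) (GV i).
  have [Up Vp] := UVp.
  elim: (index_enum _) => [|i r IHr].
    by under eq_fun do rewrite big_nil; exact: pderiv_cst pD 0.
  under eq_fun do rewrite big_cons.
  rewrite (pderiv_add pD (FGr i) _ UVp); last first.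
    by apply: (ringed_sum Pr).
  rewrite IHr addr0 (pderiv_mul pD (FU i) (GV i) UVp).
  have [Fr Gr] := FG i.
  by rewrite (D1 _ _ Fr Up) (D2 _ _ Gr Vp) mul0r mulr0 addr0.
have [h1r h10] := tens0 _ T1h; have [h2r h20] := tens0 _ T2h.
have oW := kreg_open Ps hW.
have oN := kopenI Ps (ringed_neq0 Pr h2r) oW.
set N := _ `&` W in oN.
have hN : kreg (kprod X Y) N h by apply: (kreg_restr Ps hW) => // y [].
have h2N : kreg (kprod X Y) N h2 by apply: (kreg_restr Ps h2r) => // y [[]].
have Np : N p by [].
have E : forall y, N y -> h y * h2 y = h1 y.
  by move=> y [[UVy hy] Wy]; rewrite H // mulfVK.
have := pderiv_local pD (ringed_mul Pr hN h2N) Np E.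
rewrite h10 (pderiv_mul pD hN h2N Np) h20 mulr0 addr0 => /eqP.
by rewrite mulf_eq0 (negPf hp) orbF => /eqP.
Qed.

End PointDerivations.

(** * Families of polynomial maps *)

Section Families.
Variables (k : fieldType) (n : nat).
Local Notation poly := {mpoly k[n]}.

(** An algebraic family, that is, a morphism to a finite-dimensional space of polynomials. The
    degree bound is what later puts a family of automorphisms into a single piece of the
    filtration. *)
Definition rfam (T : Type) (X : kspace k T) (p : T -> poly) : Prop :=
  (exists d, forall x, carrier X x -> (msize (p x) <= d)%N) /\
  forall m, kreg X (carrier X) (fun x => (p x)@_m).

Lemma rfam_pull T1 T2 (X : kspace k T1) (Y : kspace k T2) f p :
  is_kspace X -> kmorphism X Y f -> rfam Y p -> rfam X (p \o f).
Proof.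
move=> Xs [fC _ fr] [[d pd] pr]; split; first by exists d => x /fC/pd.
move=> m; have := fr _ _ (pr m); congr kreg; apply/seteqP; split=> x; first by case.
by move=> Cx; split => //; exact: fC.
Qed.

Section OneSpace.
Variables (T : Type) (X : kspace k T).
Hypothesis Xr : is_ringed X.
Let Xs := ringed_space Xr.
Let oT := kopenT Xs.

Lemma rfam_eq p q : rfam X p -> (forall x, carrier X x -> p x = q x) -> rfam X q.
Proof.
move=> [[d pd] pr] pq; split; first by exists d => x Cx; rewrite -pq ?pd.
by move=> m; apply: (kreg_eq Xs (pr m)) => x Cx; rewrite pq.
Qed.

Lemma rfam_cst p : rfam X (fun=> p).
Proof. by split=> [|m]; [exists (msize p)|exact: (ringed_cst Xr)]. Qed.

Lemma rfam_add p q : rfam X p -> rfam X q -> rfam X (fun x => p x + q x).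
Proof.
move=> [[d pd] pr] [[e qe] qr]; split.
  exists (maxn d e) => x Cx; apply: leq_trans (msizeD_le _ _) _.
  by rewrite geq_max !leq_max pd // qe // orbT.
by move=> m; under eq_fun do rewrite mcoeffD; exact: (ringed_add Xr).
Qed.

Lemma rfam_mul p q : rfam X p -> rfam X q -> rfam X (fun x => p x * q x).
Proof.
move=> [[d pd] pr] [[e qe] qr]; split.
  exists (d + e).+1 => x Cx; apply: leq_trans (msizeM_le _ _) _.
  by rewrite ltnS leq_add ?pd ?qe.
move=> m; under eq_fun do rewrite mcoeffM.
by apply: (ringed_sum Xr) => // ij; exact: (ringed_mul Xr).
Qed.

Lemma rfam_coef f p : kreg X (carrier X) f -> rfam X (fun x => f x *: p).
Proof.
move=> fr; split; first by exists (msize p) => x _; exact: msizeZ_le.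
move=> m; under eq_fun do rewrite mcoeffZ.
by apply: (ringed_mul Xr) => //; exact: (ringed_cst Xr).
Qed.

Lemma rfam_scale f p : kreg X (carrier X) f -> rfam X p ->
  rfam X (fun x => f x *: p x).
Proof.
move=> fr pr; have := rfam_mul (rfam_coef 1 fr) pr.
by move=> H; apply: (rfam_eq H) => x _; rewrite -scalerAl mul1r.
Qed.

Lemma rfam_sum (I : Type) (r : seq I) (P : pred I) (F : I -> T -> poly) :
  (forall i, rfam X (F i)) -> rfam X (fun x => \sum_(i <- r | P i) F i x).
Proof.
move=> FX; elim: r => [|i r IHr].
  by under eq_fun do rewrite big_nil; exact: rfam_cst.
under eq_fun do rewrite big_cons; case: (P i) => //.
exact: rfam_add.
Qed.

Lemma rfam_prod (I : Type) (r : seq I) (P : pred I) (F : I -> T -> poly) :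
  (forall i, rfam X (F i)) -> rfam X (fun x => \prod_(i <- r | P i) F i x).
Proof.
move=> FX; elim: r => [|i r IHr].
  by under eq_fun do rewrite big_nil; exact: rfam_cst.
under eq_fun do rewrite big_cons; case: (P i) => //.
exact: rfam_mul.
Qed.

Lemma rfam_exp p d : rfam X p -> rfam X (fun x => p x ^+ d).
Proof.
move=> pX; elim: d => [|d IHd]; first exact: rfam_cst.
by under eq_fun do rewrite exprS; exact: rfam_mul.
Qed.

Lemma rfam_comp (p : T -> poly) (g : T -> n.-tuple poly) :
  rfam X p -> (forall i, rfam X (fun x => tnth (g x) i)) ->
  rfam X (fun x => p x \mPo g x).
Proof.
move=> [[d pd] pr] gX.
(* By the degree bound the sum over monomials is finite and its index set does not depend on [x]. *)
apply: (@rfam_eq (fun x => \sum_(m : 'X_{1..n < d})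
    ((p x)@_m *: \prod_(i < n) (tnth (g x) i) ^+ (m i)))).
  apply: rfam_sum => m; apply: rfam_scale => //.
  by apply: rfam_prod => i; exact: rfam_exp.
by move=> x Cx; rewrite -(comp_mpolywE _ (pd x Cx)).
Qed.

Lemma rfam_deriv (p : T -> poly) i : rfam X p -> rfam X (fun x => (p x)^`M(i)).
Proof.
move=> [[d pd] pr]; split; last first.
  move=> m; under eq_fun do rewrite mcoeff_deriv -mulr_natr.
  by apply: (ringed_mul Xr) => //; exact: (ringed_cst Xr).
exists d => x Cx; rewrite msizeE; apply/bigmax_leqP_seq => m + _.
rewrite mcoeff_msupp mcoeff_deriv => H.
have : (m + U_(i))%MM \in msupp (p x).
  by rewrite mcoeff_msupp; apply: contraNneq H => ->; rewrite mul0rn.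
move/msize_mdeg_lt => /leq_trans/(_ (pd x Cx)); rewrite mdegD mdeg1 addn1.
exact: ltnW.
Qed.

Lemma rfam_det d (A : T -> 'M[poly]_d) :
  (forall i j, rfam X (fun x => A x i j)) -> rfam X (fun x => \det (A x)).
Proof.
move=> AX; rewrite /determinant; apply: rfam_sum => s.
by apply: rfam_mul; [exact: rfam_cst|apply: rfam_prod].
Qed.

Lemma rfam_adj d (A : T -> 'M[poly]_d) i j :
  (forall i j, rfam X (fun x => A x i j)) -> rfam X (fun x => (\adj (A x)) i j).
Proof.
move=> AX; under eq_fun do rewrite mxE /cofactor.
apply: rfam_mul; first exact: rfam_cst.
by apply: rfam_det => a b; under eq_fun do rewrite !mxE.
Qed.

Lemma rfam_neq_open p q : rfam X p -> rfam X q ->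
  kopen X [set x | carrier X x /\ p x <> q x].
Proof.
move=> [_ pr] [_ qr]; apply: kopen_local => // x [Cx pq].
have [m pqm] : exists m, (p x)@_m != (q x)@_m.
  apply: contrapT => H; apply: pq; apply/mpolyP => m; apply/eqP/negPn/negP => pqm.
  by apply: H; exists m.
exists [set y | carrier X y /\ (p y)@_m - (q y)@_m != 0]; split.
- by apply: (ringed_neq0 Xr); exact: ringed_sub.
- by rewrite /= subr_eq0.
- by move=> y [Cy]; rewrite subr_eq0 => pqy; split => // e; rewrite e eqxx in pqy.
Qed.

End OneSpace.
End Families.

(** * Velocities of families of polynomials *)

Section Velocity.
Variables (k : fieldType) (n : nat).
Hypothesis k0 : [pchar k] =i pred0.
Local Notation poly := {mpoly k[n]}.

Definition isder (b : {poly k}) (s : k) (p : k -> poly) (P : poly) : Prop :=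
  [/\ rfam (line b) p, b.[s] != 0
    & forall m, hasder s (fun t => (p t)@_m) (P@_m)].

Section AtPoint.
Variables (b : {poly k}) (s : k).
Hypothesis bs : b.[s] != 0.
Let br := line_ringed b.

Lemma isder_ex p : rfam (line b) p -> exists P, isder b s p P.
Proof.
move=> pL; have [[d pd] pr] := pL.
have pm m : hasder s (fun t => (p t)@_m) (der s (fun t => (p t)@_m)).
  by apply: (line_hasder k0 (pr m)); exact/line_carrier.
exists (\sum_(m : 'X_{1..n < d}) der s (fun t => (p t)@_m) *: 'X_[m]).
split=> // m; rewrite (_ : _@_m = der s (fun t => (p t)@_m)) //.
have [md|md] := ltnP (mdeg m) d.
  rewrite raddf_sum /= (bigD1 (BMultinom md)) //= mcoeffZ mcoeffX eqxx mulr1.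
  rewrite big1 ?addr0 // => m' m'm; rewrite mcoeffZ mcoeffX.
  by rewrite (_ : _ == m = false) ?mulr0 //; apply: contraNF m'm; rewrite bmeqP.
rewrite raddf_sum /= big1 => [|m' _].
  apply/esym/(derE k0)/(hasder_local bs _ (hasder_cst s 0)) => t bt.
  by apply/memN_msupp_eq0/msize_mdeg_ge/(leq_trans _ md)/pd/line_carrier.
rewrite mcoeffZ mcoeffX (_ : _ == m = false) ?mulr0 //.
by apply: contraTF md => /eqP <-; rewrite -ltnNge bmdeg.
Qed.

Lemma isder_unique p P P' : isder b s p P -> isder b s p P' -> P = P'.
Proof.
move=> [_ _ pP] [_ _ pP']; apply/mpolyP => m.
exact: (hasder_unique k0 (pP m) (pP' m)).
Qed.

Lemma isder_eq p q P : isder b s p P -> (forall t, b.[t] != 0 -> p t = q t) ->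
  isder b s q P.
Proof.
move=> [pL _ pP] pq; split => // [|m].
  by apply: (rfam_eq br pL) => t /line_carrier/pq.
by apply: (hasder_local bs _ (pP m)) => t /pq ->.
Qed.

Lemma isder_cst p : isder b s (fun=> p) 0.
Proof.
split=> // [|m]; first exact: (rfam_cst br).
by rewrite mcoeff0; exact: hasder_cst.
Qed.

Lemma isderD p q P Q : isder b s p P -> isder b s q Q ->
  isder b s (fun t => p t + q t) (P + Q).
Proof.
move=> [pL _ pP] [qL _ qQ]; split=> // [|m]; first exact: (rfam_add br).
by under eq_fun do rewrite mcoeffD; rewrite mcoeffD; exact: hasderD.
Qed.

Lemma isderM p q P Q : isder b s p P -> isder b s q Q ->
  isder b s (fun t => p t * q t) (P * q s + p s * Q).
Proof.
move=> [pL _ pP] [qL _ qQ]; split=> // [|m]; first exact: (rfam_mul br).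
under eq_fun do rewrite mcoeffM; rewrite mcoeffD !mcoeffM -big_split /=.
by apply: hasder_sum => ij; exact: hasderM.
Qed.

Lemma isder_sum (I : Type) (r : seq I) (A : pred I) (p : I -> k -> poly) P :
  (forall i, isder b s (p i) (P i)) ->
  isder b s (fun t => \sum_(i <- r | A i) p i t) (\sum_(i <- r | A i) P i).
Proof.
move=> pP; elim: r => [|i r IHr].
  by under eq_fun do rewrite big_nil; rewrite big_nil; exact: isder_cst.
under eq_fun do rewrite big_cons; rewrite big_cons; case: (A i) => //.
exact: isderD.
Qed.

Lemma isder_coef f d p : kreg (line b) (carrier (line b)) f -> hasder s f d ->
  isder b s (fun t => f t *: p) (d *: p).
Proof.
move=> fr fd; split=> // [|m]; first exact: (rfam_coef br).
under eq_fun do rewrite mcoeffZ; rewrite mcoeffZ.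
have := hasderM fd (hasder_cst s (p@_m)).
by rewrite mulr0 addr0.
Qed.

Lemma isderZ c p P : isder b s p P -> isder b s (fun t => c *: p t) (c *: P).
Proof.
move=> pP; have := isderM (isder_cst c%:MP) pP; rewrite mul0r add0r mul_mpolyC.
by move=> H; apply: (isder_eq H) => t _; rewrite mul_mpolyC.
Qed.

Lemma isder_id p : isder b s (fun t => t *: p) p.
Proof.
rewrite -[in X in isder _ _ _ X](scale1r p); apply: isder_coef.
  exact: line_coord.
exact: hasder_id.
Qed.

Lemma isder_deriv p P i : isder b s p P -> isder b s (fun t => (p t)^`M(i)) P^`M(i).
Proof.
move=> [pL _ pP]; split=> // [|m]; first exact: (rfam_deriv br).
under eq_fun do rewrite mcoeff_deriv -mulr_natr.
rewrite mcoeff_deriv -[P@__ *+ _]mulr_natr.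
have := hasderM (pP (m + U_(i))%MM) (hasder_cst s (m i).+1%:R).
by rewrite mulr0 addr0.
Qed.

(** Chain rule for a fixed outer polynomial: the [q] that satisfy it are stable under linear
    combinations and products and include the variables. *)
Lemma isder_comp_cst (q : poly) (g : k -> n.-tuple poly) (G : 'I_n -> poly) :
  (forall i, isder b s (fun t => tnth (g t) i) (G i)) ->
  isder b s (fun t => q \mPo g t) (\sum_(i < n) (q^`M(i) \mPo g s) * G i).
Proof.
move=> gG.
pose D (q : poly) := \sum_(i < n) (q^`M(i) \mPo g s) * G i.
pose C q := isder b s (fun t => q \mPo g t) (D q); rewrite -/(D q) -/(C q).
have CDZ c q1 q2 : C q1 -> C q2 -> C (c *: q1 + q2).
  move=> C1 C2; rewrite /C (_ : D _ = c *: D q1 + D q2).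
    apply: (isder_eq (isderD (isderZ c C1) C2)) => t _.
    by rewrite comp_mpolyD comp_mpolyZ.
  rewrite /D scaler_sumr -big_split /=; apply: eq_bigr => i _.
  by rewrite mderivD mderivZ comp_mpolyD comp_mpolyZ mulrDl scalerAl.
have CM q1 q2 : C q1 -> C q2 -> C (q1 * q2).
  move=> C1 C2; rewrite /C (_ : D _ = D q1 * (q2 \mPo g s) + (q1 \mPo g s) * D q2).
    by apply: (isder_eq (isderM C1 C2)) => t _; rewrite rmorphM.
  rewrite /D mulr_suml mulr_sumr -big_split /=; apply: eq_bigr => i _.
  by rewrite mderivM comp_mpolyD !rmorphM mulrDl -!mulrA; congr (_ * _ + _); rewrite mulrC.
have C1 : C 1.
  rewrite /C (_ : D _ = 0).
    by apply: (isder_eq (isder_cst 1)) => t _; rewrite comp_mpoly1.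
  by rewrite /D big1 // => i _; rewrite -mpolyC1 mderivC comp_mpoly0 mul0r.
have C0 : C 0.
  rewrite /C (_ : D _ = 0).
    by apply: (isder_eq (isder_cst 0)) => t _; rewrite comp_mpoly0.
  by rewrite /D big1 // => i _; rewrite mderiv0 comp_mpoly0 mul0r.
have CX i : C 'X_i.
  rewrite /C (_ : D _ = G i).
    by apply: (isder_eq (gG i)) => t _; rewrite comp_mpolyXU -tnth_nth.
  rewrite /D (bigD1 i) //= mderivXU eqxx rmorph1 mul1r.
  rewrite big1 ?addr0 // => l /negPf nli.
  by rewrite mderivXU eq_sym nli rmorph0 mul0r.
elim/mpolyind: q => [|c m p _ _ IH]; first exact: C0.
apply: (CDZ _ _ _ _ IH).
rewrite mpolyXE_id; elim/big_rec: _ => [|i q _ IHq]; first exact: C1.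
apply: (CM _ _ _ IHq).
elim: (m i) => [|e IHe]; first by rewrite expr0; exact: C1.
by rewrite exprS; exact: (CM _ _ (CX i) IHe).
Qed.

(** Chain rule when both polynomials move. The degree bound writes [p t] as a combination of fixed
    monomials with moving coefficients, to which the product rule and the case of a fixed outer
    polynomial apply termwise. *)
Lemma isder_comp (p : k -> poly) P (g : k -> n.-tuple poly) (G : 'I_n -> poly) :
  isder b s p P -> (forall i, isder b s (fun t => tnth (g t) i) (G i)) ->
  isder b s (fun t => p t \mPo g t)
    ((P \mPo g s) + \sum_(i < n) ((p s)^`M(i) \mPo g s) * G i).
Proof.
move=> pP gG; have [[[d pd] pr] _ pm] := pP.
set e := maxn d (msize P).
have pe t : b.[t] != 0 -> p t = \sum_(m : 'X_{1..n < e}) (p t)@_m *: 'X_[m].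
  move=> bt; apply: mpolywE; apply: leq_trans (leq_maxl _ _).
  exact/pd/line_carrier.
have Pe : P = \sum_(m : 'X_{1..n < e}) P@_m *: 'X_[m].
  by apply: mpolywE; exact: leq_maxr.
have H (m : 'X_{1..n < e}) := isderM (isder_coef 1 (pr m) (pm m)) (isder_comp_cst 'X_[m] gG).
have := isder_sum (index_enum 'X_{1..n < e}) predT H.
set R := (X in isder _ _ _ X); set R' := (X in _ -> isder _ _ _ X).
have -> : R = R'.
  rewrite /R /R' {2}Pe (raddf_sum (comp_mpoly (g s))) /=.
  under [X in _ = _ + X]eq_bigr do
    rewrite (pe s bs) (raddf_sum (mderiv _)) /= (raddf_sum (comp_mpoly (g s))) /= mulr_suml.
  rewrite exchange_big /= -big_split /=; apply: eq_bigr => m _.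
  rewrite comp_mpolyZ -scalerAl mul1r; congr (_ + _).
  rewrite -scalerAl mul1r scaler_sumr; apply: eq_bigr => i _.
  by rewrite mderivZ comp_mpolyZ -scalerAl.
move=> RR; apply: (isder_eq RR) => t bt; rewrite [in RHS](pe t bt) (raddf_sum (comp_mpoly (g t))) /=.
by apply: eq_bigr => m _; rewrite comp_mpolyZ -scalerAl mul1r.
Qed.

End AtPoint.

End Velocity.

(** * Families of automorphisms and the differential of a homomorphism *)

Section Automorphisms.
Variables (k : fieldType) (n : nat).
Hypothesis k0 : [pchar k] =i pred0.
Local Notation poly := {mpoly k[n]}.
Local Notation autA := (autA k n).

Lemma autA_inj1 (f g : autA) : f.1 = g.1 -> f = g.
Proof.
move=> fg; apply: val_inj; rewrite [LHS]surjective_pairing [RHS]surjective_pairing.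
congr (_, _) => //=; rewrite -[LHS]endo_comp_idr -(autAr g) endo_compA -fg.
by rewrite autAl endo_comp_idl.
Qed.

(** The inverses have to form a family too, since the variety structure of [Aut] is that of
    pairs. *)
Definition afam (T : Type) (X : kspace k T) (F : T -> autA) : Prop :=
  forall i, rfam X (fun x => tnth (F x).1 i) /\ rfam X (fun x => tnth (F x).2 i).

Lemma EndA_ringed d : is_ringed (EndA k n d).
Proof. by apply: kinduced_ringed; exact: affine_ringed. Qed.

Lemma EndA2_ringed d : is_ringed (ind_prod (EndA k n) (EndA k n) d).
Proof. by apply: kprod_ringed; exact: EndA_ringed. Qed.

Lemma Aut_ringed d : is_ringed (Aut k n d).
Proof. by apply: kinduced_ringed; exact: EndA2_ringed. Qed.

Lemma Aut_carrier d (f : autA) : carrier (Aut k n d) f <->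
  forall i, (msize (tnth f.1 i) <= d.+1)%N /\ (msize (tnth f.2 i) <= d.+1)%N.
Proof.
split=> [[_ [[H1 _] [H2 _]]] i|H]; first by split; [exact: H1|exact: H2].
by split => //; split; split => // i; have [] := H i.
Qed.

Lemma Aut_ind_carrier (f : autA) : ind_carrier (Aut k n) f.
Proof.
exists (\max_(i < n) maxn (msize (tnth f.1 i)) (msize (tnth f.2 i)))%N => //.
apply/Aut_carrier => i; have := leq_bigmax (F := fun i => maxn (msize (tnth f.1 i)) (msize (tnth f.2 i))) i.
by rewrite geq_max => /andP[h1 h2]; split; apply: leqW.
Qed.

Lemma kmorphism_Aut T (X : kspace k T) d (F : T -> autA) : is_ringed X ->
  (forall x, carrier X x -> carrier (Aut k n d) (F x)) ->
  (forall i m, kreg X (carrier X) (fun x => (tnth (F x).1 i)@_m)) ->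
  (forall i m, kreg X (carrier X) (fun x => (tnth (F x).2 i)@_m)) ->
  kmorphism X (Aut k n d) F.
Proof.
move=> Xr FC F1 F2; have Xs := ringed_space Xr.
apply: kmorphism_induced => //; first exact/ringed_space/EndA2_ringed.
have P (g : T -> endo k n) : (forall x, carrier X x -> forall i, (msize (tnth (g x) i) <= d.+1)%N) ->
    (forall i m, kreg X (carrier X) (fun x => (tnth (g x) i)@_m)) ->
    kmorphism X (EndA k n d) g.
  move=> gd gr; apply: kmorphism_induced => //; first exact: affine_kspace.
  apply: (kmorphism_affine Xr) => -[i m].
  by under eq_fun do rewrite ffunE; exact: gr.
apply: (kmorphism_eq Xs (kmorphism_pair Xr (P (fun x => (F x).1) _ _) (P (fun x => (F x).2) _ _))) => //.
- by move=> x /FC/Aut_carrier H i; case: (H i).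
- by move=> x /FC/Aut_carrier H i; case: (H i).
- by move=> x _ /=; case: (val (F x)).
Qed.

Lemma afam_bound T (X : kspace k T) F : afam X F ->
  exists d, forall e x, (d <= e)%N -> carrier X x -> carrier (Aut k n e) (F x).
Proof.
move=> FX.
have /choice[d dP] i : exists d, forall x, carrier X x ->
    (msize (tnth (F x).1 i) <= d)%N /\ (msize (tnth (F x).2 i) <= d)%N.
  have [[[d1 H1] _] [[d2 H2] _]] := FX i; exists (maxn d1 d2) => x Cx.
  by rewrite !leq_max H1 // H2 // orbT.
exists (\max_i d i)%N => e x de Cx; apply/Aut_carrier => i.
have [h1 h2] := dP i x Cx.
have die : (d i <= e.+1)%N by apply/leqW/(leq_trans _ de)/leq_bigmax.
by split; apply: leq_trans die.
Qed.

Lemma afam_kmorphism T (X : kspace k T) F (S : set autA) : is_ringed X ->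
  afam X F -> (forall x, carrier X x -> S (F x)) ->
  exists d, forall e, (d <= e)%N -> kmorphism X (ind_sub (Aut k n) S e) F.
Proof.
move=> Xr FX FS; have [d dP] := afam_bound FX; exists d => e de.
apply: kmorphism_sub => //.
- exact: ringed_space.
- exact/ringed_space/Aut_ringed.
- apply: kmorphism_Aut => // [x|i m|i m]; first exact: dP.
    by have [[]] := FX i.
  by have [_ []] := FX i.
Qed.

Lemma afam_cst T (X : kspace k T) f : is_ringed X -> afam X (fun=> f).
Proof. by move=> Xr i; split; exact: rfam_cst. Qed.

Lemma afam_mul T (X : kspace k T) F H : is_ringed X -> afam X F -> afam X H ->
  afam X (fun x => (F x * H x)%g).
Proof.
move=> Xr FX HX i; split; under eq_fun do rewrite endo_compE.
  apply: rfam_comp => //; first by have [] := FX i.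
  by move=> j; have [] := HX j.
apply: rfam_comp => //; first by have [] := HX i.
by move=> j; have [] := FX j.
Qed.

Lemma afam_line (b : {poly k}) s F : b.[s] != 0 -> afam (line b) F ->
  exists V : 'I_n -> poly, forall i, isder b s (fun t => tnth (F t).1 i) (V i).
Proof.
move=> bs FX.
have /choice[V VP] i : exists P, isder b s (fun t => tnth (F t).1 i) P.
  by apply: isder_ex => //; have [] := FX i.
by exists V.
Qed.

(** Differentiate the relation saying that [(F t).2] composed with [(F t).1] is the identity, at the
    parameter where both are the identity. *)
Lemma isder_inv (b : {poly k}) s F (V : 'I_n -> poly) : afam (line b) F ->
  b.[s] != 0 -> F s = 1%g ->
  (forall i, isder b s (fun t => tnth (F t).1 i) (V i)) ->
  forall i, isder b s (fun t => tnth (F t).2 i) (- V i).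
Proof.
move=> FX bs F1 FV i; have [P iP] := isder_ex k0 bs (proj2 (FX i)).
have := isder_comp bs iP FV; rewrite F1 /= !comp_mpoly_id tnth_mktuple.
under eq_bigr do rewrite comp_mpoly_id mderivXU.
rewrite (bigD1 i) //= eqxx mul1r big1 => [|j /negPf ji]; last first.
  by rewrite eq_sym ji mul0r.
rewrite addr0 => H.
have H0 : isder b s (fun t => tnth (F t).2 i \mPo (F t).1) 0.
  apply: (isder_eq bs (isder_cst bs 'X_i)) => t _.
  by rewrite -endo_compE autAl tnth_mktuple.
have /eqP := isder_unique k0 H H0.
by rewrite addr_eq0 => /eqP <-.
Qed.

(** A piece of [Aut] is induced in stages from affine spaces of coefficients. The derivation is
    pushed forward through these stages, and at each of them it is zero if it vanishes on what is
    pulled back from the next. *)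
Lemma pderiv_Aut0 d (S : set autA) x D :
  pderiv (ind_sub (Aut k n) S d) x D -> carrier (ind_sub (Aut k n) S d) x ->
  (forall i m, D (fun f : autA => (tnth f.1 i)@_m) = 0) ->
  (forall i m, D (fun f : autA => (tnth f.2 i)@_m) = 0) ->
  forall W h, kreg (ind_sub (Aut k n) S d) W h -> W x -> D h = 0.
Proof.
move=> xD Cx D1 D2.
have Ar := Aut_ringed d; have Er := EndA_ringed d; have E2r := EndA2_ringed d.
have As := ringed_space Ar; have Es := ringed_space Er; have E2s := ringed_space E2r.
have Sr : is_ringed (ind_sub (Aut k n) S d) by exact: kinduced_ringed.
have Ss := ringed_space Sr.
have D3 := pderiv_push Cx xD (ksub_incl S As).
have CA : carrier (Aut k n d) x by case: Cx.
have D4 := pderiv_push CA D3 (kinduced_emb setT (@autA_val k n) E2s).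
have C2 : carrier (ind_prod (EndA k n) (EndA k n) d) (autA_val x) by case: CA.
have D5 := pderiv_push C2 D4 (kmorphism_fst Er Er).
have D6 := pderiv_push C2 D4 (kmorphism_snd Er Er).
have [C5 C6] : carrier (EndA k n d) (autA_val x).1 /\ carrier (EndA k n d) (autA_val x).2.
  by case: C2.
have D7 := pderiv_push C5 D5 (kinduced_emb _ (@endo_coefs k n d) (affine_kspace k _)).
have D8 := pderiv_push C6 D6 (kinduced_emb _ (@endo_coefs k n d) (affine_kspace k _)).
apply: (pderiv_induced0 Ar xD) => W1 h1 h1W W1x.
apply: (pderiv_induced0 E2r D3) h1W W1x => W2 h2 h2W W2x.
apply: (pderiv_prod0 Er Er D4) h2W W2x => W3 h3 h3W W3x.
  apply: (pderiv_induced0 (affine_ringed k _) D5) h3W W3x => W4 h4 h4W W4x.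
  apply: (pderiv_affine0 D7) h4W W4x => -[i m] /=.
  rewrite -(D1 i m); congr D; apply: funext => f /=.
  by rewrite /comp /= ffunE.
apply: (pderiv_induced0 (affine_ringed k _) D6) h3W W3x => W4 h4 h4W W4x.
apply: (pderiv_affine0 D8) h4W W4x => -[i m] /=.
rewrite -(D2 i m); congr D; apply: funext => f /=.
by rewrite /comp /= ffunE.
Qed.

(** It suffices that [h] agrees along the curve with a regular [h']. This absorbs the passage to a
    larger piece made by [ind_extend]. *)
Lemma der_germ T (Y : kspace k T) b s c W h h' : kmorphism (line b) Y c ->
  b.[s] != 0 -> kreg Y W h' -> W (c s) ->
  (forall t, b.[t] != 0 -> W (c t) -> h (c t) = h' (c t)) ->
  hasder s (h \o c) (der s (h' \o c)).
Proof.
move=> [_ _ cr] bs hW Ws hh.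
have Ws' : (carrier (line b) `&` c @^-1` W) s by split => //; exact/line_carrier.
have [p [q [qs H]]] := line_regP (cr _ _ hW) Ws'.
apply: (hasder_local qs _ (line_hasder k0 (cr _ _ hW) Ws')) => t /H[[Ct Wt] _].
by apply: hh => //; exact/line_carrier.
Qed.

(* The differential of [phi] at the identity is a well-defined linear map. *)
Lemma velocity_relation T (G : indspace k T) (S : set autA) (phi : autA -> T)
    (J : finType) (a : J -> k) (b : J -> {poly k}) (s : J -> k)
    (c : J -> k -> autA) (V : J -> 'I_n -> poly) :
  is_indvariety G -> ind_morphism (ind_sub (Aut k n) S) G phi -> S 1%g ->
  (forall j, afam (line (b j)) (c j)) ->
  (forall j t, (b j).[t] != 0 -> S (c j t)) ->
  (forall j, (b j).[s j] != 0) -> (forall j, c j (s j) = 1%g) ->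
  (forall j i, isder (b j) (s j) (fun t => tnth (c j t).1 i) (V j i)) ->
  (forall i, \sum_j a j *: V j i = 0) ->
  forall m W h, (forall j, kmorphism (line (b j)) (G m) (phi \o c j)) ->
    kreg (G m) W h -> W (phi 1%g) ->
    \sum_j a j * der (s j) (h \o phi \o c j) = 0.
Proof.
move=> Gi phiM S1 cL cS bs cs cV V0 m W h cM hW Wx.
have /choice[d dP] j : exists d, forall e, (d <= e)%N ->
    kmorphism (line (b j)) (ind_sub (Aut k n) S e) (c j).
  by apply: afam_kmorphism => //; [exact: line_ringed|move=> t /line_carrier; exact: cS].
(* The successor puts the identity, whose components have [msize] 2, into the piece even if the
   maximum is 0. *)
set e := (\max_j d j).+1.
have cMe j : kmorphism (line (b j)) (ind_sub (Aut k n) S e) (c j).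
  by apply: dP; apply: leqW; exact: leq_bigmax.
have [m' pM] := phiM e; set M := maxn m m'.
have [W' [h' [hW' Wx' hh]]] := ind_extend Gi (leq_maxl m m' : (m <= M)%N) hW Wx.
have Ss : is_kspace (ind_sub (Aut k n) S e).
  exact/kinduced_kspace/ringed_space/Aut_ringed.
have pMM := kmorphism_le Gi Ss (leq_maxr m m' : (m' <= M)%N) pM.
have D := pderiv_curves k0 a cMe bs cs.
have Ce : carrier (ind_sub (Aut k n) S e) 1%g.
  by split => //; apply/Aut_carrier => i; rewrite /= tnth_mktuple msizeX mdeg1.
have CS : forall j i u, (V j i)@_u = der (s j) (fun t => (tnth (c j t).1 i)@_u).
  by move=> j i u; have [_ _ H] := cV j i; rewrite (derE k0 (H u)).
(* The coefficients of the inverses move with velocity [- V j], so they satisfy the same linear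
   relation. *)
have CS' : forall j i u, - (V j i)@_u = der (s j) (fun t => (tnth (c j t).2 i)@_u).
  move=> j i u; have [_ _ H] := isder_inv (cL j) (bs j) (cs j) (cV j) i.
  by rewrite (derE k0 (H u)) mcoeffN.
have D0 : forall W h, kreg (ind_sub (Aut k n) S e) W h -> W 1%g ->
    \sum_j a j * der (s j) (h \o c j) = 0.
  apply: (pderiv_Aut0 D Ce) => i u.
    under eq_bigr do rewrite -CS.
    have := congr1 (mcoeff u) (V0 i); rewrite mcoeff0 raddf_sum /= => V0u; rewrite -[RHS]V0u.
    by apply: eq_bigr => j _; rewrite mcoeffZ.
  under eq_bigr do rewrite -CS' mulrN.
  rewrite sumrN; apply/eqP; rewrite oppr_eq0; apply/eqP.
  have := congr1 (mcoeff u) (V0 i); rewrite mcoeff0 raddf_sum /= => V0u; rewrite -[RHS]V0u.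
  by apply: eq_bigr => j _; rewrite mcoeffZ.
have [_ _ pr] := pMM.
rewrite -[RHS](D0 _ _ (pr _ _ hW')) //.
apply: eq_bigr => j _; congr (_ * _); apply: (derE k0).
have cMM := kmorphism_comp (line_kspace (b j)) (cMe j) pMM.
apply: (der_germ cMM (bs j) hW'); first by rewrite /= cs.
move=> t bt Wt /=; have [|//] := hh (phi (c j t)) _ Wt.
by have [H _ _] := cM j; apply: H; exact/line_carrier.
Qed.

End Automorphisms.

(** * Curves with zero velocity *)

Section ConstantCurves.
Variable k : fieldType.
Hypothesis k0 : [pchar k] =i pred0.

(** In a chart the coordinates of the curve are rational functions with zero derivative, hence
    constant in characteristic zero. So the curve is locally constant, and two nonempty open subsets
    of the line meet. *)
Lemma const_curve T (X : kspace k T) (b : {poly k}) c : is_variety X ->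
  kmorphism (line b) X c ->
  (forall s W h, b.[s] != 0 -> kreg X W h -> W (c s) -> der s (h \o c) = 0) ->
  forall s t, b.[s] != 0 -> b.[t] != 0 -> c s = c t.
Proof.
move=> Xv cM c0; have [cC co cr] := cM.
have loc s : b.[s] != 0 -> exists2 q : {poly k}, q.[s] != 0 &
    forall t, q.[t] != 0 -> c t = c s.
  move=> bs; have Cs : carrier (line b) s by exact/line_carrier.
  have [I [U [x [[oU0 Us] xr xi _]]]] := variety_chart Xv (cC s Cs).
  have Us' : (carrier (line b) `&` c @^-1` U) s by [].
  have /choice[q qP] i : exists q : {poly k}, q.[s] != 0 /\
      forall t, q.[t] != 0 -> U (c t) /\ x (c t) i = x (c s) i.
    have [p [q [qs pq]]] := line_regP (cr _ _ (xr i)) Us'.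
    exists q; split => // t qt; have [[_ Ut] /= ->] := pq t qt.
    have [_ /= ->] := pq s qs; split => //.
    apply: (ratder_cst k0 qs _ qt) => u qu.
    have [[bu Uu] _] := pq u qu.
    rewrite -(c0 u _ _ (proj1 (line_carrier _ _) bu) (xr i) Uu).
    apply/esym/(derE k0); exists p, q; split => //; split => // v qv.
    by have [] := pq v qv.
  have oU := co _ oU0.
  have [q0 [q0s q0P]] := line_openP oU Us'.
  exists (q0 * \prod_i q i).
    rewrite hornerM mulf_neq0 // horner_prod; apply/prodf_neq0 => i _.
    by have [] := qP i.
  move=> t; rewrite hornerM mulf_eq0 negb_or horner_prod => /andP[/q0P[_ Ut]].
  move=> /prodf_neq0 qt; apply: xi => //; apply/ffunP => i.
  by have [_ /(_ t (qt i isT))[]] := qP i.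
move=> s t bs bt; have [q qs qP] := loc s bs; have [r rt rP] := loc t bt.
have [u] : exists u, (q * r).[u] != 0.
  by apply: (poly_neq0P k0); rewrite mulf_neq0 // ?(horner_neq0 qs) ?(horner_neq0 rt).
rewrite hornerM mulf_eq0 negb_or => /andP[qu ru].
by rewrite -(qP u qu) (rP u ru).
Qed.

End ConstantCurves.

Section Homomorphisms.
Variables (k : fieldType) (n : nat).
Hypothesis k0 : [pchar k] =i pred0.
Local Notation poly := {mpoly k[n]}.
Local Notation autA := (autA k n).
Variables (gT : groupType) (G : indspace k gT).
Hypothesis Gg : is_indgroup G.
Variable S : set autA.
Hypotheses (S1 : S 1%g) (SM : forall f g, S f -> S g -> S (f * g)%g)
  (SV : forall f, S f -> S f^-1%g).
Variable phi : autA -> gT.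
Hypothesis phiM : ind_morphism (ind_sub (Aut k n) S) G phi.
Hypothesis phiD : forall f g, S f -> S g -> phi (f * g)%g = (phi f * phi g)%g.

Let Gi := indgroup_ind Gg.

Lemma phi1 : phi 1%g = 1%g.
Proof. by apply: (mulgI (phi 1%g)); rewrite -phiD // !mulg1. Qed.

Lemma phiV f : S f -> phi f^-1%g = (phi f)^-1%g.
Proof.
move=> Sf; apply: (mulgI (phi f)); rewrite -phiD //; last exact: SV.
by rewrite !mulgV phi1.
Qed.

Lemma imorphism_phi T (X : kspace k T) F : is_ringed X -> afam X F ->
  (forall x, carrier X x -> S (F x)) -> imorphism G X (phi \o F).
Proof.
move=> Xr FX FS; have [d dP] := afam_kmorphism Xr FX FS.
have [m pM] := phiM d; exists m.
exact: (kmorphism_comp (ringed_space Xr) (dP d (leqnn d)) pM).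
Qed.

Lemma phi_carrier f : S f -> ind_carrier G (phi f).
Proof.
move=> Sf; have [d _ Cf] := Aut_ind_carrier f; have [m [pC _ _]] := phiM d.
by exists m => //; apply: pC.
Qed.

(* By homogeneity, derivatives along the curve need only be tested at the
   identity of [G]. *)
Lemma const_phi (b : {poly k}) (c : k -> autA) : afam (line b) c ->
  (forall t, b.[t] != 0 -> S (c t)) ->
  (forall s m W h, b.[s] != 0 ->
     kmorphism (line b) (G m) (fun t => phi ((c s)^-1 * c t)%g) ->
     kreg (G m) W h -> W 1%g -> der s (fun t => h (phi ((c s)^-1 * c t)%g)) = 0) ->
  forall s t, b.[s] != 0 -> b.[t] != 0 -> phi (c s) = phi (c t).
Proof.
move=> cL cS c0; have Lr := line_ringed b; have Ls := ringed_space Lr.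
have cS' t : carrier (line b) t -> S (c t) by move/line_carrier/cS.
have [m0 cM] := imorphism_phi Lr cL cS'.
apply: (const_curve k0 (ind_variety Gi m0) cM) => s W h bs hW Ws.
pose x t := phi ((c s)^-1 * c t)%g.
have [m1 xM] : imorphism G (line b) x.
  apply: (imorphism_phi Lr (F := fun t => ((c s)^-1 * c t)%g)).
    by apply: (afam_mul Lr) => //; exact: afam_cst.
  by move=> t Ct; apply: SM; [apply: SV; exact: cS|exact: cS'].
have Gr := ind_ringed Gi m1.
have [m2 lM] : imorphism G (G m1) (fun y => phi (c s) * y)%g.
  apply: (imorphism_mul Gg Gr).
    by apply: (imorphism_cst Gr); apply: phi_carrier; exact: cS.
  by exists m1; exact/kmorphism_id/ind_kspace.
have xE t : b.[t] != 0 -> (phi (c s) * x t)%g = phi (c t).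
  move=> bt; rewrite /x phiD ?phiV ?mulgA ?mulgV ?mul1g //; try exact: cS.
  by apply: SV; exact: cS.
have x1 : x s = 1%g by rewrite /x mulVg phi1.
have [W' [h' [hW' Ws' hh]]] := ind_extend Gi (leq_maxl m0 m2) hW Ws.
have lMM := kmorphism_le Gi (ind_kspace Gi m1) (leq_maxr m0 m2) lM.
have [_ _ lr] := lMM.
have W1 : (carrier (G m1) `&` (fun y => phi (c s) * y)%g @^-1` W') 1%g.
  split; last by rewrite /preimage /= mulg1.
  by have [xC _ _] := xM; rewrite -x1; apply: xC; exact/line_carrier.
have D0 := c0 s m1 _ _ bs xM (lr _ _ hW') W1.
rewrite -D0; apply: (derE k0).
have xMM := kmorphism_comp Ls xM lMM.
apply: (hasder_local (c := b) bs (r' := h \o (fun t => (phi (c s) * x t)%g))).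
  by move=> t bt /=; rewrite xE.
apply: (der_germ k0 xMM bs hW'); first by rewrite /= xE.
move=> t bt Wt; rewrite /= in Wt *.
have [|//] := hh (phi (c s) * x t)%g _ Wt; rewrite xE //.
by have [cC _ _] := cM; apply: cC; exact/line_carrier.
Qed.

End Homomorphisms.

(** * Translations, elementary and linear automorphisms *)

Section ExplicitAutomorphisms.
Variables (k : fieldType) (n : nat).
Local Notation poly := {mpoly k[n]}.
Local Notation autA := (autA k n).
Local Notation endo := (endo k n).

Lemma autA_mul_fst (f g : autA) : (f * g)%g.1 = endo_comp f.1 g.1.
Proof. by []. Qed.

Lemma autA_mul1E (f g : autA) i : tnth (f * g)%g.1 i = tnth f.1 i \mPo g.1.
Proof. exact: endo_compE. Qed.

Lemma autA_one1E i : tnth (1%g : autA).1 i = 'X_i.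
Proof. exact: tnth_mktuple. Qed.

Lemma jacM (f g : autA) : jac (f * g)%g = (jac f * jac g)%g.
Proof.
have E : (jac (f * g)%g : k)%:MP_[n] = ((jac f : k) * (jac g : k))%:MP_[n].
  rewrite -jacE [LHS]jacobian_comp (jacE f) (jacE g) comp_mpolyC.
  by rewrite [RHS]mpolyCM.
exact/val_inj/(can_inj (@mpolyCK n k) E).
Qed.

Lemma jac1 : jac (1%g : autA) = 1%g.
Proof.
by apply: val_inj; rewrite /= jacobian_id mcoeff1 eqxx.
Qed.

Lemma jacV (f : autA) : jac f^-1%g = (jac f)^-1%g.
Proof. by apply: (mulgI (jac f)); rewrite -jacM !mulgV jac1. Qed.

Lemma jac_eq1 (f : autA) : jacobian f.1 = 1 -> jac f = 1%g.
Proof. by move=> e; apply: val_inj; rewrite /= e mcoeff1 eqxx. Qed.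

Lemma translation_subproof (v : 'I_n -> k) :
  let p : endo * endo := ([tuple 'X_i + (v i)%:MP | i < n], [tuple 'X_i - (v i)%:MP | i < n]) in
  (endo_comp p.1 p.2 == endo_id k n) && (endo_comp p.2 p.1 == endo_id k n).
Proof.
apply/andP; split; apply/eqP/eq_from_tnth => i; rewrite endo_compE /= !tnth_mktuple.
  by rewrite comp_mpolyD comp_mpolyXU comp_mpolyC -tnth_nth tnth_mktuple subrK.
by rewrite comp_mpolyB comp_mpolyXU comp_mpolyC -tnth_nth tnth_mktuple addrK.
Qed.

Definition translation v : autA := AutA (translation_subproof v).

Lemma translationE v i : tnth (translation v).1 i = 'X_i + (v i)%:MP.
Proof. exact: tnth_mktuple. Qed.

Lemma translation_eq u v : u =1 v -> translation u = translation v.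
Proof. by move=> uv; apply: autA_inj1; apply/eq_from_tnth => i; rewrite !translationE uv. Qed.

Lemma translationD u v :
  translation (fun i => u i + v i) = (translation u * translation v)%g.
Proof.
apply: autA_inj1; apply/eq_from_tnth => i; rewrite autA_mul1E !translationE.
rewrite comp_mpolyD comp_mpolyXU comp_mpolyC -tnth_nth translationE.
by rewrite mpolyCD addrAC addrA.
Qed.

Lemma translation0 : translation (fun=> 0) = 1%g.
Proof.
by apply: autA_inj1; apply/eq_from_tnth => i; rewrite translationE autA_one1E mpolyC0 addr0.
Qed.

Lemma jac_translation v : jac (translation v) = 1%g.
Proof.
apply: jac_eq1; rewrite -(jacobian_id k n) /jacobian; congr (\det _).
apply/matrixP => i j; rewrite !mxE translationE tnth_mktuple.
by rewrite mderivD mderivC addr0.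
Qed.

Lemma afam_translation T (X : kspace k T) (v : T -> 'I_n -> k) : is_ringed X ->
  (forall i, kreg X (carrier X) (fun x => v x i)) -> afam X (fun x => translation (v x)).
Proof.
move=> Xr vr i.
have vX : rfam X (fun x => (v x i)%:MP_[n]).
  have := rfam_coef Xr (1 : poly) (vr i); congr rfam; apply: funext => x.
  by rewrite -mul_mpolyC mulr1.
have xX := rfam_cst Xr ('X_i : poly).
split; under eq_fun do rewrite /= tnth_mktuple; first exact: (rfam_add Xr).
apply: (rfam_add Xr) => //.
have := rfam_mul Xr (rfam_cst Xr (-1)) vX; congr rfam.
by apply: funext => x; rewrite mulN1r.
Qed.

(** ** Elementary automorphisms *)

(* [q] does not involve the variable ['X_i]. *)
Definition free_of (i : 'I_n) (q : poly) : Prop :=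
  forall g : endo, (forall j, j != i -> tnth g j = 'X_j) -> q \mPo g = q.

Lemma free_ofX i (m : 'X_{1..n}) : m i = 0%N -> free_of i 'X_[m].
Proof.
move=> mi g gX; rewrite comp_mpolyX [RHS]mpolyXE_id; apply: eq_bigr => j _.
by have [->|/gX ->//] := eqVneq j i; rewrite mi !expr0.
Qed.

Lemma free_ofZ i c q : free_of i q -> free_of i (c *: q).
Proof. by move=> fq g gX; rewrite comp_mpolyZ fq. Qed.

Lemma free_of_deriv i q : free_of i q -> q^`M(i) = 0.
Proof.
move=> fq; pose g : endo := [tuple if j == i then 0 else 'X_j | j < n].
rewrite -(fq g) => [|j /negPf ji]; last by rewrite tnth_mktuple ji.
rewrite mderiv_comp big1 // => j _; rewrite tnth_mktuple.
have [_|/negPf ji] := eqVneq j i; first by rewrite mderiv0 mulr0.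
by rewrite mderivXU ji mulr0.
Qed.

Definition elem_endo (i : 'I_n) (q : poly) : endo :=
  [tuple 'X_j + (j == i)%:R *: q | j < n].

Lemma elem_endoD i q r : free_of i q ->
  endo_comp (elem_endo i q) (elem_endo i r) = elem_endo i (q + r).
Proof.
move=> fq; apply/eq_from_tnth => j; rewrite endo_compE !tnth_mktuple.
rewrite comp_mpolyD comp_mpolyXU -tnth_nth tnth_mktuple comp_mpolyZ fq.
  by rewrite scalerDr addrAC addrA.
by move=> l /negPf li; rewrite tnth_mktuple li scale0r addr0.
Qed.

Lemma elem_endo0 i : elem_endo i 0 = endo_id k n.
Proof. by apply/eq_from_tnth => j; rewrite !tnth_mktuple scaler0 addr0. Qed.

(** [insubd] falls back on the identity if the two maps are not inverse to each other, so the term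
    carries no proof about [q] and can depend on a parameter freely. *)
Definition elem_aut (i : 'I_n) (q : poly) : autA :=
  insubd (1%g : autA) (elem_endo i q, elem_endo i (- q)).

Lemma elem_autE i q : free_of i q ->
  val (elem_aut i q) = (elem_endo i q, elem_endo i (- q)).
Proof.
move=> fq; apply: insubdK; rewrite -topredE /= !elem_endoD ?subrr ?addNr //.
  by rewrite elem_endo0 eqxx.
by rewrite -scaleN1r; exact: free_ofZ.
Qed.

Opaque elem_aut.

Lemma elem_aut1E i q j : free_of i q ->
  tnth (elem_aut i q).1 j = 'X_j + (j == i)%:R *: q.
Proof.
by move=> fq; rewrite -[(elem_aut i q).1]/((val (elem_aut i q)).1) elem_autE // tnth_mktuple.
Qed.

Lemma elem_aut2E i q j : free_of i q ->
  tnth (elem_aut i q).2 j = 'X_j - (j == i)%:R *: q.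
Proof.
move=> fq; rewrite -[(elem_aut i q).2]/((val (elem_aut i q)).2) elem_autE // tnth_mktuple.
by rewrite scalerN.
Qed.

(** Since [q] is free of ['X_i], column [i] of the Jacobian matrix is a unit vector, and the
    complementary minor is that of the identity. *)
Lemma jac_elem i q : free_of i q -> jac (elem_aut i q) = 1%g.
Proof.
move=> fq; apply: jac_eq1; rewrite /jacobian.
set A := \matrix_(_, _) _.
have AE j l : A j l = (j == l)%:R + (j == i)%:R *: q^`M(l).
  by rewrite mxE elem_aut1E // mderivD mderivXU mderivZ.
rewrite (expand_det_col _ i) (bigD1 i) //= big1 ?addr0 => [|j /negPf ji]; last first.
  by rewrite AE ji scale0r addr0 mul0r.
rewrite AE eqxx free_of_deriv // scaler0 addr0 mul1r /cofactor -signr_odd oddD addbb mul1r.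
rewrite -[RHS](@det1 _ n.-1); congr (\det _); apply/matrixP => j l; rewrite !mxE.
rewrite elem_aut1E // mderivD mderivXU mderivZ [lift i j == i]eq_sym.
by rewrite (negPf (neq_lift i j)) scale0r addr0 (inj_eq (@lift_inj _ i)).
Qed.

Lemma afam_elem T (X : kspace k T) i q f : is_ringed X -> free_of i q ->
  kreg X (carrier X) f -> afam X (fun x => elem_aut i (f x *: q)).
Proof.
move=> Xr fq fr j.
have xX := rfam_cst Xr ('X_j : poly).
have qX c : rfam X (fun x => (f x) *: (c *: q)) by apply: rfam_coef.
split.
  have := rfam_add Xr xX (qX (j == i)%:R); congr rfam; apply: funext => x.
  by rewrite elem_aut1E; [rewrite !scalerA mulrC|exact: free_ofZ].
have := rfam_add Xr xX (qX (- (j == i)%:R)); congr rfam; apply: funext => x.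
by rewrite elem_aut2E; [rewrite !scalerA mulrN scaleNr mulrC|exact: free_ofZ].
Qed.

(** ** Linear automorphisms *)

Definition lin_endo (A : 'M[k]_n) : endo := [tuple \sum_j A i j *: 'X_j | i < n].

Lemma lin_endoM A B : endo_comp (lin_endo A) (lin_endo B) = lin_endo (A *m B).
Proof.
apply/eq_from_tnth => i; rewrite endo_compE !tnth_mktuple raddf_sum /=.
under eq_bigr do rewrite comp_mpolyZ comp_mpolyXU -tnth_nth tnth_mktuple scaler_sumr.
rewrite exchange_big /=; apply: eq_bigr => j _; rewrite mxE scaler_suml.
by apply: eq_bigr => l _; rewrite scalerA.
Qed.

Lemma lin_endo1 : lin_endo 1%:M = endo_id k n.
Proof.
apply/eq_from_tnth => i; rewrite !tnth_mktuple (bigD1 i) //= mxE eqxx scale1r.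
by rewrite big1 ?addr0 // => j /negPf ji; rewrite mxE eq_sym ji scale0r.
Qed.

Definition lin_aut (A : 'M[k]_n) : autA :=
  insubd (1%g : autA) (lin_endo A, lin_endo (invmx A)).

Lemma lin_autE A : A \in unitmx -> val (lin_aut A) = (lin_endo A, lin_endo (invmx A)).
Proof.
move=> uA; apply: insubdK; rewrite -topredE /= !lin_endoM mulmxV // mulVmx //.
by rewrite lin_endo1 eqxx.
Qed.

Opaque lin_aut.

Lemma lin_aut1E A : A \in unitmx -> (lin_aut A).1 = lin_endo A.
Proof. by move=> uA; have := lin_autE uA; case: (lin_aut A) => p pP /= ->. Qed.

Lemma lin_aut2E A : A \in unitmx -> (lin_aut A).2 = lin_endo (invmx A).
Proof. by move=> uA; have := lin_autE uA; case: (lin_aut A) => p pP /= ->. Qed.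

Lemma lin_autM A B : A \in unitmx -> B \in unitmx ->
  lin_aut (A *m B) = (lin_aut A * lin_aut B)%g.
Proof.
move=> uA uB; apply: autA_inj1.
have uAB : A *m B \in unitmx by rewrite unitmx_mul uA.
rewrite [RHS]autA_mul_fst; apply: (etrans (lin_aut1E uAB)).
exact: (etrans (esym (lin_endoM A B)) (esym (congr2 (@endo_comp k n) (lin_aut1E uA) (lin_aut1E uB)))).
Qed.

Lemma lin_aut1 : lin_aut 1%:M = 1%g.
Proof. by apply: autA_inj1; rewrite lin_aut1E ?unitmx1 // lin_endo1. Qed.

Lemma jacobian_lin A : jacobian (lin_endo A) = (\det A)%:MP.
Proof.
rewrite /jacobian -(det_map_mx (@mpolyC n k)); congr (\det _).
apply/matrixP => i j; rewrite !mxE tnth_mktuple raddf_sum /=.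
rewrite (bigD1 j) //= mderivZ mderivXU eqxx big1 ?addr0 => [|l /negPf lj].
  by rewrite -mul_mpolyC mulr1.
by rewrite mderivZ mderivXU lj scaler0.
Qed.

Lemma jac_lin A : A \in unitmx -> (jac (lin_aut A) : k) = \det A.
Proof. by move=> uA; rewrite /= lin_aut1E // jacobian_lin mcoeffC eqxx mulr1. Qed.

Lemma afam_lin T (X : kspace k T) (A : T -> 'M[k]_n) : is_ringed X ->
  (forall x, carrier X x -> A x \in unitmx) ->
  (forall i j, kreg X (carrier X) (fun x => A x i j)) ->
  afam X (fun x => lin_aut (A x)).
Proof.
move=> Xr uA Ar i; have Xs := ringed_space Xr; have oX := kopenT Xs.
have P (B : T -> 'M[k]_n) : (forall i j, kreg X (carrier X) (fun x => B x i j)) ->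
    rfam X (fun x => tnth (lin_endo (B x)) i).
  move=> Br; under eq_fun do rewrite tnth_mktuple.
  by apply: (rfam_sum Xr) => j; exact: rfam_coef.
have Vr i' j : kreg X (carrier X) (fun x => (invmx (A x)) i' j).
  have := ringed_div Xr (ringed_adj Xr i' j oX Ar) (ringed_det Xr oX Ar).
  rewrite (_ : [set x | _] = carrier X) => [H|].
    by apply: (kreg_eq Xs H) => x Cx; rewrite /invmx (uA x Cx) [RHS]mxE mulrC.
  apply/seteqP; split=> x; first by case.
  by move=> Cx; split => //; have := uA x Cx; rewrite unitmxE unitfE.
split; first by apply: (rfam_eq Xr (P _ Ar)) => x /uA ?; rewrite lin_aut1E.
by apply: (rfam_eq Xr (P _ Vr)) => x /uA ?; rewrite lin_aut2E.
Qed.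

End ExplicitAutomorphisms.

(** * A criterion for closed immersions *)

Section ClosedImmersion.
Variables (k : fieldType) (n : nat).
Local Notation poly := {mpoly k[n]}.
Local Notation autA := (autA k n).
Local Notation endo := (endo k n).

(* Both groups at once: [Aut] for [e = false] and [SAut] for [e = true]. *)
Definition jac1_if (e : bool) : set autA := [set f | e -> jac f = 1%g].

Lemma jac1_if1 e : jac1_if e 1%g. Proof. by move=> _; exact: jac1. Qed.

Lemma jac1_ifM e f g : jac1_if e f -> jac1_if e g -> jac1_if e (f * g)%g.
Proof. by move=> Sf Sg ee; rewrite jacM Sf // Sg // mulg1. Qed.

Lemma jac1_ifV e f : jac1_if e f -> jac1_if e f^-1%g.
Proof. by move=> Sf ee; rewrite jacV Sf // invg1. Qed.

Lemma jac1_ifP e f : jac1_if e f <-> (e -> jacobian f.1 = 1).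
Proof.
split=> [Sf ee|Sf ee]; last exact/jac_eq1/Sf.
by rewrite jacE Sf // mpolyC1.
Qed.

Lemma ind_carrier_sub (S : set autA) f : ind_carrier (ind_sub (Aut k n) S) f <-> S f.
Proof.
split=> [[d _ []]//|Sf]; have [d _ Cf] := Aut_ind_carrier f.
by exists d.
Qed.

Variable e : bool.
Local Notation S := (jac1_if e).
Variables (gT : groupType) (G : indspace k gT).
Hypothesis Gg : is_indgroup G.
Variable phi : autA -> gT.
Hypothesis phiM : ind_morphism (ind_sub (Aut k n) S) G phi.
Hypothesis phiD : forall f g, S f -> S g -> phi (f * g)%g = (phi f * phi g)%g.
Let Gi := indgroup_ind Gg.
Let S1 := @jac1_if1 e.
Let SM := @jac1_ifM e.
Let SV := @jac1_ifV e.

Hypothesis bounded : forall d, exists D, forall f, S f -> carrier (G d) (phi f) ->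
  carrier (Aut k n D) f.

(** A regular local left inverse of [phi]. Off the image [F1 y] and [F2 y] need not be inverse to
    each other, so they are kept as endomorphisms. *)
Definition reconstructs d (U : set gT) (F1 F2 : gT -> endo) : Prop :=
  [/\ kopen (G d) U,
      forall i, rfam (ksub (G d) U) (fun y => tnth (F1 y) i),
      forall i, rfam (ksub (G d) U) (fun y => tnth (F2 y) i)
    & forall f, S f -> U (phi f) -> F1 (phi f) = f.1 /\ F2 (phi f) = f.2].

Hypothesis reconstruct1 : forall m, carrier (G m) 1%g ->
  exists U F1 F2, reconstructs m U F1 F2 /\ U 1%g.

Let phi_1 := phi1 S1 phiD.
Let phi_V := phiV S1 SV phiD.

(** [f^-1 * g] and the identity have the same image 1 and are therefore reconstructed as the same
    automorphism. *)
Lemma phi_inj f g : S f -> S g -> phi f = phi g -> f = g.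
Proof.
move=> Sf Sg fg; have [_ [m _ C1] _ _] := Gg.
have [U [F1 [F2 [[_ _ _ UF] U1]]]] := reconstruct1 C1.
have E : phi (f^-1 * g)%g = 1%g by rewrite phiD ?phi_V ?fg ?mulVg //; exact: SV.
have [e1 _] := UF _ S1 (eq_ind_r U U1 phi_1).
have [] := UF (f^-1 * g)%g (SM (SV Sf) Sg) (eq_ind_r U U1 E).
rewrite E -phi_1 e1 => e2 _; have /autA_inj1 fg1 := esym e2.
by apply: (mulgI f^-1%g); rewrite mulVg fg1.
Qed.

(** For [y] in the closure of the image, some [phi f0] is so close to [y] that [(phi f0)^-1 * y]
    lies in the neighbourhood of 1 where a reconstruction is given; this one is then translated by
    [f0]. Closedness of the image requires points of the closure, not only of the image. *)
Lemma reconstruct d y : carrier (G d) y ->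
  (forall V, kopen (G d) V -> V y -> exists2 f, S f & V (phi f)) ->
  exists U F1 F2, reconstructs d U F1 F2 /\ U y.
Proof.
move=> Cy yS; have Gr := ind_ringed Gi d; have Gs := ringed_space Gr.
have Pr := kprod_ringed Gr Gr.
have [m qM] : imorphism G (kprod (G d) (G d)) (fun p => (p.1^-1 * p.2)%g).
  apply: (imorphism_mul Gg Pr).
    by apply: (imorphism_inv Gg Pr); exists d; exact: kmorphism_fst.
  by exists d; exact: kmorphism_snd.
have lM z : carrier (G d) z -> kmorphism (G d) (G m) (fun y => z^-1 * y)%g.
  move=> Cz; apply: (kmorphism_comp Gs _ qM (f := fun y => (z, y))).
  by apply: (kmorphism_pair Gr); [exact: kmorphism_cst|exact: kmorphism_id].
have rM : kmorphism (G d) (G m) (fun z => z^-1 * y)%g.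
  apply: (kmorphism_comp Gs _ qM (f := fun z => (z, y))).
  by apply: (kmorphism_pair Gr); [exact: kmorphism_id|exact: kmorphism_cst].
have C1 : carrier (G m) 1%g.
  by have [rC _ _] := rM; rewrite -(mulVg y); exact: rC.
have [U [F1 [F2 [[oU F1r F2r UF] U1]]]] := reconstruct1 C1.
have [_ ro _] := rM.
have [f0 Sf0 [Cf0 Uf0]] := yS _ (ro _ oU) (conj Cy (eq_ind_r U U1 (mulVg y))).
have f0M := lM _ Cf0; have [_ lo _] := f0M.
set U' := carrier (G d) `&` (fun y => (phi f0)^-1 * y)%g @^-1` U.
have oU' : kopen (G d) U' by exact: lo.
have Us := kinduced_kspace U' id Gs; have Ur := kinduced_ringed U' id Gr.
have uM : kmorphism (ksub (G d) U') (ksub (G m) U) (fun y => (phi f0)^-1 * y)%g.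
  apply: kmorphism_sub => //; first exact: (ind_kspace Gi).
    by move=> x [[]].
  exact: (kmorphism_comp Us (ksub_incl U' Gs) f0M).
exists U', (fun y => endo_comp f0.1 (F1 ((phi f0)^-1 * y)%g)),
  (fun y => endo_comp (F2 ((phi f0)^-1 * y)%g) f0.2); split; last by split.
split => //.
- move=> i; under eq_fun do rewrite endo_compE; apply: (rfam_comp Ur).
    exact: (rfam_cst Ur).
  by move=> j; exact: (rfam_pull Us uM (F1r j)).
- move=> i; under eq_fun do rewrite endo_compE; apply: (rfam_comp Ur).
    exact: (rfam_pull Us uM (F2r i)).
  by move=> j; exact: (rfam_cst Ur).
- move=> f Sf [Cf Uf].
  have E : ((phi f0)^-1 * phi f)%g = phi (f0^-1 * f)%g.
    by rewrite phiD ?phi_V //; exact: SV.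
  have [e1 e2] := UF (f0^-1 * f)%g (SM (SV Sf0) Sf) (eq_ind _ U Uf _ E).
  rewrite E e1 e2; split => /=.
    by rewrite endo_compA autAr endo_comp_idl.
  by rewrite -endo_compA autAr endo_comp_idr.
Qed.

Let Im := phi @` ind_carrier (ind_sub (Aut k n) S).

Lemma ImP y : Im y <-> exists2 f, S f & phi f = y.
Proof.
by split=> -[f Sf fy]; exists f => //; apply/ind_carrier_sub.
Qed.

(** At a point [y] of the closure, [F1 y] and [F2 y] still satisfy the closed conditions that hold
    on the image: they are inverse to each other and, for [SAut], of Jacobian 1. So they define an
    automorphism [Psi y]. The morphisms [phi \o Psi] and the identity agree on the image near [y],
    hence at [y] by separatedness. *)
Lemma image_closed d : kclosed (G d) (Im `&` carrier (G d)).
Proof.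
have Gr := ind_ringed Gi d; have Gs := ringed_space Gr.
apply/(kclosedP Gs); split=> [y []//|y Cy yIm]; apply: contrapT => noV; apply: yIm.
have yS V : kopen (G d) V -> V y -> exists2 f, S f & V (phi f).
  move=> oV Vy; apply: contrapT => H; apply: noV; exists V; split => // z Vz [/ImP[f Sf fz] _].
  by apply: H; exists f; rewrite ?fz.
have [U [F1 [F2 [[oU F1r F2r UF] Uy]]]] := reconstruct Cy yS.
have Ur := kinduced_ringed U id Gr; have Us := ringed_space Ur.
have eqy (p q : gT -> poly) : rfam (ksub (G d) U) p -> rfam (ksub (G d) U) q ->
    (forall f, S f -> U (phi f) -> p (phi f) = q (phi f)) -> p y = q y.
  move=> pr qr pq; apply: contrapT => pqy.
  have /(kopen_sub_ksub _ Gs oU)[oV _] := rfam_neq_open Ur pr qr.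
  have [|f Sf [[Uf _]]] := yS _ oV; last by apply; exact: pq.
  by split => //; split.
have Xr (p : poly) := rfam_cst Ur p.
pose Z : set gT := [set z | [/\ U z, endo_comp (F1 z) (F2 z) = endo_id k n,
  endo_comp (F2 z) (F1 z) = endo_id k n & e -> jacobian (F1 z) = 1]].
have ZF f : S f -> U (phi f) -> Z (phi f).
  move=> Sf Uf; have [e1 e2] := UF f Sf Uf; rewrite /Z /= e1 e2 autAr autAl.
  by split => //; apply/jac1_ifP.
have Zy : Z y.
  split => //.
  - apply/eq_from_tnth => i; rewrite endo_compE.
    apply: (eqy (fun z => tnth (F1 z) i \mPo F2 z) (fun=> tnth (endo_id k n) i)) => //.
      exact: (rfam_comp Ur).
    by move=> f Sf Uf; have [e1 e2] := UF f Sf Uf; rewrite e1 e2 -endo_compE autAr.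
  - apply/eq_from_tnth => i; rewrite endo_compE.
    apply: (eqy (fun z => tnth (F2 z) i \mPo F1 z) (fun=> tnth (endo_id k n) i)) => //.
      exact: (rfam_comp Ur).
    by move=> f Sf Uf; have [e1 e2] := UF f Sf Uf; rewrite e1 e2 -endo_compE autAl.
  - move=> ee; apply: (eqy (fun z => jacobian (F1 z)) (fun=> 1)) => //.
      apply: (rfam_det Ur (A := fun z => \matrix_(i < n, j < n) (tnth (F1 z) i)^`M(j))) => i j.
      by apply: (rfam_eq Ur (rfam_deriv Ur j (F1r i))) => z _; rewrite mxE.
    move=> f Sf Uf; have [-> _] := UF f Sf Uf.
    by have /jac1_ifP := Sf; apply.
pose Psi z : autA := insubd (1%g : autA) (F1 z, F2 z).
have PsiE z : Z z -> (Psi z).1 = F1 z /\ (Psi z).2 = F2 z.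
  move=> [_ e1 e2 _]; have : val (Psi z) = (F1 z, F2 z).
    by apply: insubdK; rewrite -topredE /= e1 e2 !eqxx.
  by case: (Psi z) => p pP /= ->.
have PsiS z : Z z -> S (Psi z).
  by move=> Zz; apply/jac1_ifP; have [-> _] := PsiE z Zz; case: Zz.
have Zr := kinduced_ringed Z id Gr; have Zs := ringed_space Zr.
have ZU : kmorphism (ksub (G d) Z) (ksub (G d) U) id.
  by apply: kmorphism_sub => //; [move=> z [[]]|exact: ksub_incl].
have PsiA : afam (ksub (G d) Z) Psi.
  move=> i; split.
    by apply: (rfam_eq Zr (rfam_pull Zs ZU (F1r i))) => z [Zz _] /=; have [->] := PsiE z Zz.
  by apply: (rfam_eq Zr (rfam_pull Zs ZU (F2r i))) => z [Zz _] /=; have [_ ->] := PsiE z Zz.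
have [m pM] : imorphism G (ksub (G d) Z) (phi \o Psi).
  by apply: (imorphism_phi phiM Zr PsiA) => z [Zz _]; exact: PsiS.
have pM' := kmorphism_le Gi Zs (leq_maxl m d) pM.
have iM' := kmorphism_le Gi Zs (leq_maxr m d) (ksub_incl Z Gs).
have [V oV EV] := kmorphism_eq_closed Zr (ind_variety Gi _) pM' iM'.
split => //; apply/ImP; exists (Psi y); first exact: PsiS.
apply: contrapT => neq.
have : [set x | carrier (ksub (G d) Z) x /\ (phi \o Psi) x <> x] y by [].
rewrite EV => -[_ Vy].
have [f Sf [Vf Uf]] := yS _ (kopenI Gs oV oU) (conj Vy Uy).
have Zf := ZF f Sf Uf.
have : (carrier (ksub (G d) Z) `&` id @^-1` V) (phi f).
  by split => //; split => //; exact: (kopen_sub Gs oU).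
rewrite -EV => -[_]; apply => /=; congr phi; apply: autA_inj1.
by have [-> _] := PsiE _ Zf; have [-> _] := UF f Sf Uf.
Qed.

Lemma closed_immersion_reconstruct : closed_immersion (ind_sub (Aut k n) S) G phi.
Proof.
have Sc f : ind_carrier (ind_sub (Aut k n) S) f <-> S f := ind_carrier_sub S f.
have Hs d : is_kspace (ind_sub (Aut k n) S d).
  exact/kinduced_kspace/ringed_space/Aut_ringed.
have SIm f : S f -> Im (phi f) by move=> Sf; apply/ImP; exists f.
have homM : ind_morphism (ind_sub (Aut k n) S) (ind_sub G Im) phi.
  move=> d; have [m pM] := phiM d; exists m; apply: kmorphism_sub => //.
    exact: (ind_kspace Gi).
  by move=> f [Sf _]; exact: SIm.
split; [split|split; split => //].
- split; last exact: image_closed.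
  by move=> y /ImP[f Sf <-]; exact: (phi_carrier phiM).
- by rewrite -phi_1; exact: SIm.
- by move=> x y /ImP[f Sf <-] /ImP[g Sg <-]; rewrite -phiD //; apply: SIm; exact: SM.
- by move=> x /ImP[f Sf <-]; rewrite -phi_V //; apply: SIm; exact: SV.
- by move=> x y /Sc Sx /Sc Sy; exact: phiD.
(* The set-theoretic inverse, with value 1 off the image. It is a morphism because [bounded] keeps
   its values on each piece of the image in one piece of the source, and because it agrees locally
   with the reconstructions. *)
- pose psi y := xget (1%g : autA) [set f | S f /\ phi f = y].
  have psiK f : S f -> psi (phi f) = f.
    move=> Sf; have : [set g | S g /\ phi g = phi f] (psi (phi f)).
      by apply: xgetPex; exists f.
    by move=> [Sg gf]; exact: phi_inj.
  exists psi; split; last first.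
  + by move=> y [d _ [/ImP[f Sf <-] _]]; rewrite psiK.
  + by move=> f /Sc Sf; exact: psiK.
  + move=> d; have [D DP] := bounded d; exists D.
    have Gr := ind_ringed Gi d; have Gs := ringed_space Gr.
    have Ir := kinduced_ringed Im id Gr; have Is := ringed_space Ir.
    have psiS y : Im y -> S (psi y) by move=> /ImP[f Sf <-]; rewrite psiK.
    have loc y : carrier (ind_sub G Im d) y -> exists U F1 F2, [/\ U y,
       forall i m, kreg (ksub (G d) Im) (carrier (ksub (G d) Im) `&` id @^-1` U) (fun y => (tnth (F1 y) i)@_m),
       forall i m, kreg (ksub (G d) Im) (carrier (ksub (G d) Im) `&` id @^-1` U) (fun y => (tnth (F2 y) i)@_m)
      & forall z, carrier (ksub (G d) Im) z -> U z -> (psi z).1 = F1 z /\ (psi z).2 = F2 z].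
      move=> [Iy Cy].
      have [|U [F1 [F2 [[oU F1r F2r UF] Uy]]]] := @reconstruct d y Cy.
        move=> V oV Vy; have /ImP[f Sf fy] := Iy; exists f; rewrite ?fy //.
      have [_ _ ir] := ksub_incl Im Gs.
      have CU : carrier (ksub (G d) U) = U.
        apply/seteqP; split=> z; first by case.
        by move=> Uz; split => //; exact: (kopen_sub Gs oU).
      exists U, F1, F2; split => //.
      - by move=> i m; have [_ /(_ m)] := F1r i; rewrite CU => /(kreg_sub_ksub _ _ Gs oU)[/ir].
      - by move=> i m; have [_ /(_ m)] := F2r i; rewrite CU => /(kreg_sub_ksub _ _ Gs oU)[/ir].
      - move=> z [/ImP[f Sf <-] _] Uf; rewrite psiK //.
        by have [-> ->] := UF f Sf Uf.
    apply: kmorphism_sub => //; first exact/ringed_space/Aut_ringed.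
      by move=> y [Iy _]; exact: psiS.
    apply: kmorphism_Aut => //.
    * move=> y [/ImP[f Sf fy] Cy]; rewrite -fy psiK //; apply: DP => //.
      by rewrite fy.
    * move=> i m; apply: (kreg_local Is) => y Cy.
      have [U [F1 [F2 [Uy F1r F2r UF]]]] := loc y Cy.
      exists (carrier (ksub (G d) Im) `&` id @^-1` U), (fun y => (tnth (F1 y) i)@_m).
      split; [exact: F1r|by split|by move=> z []|].
      by move=> z [Cz Uz]; have [-> _] := UF z Cz Uz.
    * move=> i m; apply: (kreg_local Is) => y Cy.
      have [U [F1 [F2 [Uy F1r F2r UF]]]] := loc y Cy.
      exists (carrier (ksub (G d) Im) `&` id @^-1` U), (fun y => (tnth (F2 y) i)@_m).
      split; [exact: F2r|by split|by move=> z []|].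
      by move=> z [Cz Uz]; have [_ ->] := UF z Cz Uz.
Qed.

End ClosedImmersion.

(** * Recovering an automorphism from its conjugates *)

Section Tools.
Variables (k : fieldType) (n : nat).
Hypothesis k0 : [pchar k] =i pred0.
Local Notation poly := {mpoly k[n]}.

(** Choose the [f r] so that the rank of the vectors [E (f r)] is maximal; then every [E x] lies in
    their span, and a pseudo-inverse gives the coefficients. That they are linear in [E x] makes
    them regular when [E] is. *)
Lemma linear_recovery (T : Type) (N : nat) (E : T -> 'rV[k]_N) (P : set T) :
  exists q (f : 'I_q -> T) (B : 'M[k]_(N, q)), (forall r, P (f r)) /\
    forall x, P x -> E x = \sum_r (E x *m B) ord0 r *: E (f r).
Proof.
pose mx q (f : 'I_q -> T) := \matrix_(r < q) E (f r).
pose Q d := `[< exists q (f : 'I_q -> T), (forall r, P (f r)) /\ \rank (mx q f) = d >].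
have Q0 : exists d, Q d.
  have f0 : 'I_0 -> T by case.
  by exists (\rank (mx 0%N f0)); apply/asboolP; exists 0%N, f0; split => // -[].
have QN d : Q d -> (d <= N)%N.
  by move=> /asboolP[q [f [_ <-]]]; exact: rank_leq_col.
case: (ex_maxnP Q0 QN) => d /asboolP[q [f [fP fd]]] dmax.
exists q, f, (pinvmx (mx q f)); split => // x Px.
pose f' (r : 'I_(q + 1)) := match split r with inl a => f a | inr _ => x end.
have mxf' : mx _ f' = col_mx (mx q f) (E x).
  apply/matrixP => i j; rewrite !mxE /f'; case: (split i) => a; rewrite ?mxE //.
  by rewrite ord1.
have sub : (E x <= mx q f)%MS.
  have le : (\rank (mx _ f') <= \rank (mx q f))%N.
    rewrite fd; apply: dmax; apply/asboolP; exists (q + 1)%N, f'; split => // r.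
    by rewrite /f'; case: (split r).
  have s1 : (mx q f <= mx _ f')%MS by rewrite mxf' -addsmxE addsmxSl.
  have s2 : (mx _ f' <= mx q f)%MS.
    by rewrite -(mxrank_leqif_sup s1) eqn_leq le mxrankS.
  by apply: submx_trans s2; rewrite mxf' -addsmxE addsmxSr.
rewrite -{1}(mulmxKpV sub); apply/rowP => j; rewrite mxE summxE.
by apply: eq_bigr => r _; rewrite !mxE.
Qed.

(** Near [(x, s)] the function is a quotient of sums of terms f_i(x) g_i(t). Differentiating in t
    only replaces the g_i by scalars, and the quotient rule leaves a quotient of regular functions
    of x. *)
Lemma der_regular T (X : kspace k T) (b : {poly k}) s Om F : is_ringed X ->
  b.[s] != 0 -> kreg (kprod X (line b)) Om F ->
  (forall x, carrier X x -> Om (x, s)) ->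
  kreg X (carrier X) (fun x => der s (fun t => F (x, t))).
Proof.
move=> Xr bs FO Os; have Xs := ringed_space Xr.
have Lr := line_ringed b; have Ls := ringed_space Lr; have Pr := kprod_ringed Xr Lr.
have Ps := ringed_space Pr.
have iM x : carrier X x -> kmorphism (line b) (kprod X (line b)) (fun t => (x, t)).
  move=> Cx; apply: (kmorphism_pair Lr); first exact: kmorphism_cst.
  exact: kmorphism_id.
apply: (kreg_local Xs) => x Cx.
have [U [V [h [h' [oU oV [hT hT'] [[/= Ux Vs] hx] H]]]]] := FO.2 _ (Os x Cx).
move: hT => [m [f [g [fg hE]]]]; move: hT' => [m' [f' [g' [fg' hE']]]].
have gd i : hasder s (g i) (der s (g i)).
  by have [_ gV] := fg i; exact: (line_hasder k0 gV).
have gd' i : hasder s (g' i) (der s (g' i)).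
  by have [_ gV] := fg' i; exact: (line_hasder k0 gV).
pose A y := \sum_(i < m) f i y * g i s; pose A' y := \sum_(i < m') f' i y * g' i s.
pose B y := \sum_(i < m) f i y * der s (g i).
pose B' y := \sum_(i < m') f' i y * der s (g' i).
have reg l (u : 'I_l -> T -> k) c : (forall i, kreg X U (u i)) ->
    kreg X U (fun y => \sum_(i < l) u i y * c i).
  move=> uU; apply: (ringed_sum Xr) => // i; apply: (ringed_mul Xr) => //.
  exact: (ringed_cst Xr).
have fU i : kreg X U (f i) by have [] := fg i.
have fU' i : kreg X U (f' i) by have [] := fg' i.
have Ar := reg _ f (fun i => g i s) fU; have Ar' := reg _ f' (fun i => g' i s) fU'.
have Br := reg _ f (fun i => der s (g i)) fU; have Br' := reg _ f' (fun i => der s (g' i)) fU'.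
exists [set y | U y /\ A' y != 0], (fun y => (B y * A' y - A y * B' y) / (A' y ^+ 2)).
have A'x : A' x != 0 by move: hx; rewrite hE'.
split.
- have := ringed_div Xr (ringed_sub Xr (ringed_mul Xr Br Ar') (ringed_mul Xr Ar Br')) (ringed_exp Xr 2 Ar').
  congr kreg; apply/seteqP; split=> y [Uy]; rewrite ?expf_eq0 //= => ?; split => //.
  by rewrite expf_eq0.
- by [].
- by move=> y [Uy _]; exact: (kopen_sub Xs oU).
- move=> y [Uy A'y]; have Cy := kopen_sub Xs oU Uy.
  apply: (derE k0).
  have sumd l (u : 'I_l -> T -> k) (v : 'I_l -> k -> k) : (forall i, hasder s (v i) (der s (v i))) ->
      hasder s (fun t => \sum_(i < l) u i y * v i t) (\sum_(i < l) u i y * der s (v i)).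
    move=> vd; apply: hasder_sum => i.
    by have := hasderM (hasder_cst s (u i y)) (vd i); rewrite mul0r add0r.
  have hd := hasder_div (sumd _ f g gd) (sumd _ f' g' gd') A'y.
  have [_ _ ir] := iM y Cy; have FOy := ir _ _ FO.
  have oN : kopen (line b) ((carrier (line b) `&` (fun t => (y, t)) @^-1` Om) `&`
      [set t | V t /\ h' (y, t) != 0]).
    apply: (kopenI Ls); first exact: (kreg_open Ls FOy).
    have : kreg (line b) V (fun t => h' (y, t)).
      rewrite hE' /=; apply: (ringed_sum Lr) => // i; apply: (ringed_mul Lr).
        exact: (ringed_cst Lr).
      by have [] := fg' i.
    exact: (ringed_neq0 Lr).
  have [q [qs qN]] : exists q : {poly k}, q.[s] != 0 /\ forall t, q.[t] != 0 ->
      ((carrier (line b) `&` (fun t => (y, t)) @^-1` Om) `&`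
      [set t | V t /\ h' (y, t) != 0]) t.
    apply: (line_openP oN); split; first by split; [exact/line_carrier|exact: Os].
    by split => //; rewrite hE'.
  apply: (hasder_local qs _ hd) => t /qN[[_ Ot] [Vt ht]].
  rewrite (H (y, t)) //.
  by rewrite hE hE'.
Qed.

(** ** Degrees of differences *)

Lemma msizeM_bound (p q : poly) d e : (msize p <= d)%N -> (msize q <= e.+1)%N ->
  (msize (p * q) <= d + e)%N.
Proof.
have [->|p0] := eqVneq p 0; first by rewrite mul0r msize0.
have [->|q0] := eqVneq q 0; first by rewrite mulr0 msize0.
move=> pd qe; rewrite msizeM // -ltnS prednK; last by rewrite addn_gt0 lt0n msize_poly_eq0 p0.
by rewrite -addnS leq_add.
Qed.

(** A translation preserves the leading form, so the difference has smaller degree. With t the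
    translation, products are handled by (q r) o t - q r = (q o t - q) (r o t) + (r o t - r) q. *)
Lemma msize_translate (p : poly) (v : 'I_n -> k) d : (msize p <= d.+1)%N ->
  (msize ((p \mPo (translation v).1) - p) <= d)%N.
Proof.
pose t := (translation v).1.
pose P d (q : poly) := (msize q <= d.+1)%N /\ (msize ((q \mPo t) - q) <= d)%N.
have P1 : P 0%N 1 by rewrite /P comp_mpoly1 subrr msize0 msize1.
have PX i : P 1%N 'X_i.
  rewrite /P msizeX mdeg1 comp_mpolyXU -tnth_nth translationE addrAC subrr add0r.
  by rewrite msizeC; case: eqP.
have PM a b q r : P a q -> P b r -> P (a + b)%N (q * r).
  move=> [qa qa'] [rb rb']; split; first by rewrite -addSn msizeM_bound.
  rewrite (_ : _ - _ = ((q \mPo t) - q) * (r \mPo t) + ((r \mPo t) - r) * q).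
    apply: leq_trans (msizeD_le _ _) _; rewrite geq_max; apply/andP; split.
      apply: msizeM_bound => //; rewrite -[r \mPo t](subrK r).
      by apply: leq_trans (msizeD_le _ _) _; rewrite geq_max rb (leq_trans rb').
    by rewrite addnC; exact: msizeM_bound.
  by rewrite rmorphM /=; move: (q \mPo t) (r \mPo t) => Q R; ring.
have Pm (m : 'X_{1..n}) : P (mdeg m) 'X_[m].
  rewrite mpolyXE_id mdegE; elim/big_rec2: _ => [|i q a _ IH]; first exact: P1.
  apply: (PM _ _ _ _ _ IH); elim: (m i) => [|c IHc]; first by rewrite expr0.
  by rewrite exprS -add1n; exact: (PM _ _ _ _ (PX i) IHc).
move=> pd; rewrite -/t {1 2}(mpolyE p) raddf_sum /= -sumrB.
rewrite big_seq; apply: leq_trans (msize_sum _ _ _) _.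
apply/bigmax_leqP_seq => m _ mp; rewrite comp_mpolyZ -scalerBr.
apply: leq_trans (msizeZ_le _ _) _; apply: leq_trans (proj2 (Pm m)) _.
by rewrite -ltnS; apply: leq_trans (msize_mdeg_lt mp) pd.
Qed.

Lemma mderiv_eq0 (p : poly) : (forall i, p^`M(i) = 0) -> p = (p@_0)%:MP.
Proof.
move=> p0; apply/mpolyP => m; rewrite mcoeffC.
have [->|m0] := eqVneq m 0%MM; first by rewrite mulr1.
rewrite mulr0.
have [i mi] : exists i, m i != 0%N.
  apply: contrapT => H; case/eqP: m0; apply/mnmP => i; rewrite mnm0E.
  by apply/eqP/negPn/negP => mi; apply: H; exists i.
have /eqP := congr1 (mcoeff (m - U_(i))%MM) (p0 i).
rewrite mcoeff0 mcoeff_deriv submK ?lep1mP // -mulr_natr mulf_eq0.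
by rewrite (negPf (natr_neq0 k0 _)) orbF => /eqP.
Qed.

(** Differentiating invariance along each coordinate axis shows that all partial derivatives vanish,
    which in characteristic zero leaves the constants. *)
Lemma translate_invariant (p : poly) :
  (forall v, p \mPo (translation v).1 = p) -> p = (p@_0)%:MP.
Proof.
move=> pv; apply: mderiv_eq0 => i.
have b0 : (1 : {poly k}).[0] != 0 by rewrite hornerC oner_neq0.
pose g t := (translation (fun j => t * (j == i)%:R : k) : autA k n).1.
have gd j : isder 1 0 (fun t => tnth (g t) j) ((j == i)%:R%:MP_[n]).
  rewrite -[_%:MP]add0r; have := isderD b0 (isder_cst b0 ('X_j : poly)) (isder_id b0 ((j == i)%:R%:MP_[n])).
  by move=> H; apply: (isder_eq b0 H) => t _; rewrite translationE mpolyCM mul_mpolyC.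
have := isder_comp_cst b0 p gd.
have -> : \sum_(j < n) (p^`M(j) \mPo g 0) * (j == i)%:R%:MP = p^`M(i).
  rewrite (bigD1 i) //= eqxx mulr1 big1 ?addr0 => [|j /negPf ->]; last by rewrite mulr0.
  rewrite (_ : g 0 = endo_id k n) ?comp_mpoly_id //.
  by apply/eq_from_tnth => j; rewrite translationE mul0r mpolyC0 addr0 tnth_mktuple.
move=> H; apply: (isder_unique k0 H (isder_eq b0 (isder_cst b0 p) _)) => t _.
by rewrite pv.
Qed.

(** The difference of [Y] and a translate of it stays in [W] and has smaller degree; when all these
    differences are zero, [Y] is constant. *)
Lemma translation_stable (W : set ('I_n -> poly)) :
  (forall Y Z, W Y -> W Z -> W (fun l => Y l - Z l)) ->
  (forall Y v, W Y -> W (fun l => Y l \mPo (translation v).1)) ->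
  forall Y, W Y -> (exists l, Y l != 0) ->
  exists2 c : 'I_n -> k, W (fun l => (c l)%:MP) & exists l, c l != 0.
Proof.
move=> WB Wt Y.
have : exists d, forall l, (msize (Y l) <= d)%N.
  by exists (\max_l msize (Y l))%N => l; exact: (leq_bigmax (F := fun l => msize (Y l))).
move=> [d]; elim: d Y => [|d IHd] Y Yd WY [l Yl].
  by have := Yd l; rewrite leqn0 msize_poly_eq0 (negPf Yl).
have [[v [j Yj]]|inv] := pselect (exists v j, (Y j \mPo (translation v).1) != Y j).
  apply: (IHd (fun l => (Y l \mPo (translation v).1) - Y l)).
  - by move=> i; exact: msize_translate.
  - exact: (WB _ _ (Wt _ v WY) WY).
  - by exists j; rewrite subr_eq0.
have Yc j : Y j = ((Y j)@_0)%:MP.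
  apply: translate_invariant => v; apply/eqP/negPn/negP => H; apply: inv.
  by exists v, j.
exists (fun j => (Y j)@_0).
  by rewrite (_ : (fun l => _) = Y) //; apply: funext => j; rewrite -Yc.
by exists l; apply: contraNneq Yl; rewrite (Yc l) mpolyCK => ->; rewrite mpolyC0.
Qed.

End Tools.

(** * Pullbacks of a vector field and injectivity of the differential *)

Section Conjugates.
Variables (k : fieldType) (n : nat).
Hypothesis k0 : [pchar k] =i pred0.
Local Notation poly := {mpoly k[n]}.
Local Notation autA := (autA k n).
Local Notation endo := (endo k n).
Variables (gT : groupType) (G : indspace k gT).
Hypothesis Gg : is_indgroup G.
Let Gi := indgroup_ind Gg.

(* The combination of the tangent vectors at [1] of the curves [c j] is zero. *)
Definition killed (J : finType) (a : J -> k) (b : J -> {poly k}) (s : J -> k)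
    (c : J -> k -> gT) : Prop :=
  forall m W h, (forall j, kmorphism (line (b j)) (G m) (c j)) ->
    kreg (G m) W h -> W 1%g -> \sum_j a j * der (s j) (h \o c j) = 0.

Lemma der_congr (b : {poly k}) s r r' : b.[s] != 0 ->
  (forall t, b.[t] != 0 -> r t = r' t) -> der s r = der s r'.
Proof.
move=> bs rr; rewrite /der; congr (xget _ _); apply/seteqP; split=> d /=.
  by apply: (hasder_local bs) => t bt; rewrite rr.
exact: (hasder_local bs).
Qed.

Lemma line_shift (c : k) : kmorphism (line 1) (line 1) (fun t : k => t + c).
Proof.
have Lr := line_ringed (1 : {poly k}); have Ls := ringed_space Lr.
apply: (kmorphism_induced Ls (affine_kspace _ _)).
  by move=> t _ /=; rewrite hornerC oner_neq0.
apply: (kmorphism_affine Lr) => i /=.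
apply: (kreg_eq Ls (f := fun t => t + c)) => [|t _]; last by rewrite ffunE.
apply: (ringed_add Lr); first exact: line_coord.
by apply: (ringed_cst Lr); exact: (kopenT Ls).
Qed.

Lemma der_extend (b : {poly k}) s (c : k -> gT) m M W h W' h' :
  b.[s] != 0 -> c s = 1%g -> kmorphism (line b) (G m) c ->
  kmorphism (line b) (G M) c ->
  kreg (G M) W' h' -> W' 1%g ->
  (forall y, carrier (G m) y -> W' y -> W y /\ h y = h' y) ->
  der s (h \o c) = der s (h' \o c).
Proof.
move=> bs cs cm cM hW' W1 hh; apply: (derE k0).
apply: (der_germ k0 cM bs hW'); first by rewrite cs.
move=> t bt Wt; have [cC _ _] := cm.
by have [|_ //] := hh (c t) _ Wt; apply: cC; exact/line_carrier.
Qed.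

(** Test functions extend to larger pieces without changing the derivatives along the curves, so the
    relation need only be tested on large pieces. *)
Lemma killed_from (J : finType) (a : J -> k) b s c m0 :
  (forall j, (b j).[s j] != 0) -> (forall j, c j (s j) = 1%g) ->
  (forall j, kmorphism (line (b j)) (G m0) (c j)) ->
  (forall m W h, (m0 <= m)%N -> kreg (G m) W h -> W 1%g ->
     \sum_j a j * der (s j) (h \o c j) = 0) ->
  killed a b s c.
Proof.
move=> bs cs cM H m W h cm hW W1.
have [W' [h' [hW' W1' hh]]] := ind_extend Gi (leq_maxl m m0) hW W1.
rewrite -[RHS](H _ _ _ (leq_maxr m m0) hW' W1'); apply: eq_bigr => j _; congr (_ * _).
apply: (der_extend (bs j) (cs j) (cm j) _ hW' W1' hh).
exact: (kmorphism_le Gi (line_kspace _) (leq_maxr _ _) (cM j)).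
Qed.

Lemma common_level (J : finType) (b : J -> {poly k}) (c : J -> k -> gT) :
  (forall j, imorphism G (line (b j)) (c j)) ->
  exists m, forall j, kmorphism (line (b j)) (G m) (c j).
Proof.
move=> /choice[m mP]; exists (\max_j m j)%N => j.
exact: (kmorphism_le Gi (line_kspace _) (leq_bigmax j) (mP j)).
Qed.

Variable e : bool.
Local Notation S := (@jac1_if k n e).
Variable phi : autA -> gT.
Hypothesis phiM : ind_morphism (ind_sub (Aut k n) S) G phi.
Hypothesis phiD : forall f g, S f -> S g -> phi (f * g)%g = (phi f * phi g)%g.
Let S1 := @jac1_if1 k n e.
Let SM := @jac1_ifM k n e.
Let SV := @jac1_ifV k n e.
Let phi_1 := phi1 S1 phiD.
Let phi_V := phiV S1 SV phiD.

Lemma jac1_if_translation v : S (translation v).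
Proof. by move=> _; exact: jac_translation. Qed.

Lemma jac1_if_elem i q : free_of i q -> S (elem_aut i q).
Proof. by move=> fq _; exact: jac_elem. Qed.

Let St := jac1_if_translation.
Let Se := jac1_if_elem.

(* [SL_n] acts transitively on the one-parameter groups of translations. *)
Lemma phi_translation_trivial (v : 'I_n -> k) i : v i != 0 ->
  (forall t : k, phi (translation (fun j => t * v j)) = 1%g) ->
  forall u : 'I_n -> k, phi (translation u) = 1%g.
Proof.
move=> vi v1.
pose tr j (a : k) : autA := translation (fun l => (l == j)%:R * a).
have other j a : j != i -> phi (tr j a) = 1%g.
  move=> ji; have fX : free_of j ('X_i : poly).
    by apply: free_ofX; rewrite mnm1E eq_sym (negPf ji).
  (* With this factor the shear x_j |-> x_j + x_i carries the translation by t v to the one by t v +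
     a e_j. Since [phi] kills the former, it also kills the translation by a e_j. *)
  pose t := a / v i.
  pose tv : autA := translation (fun l => t * v l).
  pose tw : autA := translation (fun l => (l == j)%:R * a + t * v l).
  have E : (elem_aut j 'X_i * tv)%g = (tw * elem_aut j 'X_i)%g.
    apply: autA_inj1; apply/eq_from_tnth => l.
    rewrite !autA_mul1E elem_aut1E // translationE !comp_mpolyD comp_mpolyZ.
    rewrite !comp_mpolyXU comp_mpolyC -!tnth_nth !translationE elem_aut1E //.
    rewrite scalerDr mpolyCD [_ *: _%:MP](_ : _ = ((l == j)%:R * a)%:MP); last first.
      by rewrite -mul_mpolyC -mpolyCM /t divfK.
    by rewrite [LHS]addrACA; congr (_ + _); exact: addrC.
  have E1 : phi (elem_aut j 'X_i * tv)%g = phi (elem_aut j 'X_i).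
    by rewrite (phiD (Se fX) (St _)) v1 mulg1.
  have E2 : phi (tw * elem_aut j 'X_i)%g = (phi (tr j a) * phi (elem_aut j 'X_i))%g.
    by rewrite (phiD (St _) (Se fX)) /tw translationD (phiD (St _) (St _)) v1 mulg1.
  by apply: (mulIg (phi (elem_aut j 'X_i))); rewrite mul1g -E2 -E E1.
have comb (s : seq 'I_n) (r : 'I_n -> k) :
    phi (translation (fun l => \sum_(j <- s | j != i) (l == j)%:R * r j)) = 1%g.
  elim: s => [|j s IHs].
    rewrite (translation_eq (v := fun=> 0)) ?translation0 //.
    by move=> l; rewrite big_nil.
  rewrite (translation_eq (v := fun l => (if j != i then (l == j)%:R * r j else 0) +
      \sum_(j <- s | j != i) (l == j)%:R * r j)); last first.
    by move=> l; rewrite big_cons; case: (j != i); rewrite ?add0r.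
  rewrite translationD phiD // IHs mulg1.
  have [_|ji] := eqVneq j i; last exact: other.
  by rewrite -phi_1 -[in RHS](translation0 k n).
move=> u; pose t := u i / v i.
(* [u] is the multiple of [v] with the same coordinate [i], corrected along the other axes. *)
rewrite (translation_eq (v := fun l => t * v l +
   \sum_(j | j != i) (l == j)%:R * (u j - t * v j))); last first.
  move=> l; have [->|li] := eqVneq l i.
    rewrite big1 => [|j ji]; first by rewrite addr0 /t divfK.
    by rewrite eq_sym (negPf ji) mul0r.
  rewrite (bigD1 l) //= eqxx mul1r big1 => [|j /andP[_ jl]].
    by rewrite addr0 addrC subrK.
  by rewrite eq_sym (negPf jl) mul0r.
by rewrite translationD phiD // v1 mul1g comb.
Qed.

Section OneParameter.
Variables (b0 : {poly k}) (u : k -> autA) (w : 'I_n -> poly).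
Hypotheses (b00 : b0.[0] != 0) (uL : afam (line b0) u) (u0 : u 0 = 1%g).
Hypothesis uS : forall t, b0.[t] != 0 -> S (u t).
Hypothesis uw : forall i, isder b0 0 (fun t => tnth (u t).1 i) (w i).

Definition conj_curve (f : autA) (t : k) : autA := (f^-1 * u t * f)%g.

(** The pullback of the vector field [w] by [f], that is, the inverse Jacobian matrix of [f] applied
    to [w] composed with [f]; the entries of that inverse are the partial derivatives of [f.2]
    composed with [f.1]. *)
Definition conj_vel (f : autA) (l : 'I_n) : poly :=
  \sum_(i < n) ((tnth f.2 l)^`M(i) \mPo f.1) * (w i \mPo f.1).

Let Lr := line_ringed b0.

Lemma conj_curve0 f : conj_curve f 0 = 1%g.
Proof. by rewrite /conj_curve u0 mulg1 mulVg. Qed.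

Lemma conj_curve_afam f : afam (line b0) (conj_curve f).
Proof.
apply: (afam_mul Lr); last exact: afam_cst.
by apply: (afam_mul Lr) => //; exact: afam_cst.
Qed.

Lemma conj_curve_S f t : S f -> b0.[t] != 0 -> S (conj_curve f t).
Proof. by move=> Sf bt; apply: SM => //; apply: SM; [exact: SV|exact: uS]. Qed.

Lemma conj_curve_imorphism f : S f -> imorphism G (line b0) (phi \o conj_curve f).
Proof.
move=> Sf; apply: (imorphism_phi phiM Lr (conj_curve_afam f)).
by move=> t /line_carrier; exact: conj_curve_S.
Qed.

Lemma conj_curve_isder f l :
  isder b0 0 (fun t => tnth (conj_curve f t).1 l) (conj_vel f l).
Proof.
apply: (isder_eq b00 (p := fun t => (tnth f.2 l \mPo (u t).1) \mPo f.1)); last first.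
  by move=> t _; rewrite !autA_mul1E.
have := isder_comp b00 (isder_comp_cst b00 (tnth f.2 l) uw) (fun j => isder_cst b00 (tnth f.1 j)).
rewrite [X in _ + X]big1 ?addr0 => [|i _]; last by rewrite mulr0.
rewrite u0 raddf_sum /=; congr isder; apply: eq_bigr => i _.
by rewrite rmorphM /= comp_mpoly_id.
Qed.

(** A translation has identity Jacobian matrix, so pulling back by it is mere substitution. *)
Lemma conj_vel_translation f v l :
  conj_vel (f * translation v)%g l = conj_vel f l \mPo (translation v).1.
Proof.
rewrite /conj_vel raddf_sum /=; apply: eq_bigr => i _.
rewrite endo_compE tnth_mktuple comp_mpolyB comp_mpolyXU comp_mpolyC -tnth_nth.
by rewrite mderivB mderivC subr0 rmorphM /= !comp_mpoly_comp.
Qed.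

Hypothesis nontrivial_translation : exists v, phi (translation v) <> 1%g.

(* The killed combinations of velocities form a translation-stable space of
   polynomial vector fields; if it is nonzero, it contains a constant field,
   and the translations along that field are in the kernel. *)
Lemma conj_vel_killed (J : finType) (a : J -> k) (f : J -> autA) :
  (forall j, S (f j)) ->
  killed a (fun=> b0) (fun=> 0) (fun j => phi \o conj_curve (f j)) ->
  forall l, \sum_j a j *: conj_vel (f j) l = 0.
Proof.
move=> fS fK l; apply/eqP/negPn/negP => Yl.
pose W (Y : 'I_n -> poly) := exists (J : finType) (a : J -> k) (f : J -> autA),
  [/\ forall j, S (f j),
     killed a (fun=> b0) (fun=> 0) (fun j => phi \o conj_curve (f j))
   & Y = fun l => \sum_j a j *: conj_vel (f j) l].
have WB Y Z : W Y -> W Z -> W (fun l => Y l - Z l).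
  move=> [J1 [a1 [f1 [S1' K1 ->]]]] [J2 [a2 [f2 [S2' K2 ->]]]].
  exists (J1 + J2)%type.
  exists (fun j => match j with inl i => a1 i | inr i => - a2 i end).
  exists (fun j => match j with inl i => f1 i | inr i => f2 i end).
  split; first by case.
    move=> m A h cM hA A1; rewrite big_sumType /=.
    rewrite (K1 m A h (fun j => cM (inl j)) hA A1) add0r.
    under eq_bigr do rewrite mulNr.
    by rewrite sumrN (K2 m A h (fun j => cM (inr j)) hA A1) oppr0.
  apply: funext => i; rewrite big_sumType /=; congr (_ + _).
  by under [in RHS]eq_bigr do rewrite scaleNr; rewrite sumrN.
have Wt Y v : W Y -> W (fun l => Y l \mPo (translation v).1).
  move=> [J1 [a1 [f1 [S1' K1 ->]]]].
  pose f2 j := (f1 j * translation v)%g.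
  have S2' j : S (f2 j) by apply: SM.
  (* Conjugation by [phi (translation v)] carries the curves of the [f1 j] to those of the [f2 j],
     and test functions are pulled back along it. *)
  exists J1, a1, f2; split => //; last first.
    apply: funext => i; rewrite raddf_sum /=; apply: eq_bigr => j _.
    by rewrite comp_mpolyZ conj_vel_translation.
  have [m1 c1M] := common_level (fun j => conj_curve_imorphism (S1' j)).
  pose y0 := phi (translation v).
  have Cy0 : ind_carrier G y0 by exact: (phi_carrier phiM).
  have Gr := ind_ringed Gi m1.
  have [m2 qM] : imorphism G (G m1) (fun y => y0^-1 * y * y0)%g.
    apply: (imorphism_mul Gg Gr); last exact: imorphism_cst.
    apply: (imorphism_mul Gg Gr); first by apply: (imorphism_inv Gg Gr); exact: imorphism_cst.
    by exists m1; exact/kmorphism_id/ind_kspace.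
  have cE j t : b0.[t] != 0 ->
      (y0^-1 * (phi \o conj_curve (f1 j)) t * y0)%g = (phi \o conj_curve (f2 j)) t.
    move=> bt /=; have Sc := conj_curve_S (S1' j) bt.
    rewrite /y0 -phi_V // -phiD //; last exact: SV.
    rewrite -phiD //; last by apply: SM => //; exact: SV.
    by rewrite /conj_curve /f2 invgM !mulgA.
  have c2M j : kmorphism (line b0) (G m2) (phi \o conj_curve (f2 j)).
    apply: (kmorphism_eq (line_kspace b0) (kmorphism_comp (line_kspace b0) (c1M j) qM)).
    by move=> t /line_carrier bt; rewrite -cE.
  apply: (killed_from (m0 := m2)) => // [j|m A h mm hA A1].
    by rewrite /= conj_curve0.
  have [_ _ qr] := kmorphism_le Gi (ind_kspace Gi m1) mm qM.
  (* A curve is needed to see that 1 lies in [G m1]; without curves the sum is empty. *)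
  have [j0 _|noJ] := pickP (fun _ : J1 => true); last by rewrite big_pred0.
  rewrite -[RHS](K1 m1 _ _ c1M (qr _ _ hA)); last first.
    split; last by rewrite /preimage /= mulg1 mulVg.
    have [cC _ _] := c1M j0; have := cC 0; rewrite /= conj_curve0 phi_1; apply.
    exact/line_carrier.
  apply: eq_bigr => j _; congr (_ * _); apply: (der_congr b00) => t bt.
  exact: (congr1 h (esym (cE j t bt))).
pose Y0 l' := \sum_j a j *: conj_vel (f j) l'.
have WY0 : W Y0 by exists J, a, f.
have Y0l : exists l', Y0 l' != 0 by exists l.
have [c [J1 [a1 [f1 [S1' K1 cE]]]] [i ci]] := translation_stable k0 WB Wt WY0 Y0l.
pose tau (t : k) : autA := translation (fun i => t * c i).
have L1 := line_ringed (1 : {poly k}).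
have one0 (t : k) : (1 : {poly k}).[t] != 0 by rewrite hornerC oner_neq0.
have tauL : afam (line 1) tau.
  apply: (afam_translation L1) => j; apply: (ringed_mul L1); first exact: line_coord.
  by apply: (ringed_cst L1); exact: (kopenT (ringed_space L1)).
have tau0 : tau 0 = 1%g.
  by rewrite -(translation0 k n); apply: translation_eq => j; rewrite mul0r.
have tauV j : isder 1 0 (fun t => tnth (tau t).1 j) ((c j)%:MP).
  rewrite -[_%:MP]add0r; have := isderD (one0 0) (isder_cst (one0 0) ('X_j : poly)) (isder_id (one0 0) ((c j)%:MP)).
  by move=> H; apply: (isder_eq (one0 0) H) => t _; rewrite translationE mpolyCM mul_mpolyC.
have tauM : imorphism G (line 1) (phi \o tau).
  by apply: (imorphism_phi phiM L1 tauL) => t _; exact: St.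
(* The constant field [c] is a combination of velocities whose images sum to zero. Since the
   differential is well defined, [phi \o tau] has zero velocity at 0. *)
have tauK : killed (fun _ : unit => 1) (fun=> 1) (fun=> 0) (fun=> phi \o tau).
  have [m1 c1M] := common_level (fun j => conj_curve_imorphism (S1' j)).
  have [m2 c2M] := tauM.
  apply: (killed_from (m0 := maxn m1 m2)) => // [_|_|m A h mm hA A1].
  - by rewrite /= tau0.
  - exact: (kmorphism_le Gi (line_kspace _) (leq_maxr _ _) c2M).
  have m1m := leq_trans (leq_maxl m1 m2) mm; have m2m := leq_trans (leq_maxr m1 m2) mm.
  have c1m j := kmorphism_le Gi (line_kspace b0) m1m (c1M j).
  have c2m := kmorphism_le Gi (line_kspace 1) m2m c2M.
  pose a' (j : J1 + unit) := match j with inl i => a1 i | inr _ => - 1 end.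
  pose b' (j : J1 + unit) := match j with inl i => b0 | inr _ => 1 end.
  pose c' (j : J1 + unit) := match j with inl i => conj_curve (f1 i) | inr _ => tau end.
  pose V' (j : J1 + unit) := match j with
    inl i => conj_vel (f1 i) | inr _ => fun i => (c i)%:MP end.
  have : \sum_j a' j * der 0 (h \o phi \o c' j) = 0.
    apply: (velocity_relation k0 (b := b') (V := V') Gi phiM S1 _ _ _ _ _ _ _ hA).
    - by case=> [j|j]; [exact: conj_curve_afam|exact: tauL].
    - case=> [j t bt|j t _]; [exact: conj_curve_S|exact: St].
    - by case=> [j|j]; [exact: b00|exact: one0].
    - by case=> [j|j]; [exact: conj_curve0|exact: tau0].
    - by case=> [j|j] l'; [exact: conj_curve_isder|exact: tauV].
    - move=> l'; rewrite big_sumType /= (big_pred1 tt) => [|[] //].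
      by rewrite scaleN1r -(congr1 (fun Y => Y l') cE) subrr.
    - by case=> [j|j]; [exact: c1m|exact: c2m].
    - by rewrite phi_1.
  rewrite big_sumType /= (K1 m A h c1m hA A1) add0r.
  rewrite !(big_pred1 tt); try by case.
  by rewrite mulN1r mul1r => /eqP; rewrite oppr_eq0 => /eqP.
have [v0 v0P] := nontrivial_translation; apply: v0P.
apply: (phi_translation_trivial ci) => t.
rewrite -[RHS]phi_1 -tau0.
(* As [tau] is a one-parameter group, its velocity at any [s], moved to the identity, is its
   velocity at 0; so zero velocity at 0 makes [phi \o tau] constant. *)
apply: (const_phi k0 Gg S1 SM SV phiM phiD tauL) => // [s _|s m A h _ cM hA A1].
  exact: St.
have tE t' : ((tau s)^-1 * tau t')%g = tau (t' - s).
  apply: (mulgI (tau s)); rewrite mulVKg -translationD; apply: translation_eq => j.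
  by rewrite -mulrDl subrKC.
have cE' : (fun t' => h (phi ((tau s)^-1 * tau t')%g)) = (fun t' => (h \o (phi \o tau)) (t' - s)).
  by apply: funext => t' /=; rewrite tE.
have tauMm : kmorphism (line 1) (G m) (phi \o tau).
  apply: (kmorphism_eq (line_kspace 1) (kmorphism_comp (line_kspace 1) (line_shift s) cM)).
  by move=> t' _ /=; rewrite tE addrK.
have [_ _ tr] := tauMm.
have A0 : (carrier (line 1) `&` (phi \o tau) @^-1` A) 0.
  by split; [exact/line_carrier|rewrite /preimage /= tau0 phi_1].
have hd := line_hasder k0 (tr _ _ hA) A0.
rewrite cE'; apply: (derE k0).
have := tauK m A h (fun=> tauMm) hA A1; rewrite (big_pred1 tt) ?mul1r; last by case.
move=> d0; rewrite -d0; apply: hasder_shift; rewrite subrr.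
exact: hd.
Qed.

End OneParameter.
End Conjugates.

(** * Regular reconstruction of an automorphism *)

Section Reconstruction.
Variables (k : fieldType) (n : nat).
Hypothesis k0 : [pchar k] =i pred0.
Local Notation poly := {mpoly k[n]}.
Local Notation autA := (autA k n).
Local Notation endo := (endo k n).
Variables (gT : groupType) (G : indspace k gT).
Hypothesis Gg : is_indgroup G.
Let Gi := indgroup_ind Gg.
Variable e : bool.
Local Notation S := (@jac1_if k n e).
Variable phi : autA -> gT.
Hypothesis phiM : ind_morphism (ind_sub (Aut k n) S) G phi.
Hypothesis phiD : forall f g, S f -> S g -> phi (f * g)%g = (phi f * phi g)%g.
Let S1 := @jac1_if1 k n e.
Let SM := @jac1_ifM k n e.
Let SV := @jac1_ifV k n e.
Let phi_1 := phi1 S1 phiD.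
Let phi_V := phiV S1 SV phiD.
Hypothesis nontrivial_translation : exists v, phi (translation v) <> 1%g.

(** [E g] collects the chart coordinates of the velocity at 1, [linear_recovery] supplies elements
    whose coordinates suffice, and [conj_vel_killed] replaces coordinates by vector fields. The
    fields in the resulting sum are fixed; only their scalar coefficients depend on [g]. *)
Lemma conj_vel_regular (b0 : {poly k}) (u : k -> autA) (w : 'I_n -> poly) d :
  b0.[0] != 0 -> afam (line b0) u -> u 0 = 1%g ->
  (forall t, b0.[t] != 0 -> S (u t)) ->
  (forall i, isder b0 0 (fun t => tnth (u t).1 i) (w i)) ->
  exists X : 'I_n -> gT -> poly, (forall l, rfam (G d) (X l)) /\
    forall f l, S f -> carrier (G d) (phi f) -> X l (phi f) = conj_vel w f l.
Proof.
move=> b00 uL u0 uS uw.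
have Gr := ind_ringed Gi d; have Gs := ringed_space Gr.
have Lr := line_ringed b0; have Ls := ringed_space Lr; have Pr := kprod_ringed Gr Lr.
have [m0 uM] : imorphism G (line b0) (phi \o u).
  by apply: (imorphism_phi phiM Lr uL) => t /line_carrier; exact: uS.
have Pfst : imorphism G (kprod (G d) (line b0)) fst.
  by exists d; exact: kmorphism_fst.
have Psnd : imorphism G (kprod (G d) (line b0)) (fun p => phi (u p.2)).
  exists m0; exact: (kmorphism_comp (ringed_space Pr) (kmorphism_snd Gr Lr) uM).
have [m1 qM1] := imorphism_mul Gg Pr (imorphism_mul Gg Pr (imorphism_inv Gg Pr Pfst) Psnd) Pfst.
have [_ [m2 _ C2] _ _] := Gg.
set m := maxn m1 m2.
have qM := kmorphism_le Gi (ringed_space Pr) (leq_maxl m1 m2 : (m1 <= m)%N) qM1.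
have C1 : carrier (G m) 1%g.
  by have [H _ _] := ind_incl Gi (leq_maxr m1 m2 : (m2 <= m)%N); exact: H.
have [I [U [x [[oU U1] xr _ xP]]]] := variety_chart (ind_variety Gi m) C1.
have [_ _ qr] := qM.
pose q g t := (g^-1 * phi (u t) * g)%g.
pose E (g : gT) (i : I) := der 0 (fun t => x (q g t) i).
have Er i : kreg (G d) (carrier (G d)) (fun g => E g i).
  apply: (der_regular k0 Gr b00 (qr _ _ (xr i))) => g Cg; split.
    by split => //; exact/line_carrier.
  by rewrite /preimage /= u0 phi_1 mulg1 mulVg.
have qE f t : S f -> b0.[t] != 0 -> q (phi f) t = phi (conj_curve u f t).
  move=> Sf bt; have St := uS t bt; rewrite /q -phi_V // -phiD //; last exact: SV.
  by rewrite -phiD //; apply: SM => //; exact: SV.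
pose row g : 'rV[k]_#|I| := \row_i E g (enum_val i).
have [r [f [B [fP rowE]]]] := linear_recovery (fun f => row (phi f))
  [set f | S f /\ carrier (G d) (phi f)].
exists (fun l g => \sum_s (row g *m B) ord0 s *: conj_vel w (f s) l); split.
  move=> l; apply: (rfam_sum Gr) => s; apply: (rfam_coef Gr).
  under eq_fun do rewrite mxE.
  apply: (ringed_sum Gr) => [|i]; first exact: (kopenT Gs).
  under eq_fun do rewrite mxE.
  by apply: (ringed_mul Gr) => //; apply: (ringed_cst Gr); exact: (kopenT Gs).
move=> f0 l Sf0 Cf0.
pose J := ('I_r + unit)%type.
pose a (j : J) := match j with inl s => (row (phi f0) *m B) ord0 s | inr _ => - 1 end.
pose ff (j : J) := match j with inl s => f s | inr _ => f0 end.
have Sff j : S (ff j) by case: j => [s|j] //=; have [] := fP s.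
have Cff j : carrier (G d) (phi (ff j)) by case: j => [s|j] //=; have [] := fP s.
have cM j : kmorphism (line b0) (G m) (phi \o conj_curve u (ff j)).
  have iM : kmorphism (line b0) (kprod (G d) (line b0)) (fun t => (phi (ff j), t)).
    by apply: (kmorphism_pair Lr); [exact: kmorphism_cst|exact: kmorphism_id].
  apply: (kmorphism_eq Ls (kmorphism_comp Ls iM qM)) => t /line_carrier bt /=.
  exact: qE.
have c0 j : (phi \o conj_curve u (ff j)) 0 = 1%g by rewrite /= conj_curve0.
have E0 i : \sum_j a j * E (phi (ff j)) i = 0.
  rewrite big_sumType /= (big_pred1 tt) => [|[] //].
  have := congr1 (fun v : 'rV_ _ => v ord0 (enum_rank i)) (rowE f0 (conj Sf0 Cf0)).
  rewrite /= summxE mxE enum_rankK mulN1r => ->.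
  rewrite -[X in X - _](_ : \sum_(s < r) ((row (phi f0) *m B) ord0 s *: row (phi (f s))) ord0 (enum_rank i) = _).
    by rewrite subrr.
  by apply: eq_bigr => s _; rewrite !mxE enum_rankK.
(* By [E0] the point derivation [D] kills the chart coordinates at 1, hence every function regular
   near 1. *)
have K : killed G a (fun=> b0) (fun=> 0) (fun j => phi \o conj_curve u (ff j)).
  apply: (killed_from k0 Gg (m0 := m)) => // M A h mM hA A1.
  have [_ _ ir] := ind_incl Gi mM.
  have hm := ir _ _ hA.
  have D := pderiv_curves k0 a cM (fun=> b00) c0.
  have [p1 [p2 [p20 pE]]] := xP _ _ hm (conj C1 A1).
  apply: (pderiv_rational0 (ind_ringed Gi m) D (p := p1) (q := p2) U1
    (c := fun i y => x y (enum_val i)) _ _ hm) => //.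
  - move=> i; rewrite -[RHS](E0 (enum_val i)); apply: eq_bigr => j _; congr (_ * _).
    by apply: (der_congr b00) => t bt /=; rewrite qE.
  - by move=> y Uy _ py; have [] := pE y Uy py.
have := conj_vel_killed k0 Gg phiM phiD b00 uL u0 uS uw nontrivial_translation Sff K l.
rewrite big_sumType /= (big_pred1 tt) => [|[] //].
by rewrite scaleN1r => /eqP; rewrite subr_eq0 => /eqP.
Qed.

Hypothesis scaling_curve : forall j : 'I_n, exists (i : 'I_n) (b0 : {poly k}) (u : k -> autA),
  [/\ b0.[0] != 0 /\ afam (line b0) u, u 0 = 1%g,
      forall t, b0.[t] != 0 -> S (u t)
    & forall l, isder b0 0 (fun t => tnth (u t).1 l) ((l == i)%:R *: 'X_j)].

Lemma conj_vel_unit (i : 'I_n) (c : poly) (f : autA) (l : 'I_n) :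
  conj_vel (fun l => (l == i)%:R *: c) f l = ((tnth f.2 l)^`M(i) \mPo f.1) * (c \mPo f.1).
Proof.
rewrite /conj_vel (bigD1 i) //= eqxx scale1r big1 ?addr0 // => j /negPf ->.
by rewrite scale0r raddf0 mulr0.
Qed.

Lemma inverse_jacobian_regular d : exists M : gT -> 'M[poly]_n,
  (forall l i, rfam (G d) (fun g => M g l i)) /\
  forall f, S f -> carrier (G d) (phi f) ->
    M (phi f) = \matrix_(l, i) ((tnth f.2 l)^`M(i) \mPo f.1).
Proof.
have /choice[X XP] i : exists X : 'I_n -> gT -> poly, (forall l, rfam (G d) (X l)) /\
    forall f l, S f -> carrier (G d) (phi f) ->
      X l (phi f) = conj_vel (fun l => (l == i)%:R *: 1) f l.
  pose u (t : k) : autA := translation (fun l => t * (l == i)%:R).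
  have L1 := line_ringed (1 : {poly k}).
  have one0 (t : k) : (1 : {poly k}).[t] != 0 by rewrite hornerC oner_neq0.
  apply: (conj_vel_regular (b0 := 1) (u := u) d) => //.
  - apply: (afam_translation L1) => j; apply: (ringed_mul L1); first exact: line_coord.
    by apply: (ringed_cst L1); exact: (kopenT (ringed_space L1)).
  - by rewrite -(translation0 k n); apply: translation_eq => j; rewrite mul0r.
  - by move=> t _; exact: jac1_if_translation.
  - move=> j; rewrite -[_ *: _]add0r.
    have H := isderD (one0 0) (isder_cst (one0 0) ('X_j : poly)) (isder_id (one0 0) ((j == i)%:R *: 1)).
    apply: (isder_eq (one0 0) H) => t _.
    by rewrite translationE mpolyCM mul_mpolyC -[_%:MP]mulr1 mul_mpolyC.
exists (fun g => \matrix_(l, i) X i l g); split.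
  by move=> l i; under eq_fun do rewrite mxE; have [] := XP i.
move=> f Sf Cf; apply/matrixP => l i; rewrite !mxE; have [_ ->//] := XP i.
by rewrite conj_vel_unit comp_mpoly1 mulr1.
Qed.

Lemma det_inverse_jacobian (f : autA) :
  \det (\matrix_(l < n, i < n) ((tnth f.2 l)^`M(i) \mPo f.1)) = (jac f^-1%g : k)%:MP.
Proof.
have <- : jacobian f.2 \mPo f.1 = (jac f^-1%g : k)%:MP.
  by rewrite (jacE f^-1%g) comp_mpolyC.
rewrite /jacobian -det_map_mx; congr (\det _).
by apply/matrixP => l i; rewrite !mxE.
Qed.

(** The vector [N j] is column [i j] of the inverse Jacobian matrix times the component j of [f];
    row [i j] of the adjugate turns it into that component times the determinant, which is the
    Jacobian of the inverse of [f]. To avoid a division, the Jacobian of [f] itself is read off the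
    matrix reconstructed at [g^-1]. *)
Lemma reconstruct_first d : exists F : gT -> endo,
  (forall j, rfam (G d) (fun g => tnth (F g) j)) /\
  forall f, S f -> carrier (G d) (phi f) -> F (phi f) = f.1.
Proof.
have Gr := ind_ringed Gi d; have Gs := ringed_space Gr.
have [_ _ _ invM] := Gg; have [d' vM] := invM d.
have [M [Mr ME]] := inverse_jacobian_regular d.
have [M' [Mr' ME']] := inverse_jacobian_regular d'.
have /choice[i] := scaling_curve.
move=> /choice[b0 /choice[u uP]].
have /choice[N NP] j : exists X : 'I_n -> gT -> poly, (forall l, rfam (G d) (X l)) /\
    forall f l, S f -> carrier (G d) (phi f) ->
      X l (phi f) = conj_vel (fun l => (l == i j)%:R *: 'X_j) f l.
  by have [[b00 uL] u0 uS uw] := uP j; exact: (conj_vel_regular d b00 uL u0 uS uw).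
exists (fun g => [tuple (\det (M' g^-1%g))@_0 *: \sum_l (\adj (M g)) (i j) l * N j l g | j < n]).
split=> [j|f Sf Cf].
  under eq_fun do rewrite tnth_mktuple.
  apply: (rfam_scale Gr).
    have [_ H] := rfam_pull Gs vM (rfam_det (ind_ringed Gi d') Mr').
    exact: H.
  apply: (rfam_sum Gr) => l; apply: (rfam_mul Gr); first exact: (rfam_adj Gr).
  by have [] := NP j.
have Cf' : carrier (G d') (phi f^-1%g).
  by rewrite phi_V //; have [vC _ _] := vM; exact: vC.
apply/eq_from_tnth => j; rewrite tnth_mktuple -phi_V // ME' //; last exact: SV.
rewrite (det_inverse_jacobian f^-1%g) invgK mpolyCK ME //.
set A := \matrix_(_, _) _.
rewrite (eq_bigr (fun l => (\adj A) (i j) l * A l (i j) * tnth f.1 j)); last first.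
  move=> l _; have [_ ->//] := NP j.
  by rewrite conj_vel_unit comp_mpolyXU -tnth_nth mulrA /A mxE.
rewrite -mulr_suml.
have -> : \sum_l (\adj A) (i j) l * A l (i j) = \det A.
  by have := congr1 (fun B : 'M_n => B (i j) (i j)) (mul_adj_mx A); rewrite !mxE eqxx.
rewrite det_inverse_jacobian mul_mpolyC scalerA jacV /= mulfV ?scale1r //.
exact: (kstar_neq0 (jac f)).
Qed.

Lemma closed_immersion_nontrivial_translation :
  closed_immersion (ind_sub (Aut k n) S) G phi.
Proof.
have full d : exists F1 F2 : gT -> endo,
  [/\ forall j, rfam (G d) (fun g => tnth (F1 g) j),
      forall j, rfam (G d) (fun g => tnth (F2 g) j)
    & forall f, S f -> carrier (G d) (phi f) -> F1 (phi f) = f.1 /\ F2 (phi f) = f.2].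
  have [_ _ _ invM] := Gg; have [d' vM] := invM d.
  have [F1 [F1r F1E]] := reconstruct_first d; have [F2 [F2r F2E]] := reconstruct_first d'.
  (* The second component of [f] is the first component of [f^-1], read off at [g^-1]. *)
  exists F1, (fun g => F2 g^-1%g); split => // [j|f Sf Cf].
    exact: (rfam_pull (ind_kspace Gi d) vM (F2r j)).
  rewrite F1E // -phi_V // F2E //; first exact: SV.
  by rewrite phi_V //; have [vC _ _] := vM; exact: vC.
apply: (closed_immersion_reconstruct Gg phiM phiD) => d.
  have [F1 [F2 [F1r F2r FE]]] := full d.
  have /choice[D1 D1P] j := proj1 (F1r j); have /choice[D2 D2P] j := proj1 (F2r j).
  exists (\max_j maxn (D1 j) (D2 j))%N => f Sf Cf; apply/Aut_carrier => j.
  have := leq_bigmax (F := fun j => maxn (D1 j) (D2 j)) j; rewrite geq_max => /andP[h1 h2].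
  have [e1 e2] := FE f Sf Cf; rewrite -e1 -e2.
  by split; apply/leqW; [exact: leq_trans (D1P j _ Cf) h1|exact: leq_trans (D2P j _ Cf) h2].
move=> C1; have [F1 [F2 [F1r F2r FE]]] := full d.
have Gs := ind_kspace Gi d; have Us := kinduced_kspace (carrier (G d)) id Gs.
have iM := ksub_incl (carrier (G d)) Gs.
exists (carrier (G d)), F1, F2; split => //; split => //.
- exact: kopenT.
- by move=> j; exact: (rfam_pull Us iM (F1r j)).
- by move=> j; exact: (rfam_pull Us iM (F2r j)).
Qed.

End Reconstruction.

(** * Divergence-free vector fields *)

Section LinearSpaces.
Variables (k : fieldType) (n : nat).
Hypothesis k0 : [pchar k] =i pred0.
Local Notation poly := {mpoly k[n]}.

Lemma subspace_sum (W : set ('I_n -> poly)) (J : Type) (r : seq J) (P : pred J) (a : J -> k) Y :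
  W (fun=> 0) -> (forall X Z, W X -> W Z -> W (fun l => X l + Z l)) ->
  (forall c X, W X -> W (fun l => c *: X l)) -> (forall j, P j -> W (Y j)) ->
  W (fun l => \sum_(j <- r | P j) a j *: Y j l).
Proof.
move=> W0 WD WZ WY; elim: r => [|j r IHr].
  by rewrite (_ : (fun l => _) = fun=> 0) //; apply: funext => l; rewrite big_nil.
have [Pj|Pj] := boolP (P j).
  rewrite (_ : (fun l => _) = fun l => a j *: Y j l + \sum_(j <- r | P j) a j *: Y j l).
    by apply: WD => //; apply: WZ; exact: WY.
  by apply: funext => l; rewrite big_cons Pj.
rewrite (_ : (fun l => _) = fun l => \sum_(j <- r | P j) a j *: Y j l) //.
by apply: funext => l; rewrite big_cons (negPf Pj).
Qed.

(** Finiteness replaces a limit argument. By the degree bound the [R t] span a finite-dimensional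
    space, so all of them are combinations of finitely many [R (t0 r)] with coefficients regular in
    [t]; differentiating the coefficients expresses [Q] by the same [R (t0 r)]. *)
Lemma subspace_deriv (W : set ('I_n -> poly)) (R : k -> 'I_n -> poly) Q :
  W (fun=> 0) -> (forall X Z, W X -> W Z -> W (fun l => X l + Z l)) ->
  (forall c X, W X -> W (fun l => c *: X l)) ->
  (forall t, W (R t)) -> (forall l, isder 1 0 (fun t => R t l) (Q l)) -> W Q.
Proof.
move=> W0 WD WZ WR RQ.
have one0 (t : k) : (1 : {poly k}).[t] != 0 by rewrite hornerC oner_neq0.
have Lr := line_ringed (1 : {poly k}); have oL := kopenT (ringed_space Lr).
have /choice[d dP] l : exists d, forall t, (msize (R t l) <= d)%N.
  by have [[[d dP] _] _ _] := RQ l; exists d => t; apply: dP; exact/line_carrier.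
set D := (\max_l d l)%N.
have RD t l : (msize (R t l) <= D)%N by apply: leq_trans (dP l t) (leq_bigmax l).
pose C : finType := ('I_n * 'X_{1..n < D})%type.
pose ev (i : 'I_#|{: C}|) : 'I_n * 'X_{1..n < D} := enum_val i.
pose row t : 'rV[k]_#|{: C}| := \row_i (R t (ev i).1)@_((ev i).2).
have [q [t0 [B [_ rowE]]]] := linear_recovery row setT.
pose c r t := (row t *m B) ord0 r.
have RE t l : R t l = \sum_r c r t *: R (t0 r) l.
  apply/mpolyP => m; rewrite raddf_sum /=.
  have [md|md] := ltnP (mdeg m) D; last first.
    have R0 u : (R u l)@_m = 0 by apply/memN_msupp_eq0/msize_mdeg_ge/(leq_trans _ md).
    by rewrite R0 big1 // => r _; rewrite mcoeffZ R0 mulr0.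
  have := congr1 (fun v : 'rV_ _ => v ord0 (enum_rank ((l, BMultinom md) : C))) (rowE t Logic.I).
  rewrite /= summxE mxE /ev enum_rankK /= => ->; apply: eq_bigr => r _.
  by rewrite mcoeffZ mxE [in X in _ * X]mxE /ev enum_rankK.
pose dc r := \sum_i (Q (ev i).1)@_((ev i).2) * B i r.
have cr r : kreg (line 1) (carrier (line 1)) (c r).
  rewrite /c; under eq_fun do rewrite mxE.
  apply: (ringed_sum Lr) => // i; under eq_fun do rewrite mxE.
  apply: (ringed_mul Lr); last exact: (ringed_cst Lr).
  by have [[_ H] _ _] := RQ (ev i).1; exact: H.
have cd r : hasder 0 (c r) (dc r).
  rewrite /c; under eq_fun do rewrite mxE; apply: hasder_sum => i.
  under eq_fun do rewrite mxE.
  have [_ _ H] := RQ (ev i).1.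
  have := hasderM (H (ev i).2) (hasder_cst 0 (B i r)).
  by rewrite mulr0 addr0.
have QE l : Q l = \sum_r dc r *: R (t0 r) l.
  have H := isder_sum (one0 0) (index_enum 'I_q) predT (fun r => isder_coef (one0 0) (R (t0 r) l) (cr r) (cd r)).
  apply: (isder_unique k0 (RQ l)).
  by apply: (isder_eq (one0 0) H) => t _; rewrite [RHS]RE.
rewrite (_ : Q = fun l => \sum_r dc r *: R (t0 r) l); last exact: funext.
by apply: subspace_sum.
Qed.

(** At the identity matrix the derivative of the determinant is the trace: a permutation other than
    the identity moves at least two points, so its product contains two factors that vanish at
    [s]. *)
Lemma isder_det (b : {poly k}) s d (A : k -> 'M[poly]_d) (A' : 'M[poly]_d) :
  b.[s] != 0 -> (forall i j, isder b s (fun t => A t i j) (A' i j)) ->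
  A s = 1%:M -> isder b s (fun t => \det (A t)) (\sum_i A' i i).
Proof.
move=> bs AA A1; pose P (p : 'S_d) : poly := if p == 1%g then \sum_i A' i i else 0.
have -> : \sum_i A' i i = \sum_(p : 'S_d) (-1) ^+ p * P p.
  rewrite (bigD1 (1%g : {perm 'I_d})) //= [X in _ + X]big1 ?addr0 => [|p p1].
    by rewrite /P eqxx odd_perm1 expr0 mul1r.
  by rewrite /P (negPf p1) mulr0.
rewrite /determinant; apply: (isder_sum bs) => p.
have prodd : isder b s (fun t => \prod_i A t i (p i)) (P p).
  rewrite /P; have [->|p1] := eqVneq p 1%g.
    have H : isder b s (fun t => \prod_i A t i i) (\sum_i A' i i) /\ \prod_i A s i i = 1.
      elim: (index_enum _) => [|i r [IH1 IH2]].
        by split; last (by rewrite big_nil); under eq_fun do rewrite big_nil;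
           rewrite big_nil; exact: isder_cst.
      split; last by rewrite big_cons IH2 A1 mxE eqxx mulr1.
      have := isderM bs (AA i i) IH1; rewrite IH2 A1 mxE eqxx mulr1 mul1r.
      rewrite big_cons => H; apply: (isder_eq bs H) => t _; by rewrite big_cons.
    apply: (isder_eq bs (proj1 H)) => t _; apply: eq_bigr => i _; by rewrite perm1.
  have [i pi] : exists i, p i != i.
    apply: contrapT => H; case/eqP: p1; apply/permP => i; rewrite perm1.
    by apply/eqP/negPn/negP => pi; apply: H; exists i.
  have ppi : p (p i) != p i by rewrite (inj_eq perm_inj).
  have /choice[R RP] (j : 'I_d) : exists R, isder b s (fun t => \prod_(l | (l != i) && (l != p i)) A t l (p l)) R.
    apply: (isder_ex k0 bs); apply: (rfam_prod (line_ringed b)) => l.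
    by have [] := AA l (p l).
  have := isderM bs (AA i (p i)) (isderM bs (AA (p i) (p (p i))) (RP i)).
  rewrite A1 !mxE [i == _]eq_sym (negPf pi) [p i == _]eq_sym (negPf ppi).
  rewrite !(mul0r, mulr0, addr0) => H; apply: (isder_eq bs H) => t _.
  by rewrite [RHS](bigD1 i) //= [in RHS](bigD1 (p i)) //=.
have := isderM bs (isder_cst bs ((-1) ^+ p)) prodd.
by rewrite mul0r add0r.
Qed.

End LinearSpaces.

Section TrivialTranslations.
Variables (k : fieldType) (n : nat).
Hypothesis k0 : [pchar k] =i pred0.
Local Notation poly := {mpoly k[n]}.
Local Notation autA := (autA k n).
Local Notation endo := (endo k n).
Variables (gT : groupType) (G : indspace k gT).
Hypothesis Gg : is_indgroup G.
Local Notation S := (@jac1_if k n true).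
Variable phi : autA -> gT.
Hypothesis phiM : ind_morphism (ind_sub (Aut k n) S) G phi.
Hypothesis phiD : forall f g, S f -> S g -> phi (f * g)%g = (phi f * phi g)%g.
Let S1 := @jac1_if1 k n true.
Let SM := @jac1_ifM k n true.
Let SV := @jac1_ifV k n true.
Let phi_V := phiV S1 SV phiD.
Hypothesis trivial_translation : forall v, phi (translation v) = 1%g.

Let one0 (t : k) : (1 : {poly k}).[t] != 0.
Proof. by rewrite hornerC oner_neq0. Qed.

Let L1 := line_ringed (1 : {poly k}).

Definition kernel_curve (c : k -> autA) (V : 'I_n -> poly) : Prop :=
  [/\ afam (line 1) c, c 0 = 1%g, forall t, S (c t) /\ phi (c t) = 1%g
    & forall l, isder 1 0 (fun t => tnth (c t).1 l) (V l)].

Definition kernel_fields : set ('I_n -> poly) :=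
  [set Y | exists (J : finType) (a : J -> k) (c : J -> k -> autA) (V : J -> 'I_n -> poly),
     (forall j, kernel_curve (c j) (V j)) /\ Y = fun l => \sum_j a j *: V j l].

Lemma kernel_curve_field c V : kernel_curve c V -> kernel_fields V.
Proof.
move=> cV; exists unit, (fun=> 1), (fun=> c), (fun=> V); split => //.
by apply: funext => l; rewrite (big_pred1 tt) ?scale1r // => -[].
Qed.

Lemma kernel_fields0 : kernel_fields (fun=> 0).
Proof.
exists void, (fun _ => 0), (fun _ _ => 1%g), (fun _ _ => 0).
by split; [case|apply: funext => l; rewrite big_pred0].
Qed.

Lemma kernel_fieldsD X Z : kernel_fields X -> kernel_fields Z ->
  kernel_fields (fun l => X l + Z l).
Proof.
move=> [J1 [a1 [c1 [V1 [H1 ->]]]]] [J2 [a2 [c2 [V2 [H2 ->]]]]].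
exists (J1 + J2)%type.
exists (fun j => match j with inl i => a1 i | inr i => a2 i end).
exists (fun j => match j with inl i => c1 i | inr i => c2 i end).
exists (fun j => match j with inl i => V1 i | inr i => V2 i end).
by split; [case|apply: funext => l; rewrite big_sumType].
Qed.

Lemma kernel_fieldsZ c X : kernel_fields X -> kernel_fields (fun l => c *: X l).
Proof.
move=> [J [a [u [V [H ->]]]]]; exists J, (fun j => c * a j), u, V; split => //.
apply: funext => l; rewrite scaler_sumr; apply: eq_bigr => j _.
by rewrite scalerA.
Qed.

Lemma kernel_fields_sum (J : Type) (r : seq J) (P : pred J) (a : J -> k) Y :
  (forall j, P j -> kernel_fields (Y j)) ->
  kernel_fields (fun l => \sum_(j <- r | P j) a j *: Y j l).
Proof.
by apply: subspace_sum; [exact: kernel_fields0|exact: kernel_fieldsD|exact: kernel_fieldsZ].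
Qed.

Lemma kernel_fields_conj Y f : S f -> kernel_fields Y -> kernel_fields (conj_vel Y f).
Proof.
move=> Sf [J [a [u [V [H ->]]]]].
exists J, a, (fun j => conj_curve (u j) f), (fun j => conj_vel (V j) f); split.
  move=> j; have [uL u0 uS uV] := H j; split.
  - exact: conj_curve_afam.
  - exact: conj_curve0.
  - move=> t; have [Su ut] := uS t; split.
      by apply: SM => //; apply: SM => //; exact: SV.
    rewrite /conj_curve (phiD (SM (SV Sf) Su) Sf) (phiD (SV Sf) Su).
    by rewrite ut mulg1 (phi_V Sf) mulVg.
  - by move=> l; exact: conj_curve_isder.
apply: funext => l; rewrite /conj_vel.
under [RHS]eq_bigr do rewrite scaler_sumr.
rewrite exchange_big /=; apply: eq_bigr => i _.
rewrite [X in _ * X](raddf_sum (comp_mpoly f.1)) /= mulr_sumr; apply: eq_bigr => j _.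
by rewrite comp_mpolyZ scalerAr.
Qed.

Lemma translation_kernel_curve (v : 'I_n -> k) :
  kernel_curve (fun t => translation (fun l => t * v l)) (fun l => (v l)%:MP).
Proof.
split.
- apply: (afam_translation L1) => j; apply: (ringed_mul L1); first exact: line_coord.
  by apply: (ringed_cst L1); exact: (kopenT (ringed_space L1)).
- by rewrite -(translation0 k n); apply: translation_eq => j; rewrite mul0r.
- by move=> t; split => //; exact: jac1_if_translation.
- move=> l; rewrite -[_%:MP]add0r.
  have H := isderD (one0 0) (isder_cst (one0 0) ('X_l : poly)) (isder_id (one0 0) ((v l)%:MP)).
  by apply: (isder_eq (one0 0) H) => t _; rewrite translationE mpolyCM mul_mpolyC.
Qed.

(** If P is free of x_i and d_j P = x^m, the pullback of d_j along x_i |-> x_i + P is d_j - x^m d_i,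
    and d_j is in the space as well. Such a P is the antiderivative of x^m in a variable x_j that
    divides it; for m = 0 the field is constant. *)
Lemma kernel_fields_free (i : 'I_n) (m : 'X_{1..n}) : m i = 0%N ->
  kernel_fields (fun l => (l == i)%:R *: 'X_[m]).
Proof.
move=> mi; have cst j : kernel_fields (fun l => (l == j)%:R *: 1).
  have := kernel_curve_field (translation_kernel_curve (fun l => (l == j)%:R)).
  by congr kernel_fields; apply: funext => l; rewrite -mul_mpolyC mulr1.
have [->|m0] := eqVneq m 0%MM; first by rewrite mpolyX0.
have [j mj] : exists j, m j != 0%N.
  apply: contrapT => H; case/eqP: m0; apply/mnmP => j; rewrite mnm0E.
  by apply/eqP/negPn/negP => mj; apply: H; exists j.
have ji : j != i by apply: contraNneq mj => ->; rewrite mi.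
pose P : poly := (m j).+1%:R^-1 *: 'X_[m + U_(j)].
have fP : free_of i P.
  by apply/free_ofZ/free_ofX; rewrite mnmDE mi mnm1E (negPf ji).
have dP : P^`M(j) = 'X_[m].
  rewrite mderivZ mderivX mnmDE mnm1E eqxx addn1 addmK scalerA mulVf ?scale1r //.
  exact: natr_neq0.
have := kernel_fields_conj (jac1_if_elem fP) (cst j).
move=> /(kernel_fieldsZ (-1)) /(kernel_fieldsD (cst j)).
congr kernel_fields; apply: funext => l.
rewrite conj_vel_unit comp_mpoly1 mulr1 elem_aut2E // mderivB mderivXU mderivZ dP.
rewrite comp_mpolyB comp_mpolyZ (free_ofX mi) => [|l' /negPf l'i]; last first.
  by rewrite elem_aut1E // l'i scale0r addr0.
by rewrite rmorph_nat scaleN1r opprB [X in X + _]scaler_nat addrC subrK.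
Qed.

Lemma mderiv_free (i j : 'I_n) (m : 'X_{1..n}) : m i = 0%N ->
  free_of i (('X_[m] : poly)^`M(j)).
Proof.
move=> mi; rewrite mderivX; apply/free_ofZ/free_ofX.
by rewrite mnmBE mi sub0n.
Qed.

(** For a monomial write x^m = m1 m2 with m1 a power of x_i and m2 free of x_i. Pulling back m1 d_j
    along x_i |-> x_i + t m2 and differentiating at t = 0 gives (d_i m1) m2 d_j - m1 (d_j m2) d_i,
    which is the required field; [subspace_deriv] keeps this derivative in the space. *)
Lemma kernel_fields_curl (i j : 'I_n) (p : poly) : i != j ->
  kernel_fields (fun l => (l == j)%:R *: p^`M(i) - (l == i)%:R *: p^`M(j)).
Proof.
move=> ij.
have mon (m : 'X_{1..n}) : kernel_fields
    (fun l => (l == j)%:R *: 'X_[m]^`M(i) - (l == i)%:R *: 'X_[m]^`M(j)).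
  pose m1 : 'X_{1..n} := (U_(i) *+ m i)%MM; pose m2 := (m - m1)%MM.
  have m1i : m1 i = m i by rewrite mulmnE mnm1E eqxx mul1n.
  have m1j : m1 j = 0%N by rewrite mulmnE mnm1E (negPf ij) mul0n.
  have m2i : m2 i = 0%N by rewrite mnmBE m1i subnn.
  have mE : 'X_[m] = 'X_[m1] * 'X_[m2] :> poly.
    rewrite -mpolyXD addmC submK //; apply/mnm_lepP => l; rewrite mulmnE mnm1E.
    by have [<-|_] := eqVneq i l; rewrite ?mul1n ?mul0n.
  have d1 : ('X_[m1] : poly)^`M(j) = 0 by apply: free_of_deriv; exact: free_ofX.
  have d2 : ('X_[m2] : poly)^`M(i) = 0 by apply: free_of_deriv; exact: free_ofX.
  have f2 : free_of i ('X_[m2] : poly) by exact: free_ofX.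
  have f2t (t : k) := free_ofZ t f2.
  pose f (t : k) := elem_aut i (t *: ('X_[m2] : poly)).
  have fg t l : l != i -> tnth (f t).1 l = 'X_l.
    by move=> /negPf li; rewrite elem_aut1E // li scale0r addr0.
  pose R (t : k) (l : 'I_n) : poly :=
    ((l == j)%:R - t *: ((l == i)%:R *: 'X_[m2]^`M(j))) * ('X_[m1] \mPo (f t).1).
  apply: (subspace_deriv k0 kernel_fields0 kernel_fieldsD kernel_fieldsZ (R := R)).
    move=> t; have := kernel_fields_conj (jac1_if_elem (f2t t)) (kernel_fields_free m1j).
    congr kernel_fields; apply: funext => l; rewrite conj_vel_unit elem_aut2E //.
    rewrite mderivB mderivXU mderivZ mderivZ comp_mpolyB !comp_mpolyZ rmorph_nat.
    rewrite (mderiv_free _ m2i) //; last exact: fg.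
    by rewrite /R; congr ((_ - _) * _); rewrite !scalerA mulrC.
  move=> l.
  have gd l' : isder 1 0 (fun t => tnth (f t).1 l') ((l' == i)%:R *: 'X_[m2]).
    rewrite -[_ *: _]add0r.
    have H := isderD (one0 0) (isder_cst (one0 0) ('X_l' : poly)) (isder_id (one0 0) ((l' == i)%:R *: 'X_[m2])).
    apply: (isder_eq (one0 0) H) => t _.
    by rewrite elem_aut1E // !scalerA mulrC.
  have H1 := isder_comp_cst (one0 0) 'X_[m1] gd.
  have H2 := isderD (one0 0) (isder_cst (one0 0) ((l == j)%:R : poly))
    (isderZ (one0 0) (-1) (isder_id (one0 0) ((l == i)%:R *: ('X_[m2] : poly)^`M(j)))).
  have := isderM (one0 0) H2 H1.
  have f0 : (f 0).1 = endo_id k n.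
    apply/eq_from_tnth => l'; rewrite elem_aut1E ?scale0r ?scaler0 ?addr0 ?tnth_mktuple //.
    by rewrite -[0](scale0r ('X_[m2] : poly)).
  rewrite f0 comp_mpoly_id (bigD1 i) //= big1 ?addr0 => [|l' /negPf ->]; last first.
    by rewrite scale0r mulr0.
  rewrite eqxx scale1r comp_mpoly_id !scale0r scaler0 addr0 add0r.
  move=> H; apply: (isder_eq (one0 0) (p := fun t => ((l == j)%:R +
      -1 *: (t *: ((l == i)%:R *: 'X_[m2]^`M(j)))) * ('X_[m1] \mPo (f t).1))); last first.
    by move=> t _; rewrite /R scaleN1r.
  move: H; congr isder.
  rewrite mE !mderivM d1 d2 mulr0 addr0 mul0r add0r scaleN1r addrC; congr (_ + _).
    by rewrite mulr_natl scaler_nat.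
  by rewrite mulNr -scalerAl [X in _ *: X]mulrC.
rewrite (_ : (fun l => _) = fun l => \sum_(m <- msupp p) p@_m *:
   ((l == j)%:R *: 'X_[m]^`M(i) - (l == i)%:R *: 'X_[m]^`M(j))).
  by apply: kernel_fields_sum => m _; exact: mon.
apply: funext => l; rewrite {1 2}(mpolyE p) !(raddf_sum (mderiv _)) /= !scaler_sumr -sumrB.
apply: eq_bigr => m _; rewrite !mderivZ scalerBr !scalerA.
by rewrite mulrC [_ * p@_m]mulrC.
Qed.

End TrivialTranslations.

(** * Triviality on automorphisms of Jacobian 1 *)

Section TrivialOnSAut.
Variables (k : fieldType) (n : nat).
Hypothesis k0 : [pchar k] =i pred0.
Local Notation poly := {mpoly k[n]}.
Local Notation autA := (autA k n).
Local Notation endo := (endo k n).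

Definition primitive (i : 'I_n) (p : poly) : poly :=
  \sum_(m <- msupp p) (p@_m / (m i).+1%:R) *: 'X_[m + U_(i)].

Lemma primitiveE i p : (primitive i p)^`M(i) = p.
Proof.
rewrite [RHS](mpolyE p) /primitive (raddf_sum (mderiv i)) /=; apply: eq_bigr => m _.
rewrite mderivZ mderivX mnmDE mnm1E eqxx addn1 addmK scalerA divfK //.
exact: natr_neq0.
Qed.

Lemma free_of_mderiv0 i (q : poly) m : q^`M(i) = 0 -> m \in msupp q -> m i = 0%N.
Proof.
move=> q0 mq; apply: contraTeq mq => mi; rewrite mcoeff_msupp negbK.
have /eqP := congr1 (mcoeff (m - U_(i))%MM) q0.
rewrite mcoeff0 mcoeff_deriv submK ?lep1mP // -mulr_natr mulf_eq0.
by rewrite (negPf (natr_neq0 k0 _)) orbF.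
Qed.

(** The Jacobian determinant is constant along the curve, and its derivative at the identity is the
    trace of the Jacobian matrix of [V], which is the divergence. *)
Lemma velocity_div_free (b : {poly k}) s (c : k -> autA) (V : 'I_n -> poly) :
  b.[s] != 0 -> c s = 1%g -> (forall t, b.[t] != 0 -> jac (c t) = 1%g) ->
  (forall l, isder b s (fun t => tnth (c t).1 l) (V l)) ->
  \sum_l (V l)^`M(l) = 0.
Proof.
move=> bs cs cj cV; pose A t : 'M[poly]_n := \matrix_(i, j) (tnth (c t).1 i)^`M(j).
pose A' : 'M[poly]_n := \matrix_(i, j) (V i)^`M(j).
have AA i j : isder b s (fun t => A t i j) (A' i j).
  have -> : A' i j = (V i)^`M(j) by rewrite mxE.
  apply: (isder_eq bs (isder_deriv bs j (cV i))) => t _.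
  by rewrite mxE.
have A1 : A s = 1%:M.
  by apply/matrixP => i j; rewrite !mxE cs autA_one1E mderivXU.
have := isder_det k0 bs AA A1; under eq_bigr do rewrite mxE.
move=> H; apply: (isder_unique k0 H); apply: (isder_eq bs (isder_cst bs 1)) => t bt.
by rewrite -[RHS]/(jacobian (c t).1) jacE cj // mpolyC1.
Qed.

Variables (gT : groupType) (G : indspace k gT).
Hypothesis Gg : is_indgroup G.
Let Gi := indgroup_ind Gg.
Local Notation S := (@jac1_if k n true).
Variable phi : autA -> gT.
Hypothesis phiM : ind_morphism (ind_sub (Aut k n) S) G phi.
Hypothesis phiD : forall f g, S f -> S g -> phi (f * g)%g = (phi f * phi g)%g.
Let S1 := @jac1_if1 k n true.
Let SM := @jac1_ifM k n true.
Let SV := @jac1_ifV k n true.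
Let phi_1 := phi1 S1 phiD.
Hypothesis trivial_translation : forall v, phi (translation v) = 1%g.
Local Notation kfields := (kernel_fields phi).

Let one0 (t : k) : (1 : {poly k}).[t] != 0.
Proof. by rewrite hornerC oner_neq0. Qed.

Let L1 := line_ringed (1 : {poly k}).

(** With P_j an antiderivative of Y_j in x_i, the field Y is the sum over j other than i of d_i P_j
    d_j - d_j P_j d_i, plus q d_i, where q is Y_i plus the sum of the d_j P_j. Zero divergence of Y
    says that d_i q = 0, so the last term is a combination of monomial fields free of x_i. *)
Lemma div_free_kernel_fields (i : 'I_n) (Y : 'I_n -> poly) :
  \sum_l (Y l)^`M(l) = 0 -> kfields Y.
Proof.
move=> Y0; pose P j := primitive i (Y j).
pose q := Y i + \sum_(j | j != i) (P j)^`M(j).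
have q0 : q^`M(i) = 0.
  rewrite mderivD (raddf_sum (mderiv i)) /= -[RHS]Y0 [RHS](bigD1 i) //=; congr (_ + _).
  by apply: eq_bigr => j _; rewrite mderiv_comm primitiveE.
have K1 : kfields (fun l => \sum_(m <- msupp q | m i == 0%N) q@_m *: ((l == i)%:R *: 'X_[m])).
  apply: kernel_fields_sum => m /eqP mi.
  exact: (kernel_fields_free k0 phiD trivial_translation).
have K2 : kfields (fun l => \sum_(j | j != i) 1 *: ((l == j)%:R *: (P j)^`M(i) - (l == i)%:R *: (P j)^`M(j))).
  apply: kernel_fields_sum => j ji.
  by apply: (kernel_fields_curl k0 phiD trivial_translation); rewrite eq_sym.
have := kernel_fieldsD K1 K2; congr kernel_fields; apply: funext => l.
have -> : \sum_(m <- msupp q | m i == 0%N) q@_m *: ((l == i)%:R *: 'X_[m]) = (l == i)%:R *: q.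
  rewrite {3}(mpolyE q) scaler_sumr big_seq_cond [RHS]big_seq; apply: eq_big => m.
    by case mq: (m \in msupp q) => //=; rewrite (free_of_mderiv0 q0 mq).
  by move=> _; rewrite !scalerA mulrC.
under eq_bigr do rewrite scale1r; rewrite sumrB -scaler_sumr.
have [->|li] := eqVneq l i.
  rewrite !scale1r big1 => [|j ji]; last by rewrite eq_sym (negPf ji) scale0r.
  by rewrite sub0r /q addrK.
rewrite !scale0r add0r subr0 (bigD1 l) //= eqxx scale1r primitiveE big1 ?addr0 //.
by move=> j /andP[_ jl]; rewrite eq_sym (negPf jl) scale0r.
Qed.

(** Moved to the identity at [s], the curve has a divergence-free velocity, hence one that is a
    combination of velocities of curves in the kernel. By [velocity_relation] the image curve has
    zero velocity. *)
Lemma phi_curve_const (i0 : 'I_n) (b : {poly k}) (c : k -> autA) : afam (line b) c ->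
  (forall t, b.[t] != 0 -> S (c t)) ->
  forall s t, b.[s] != 0 -> b.[t] != 0 -> phi (c s) = phi (c t).
Proof.
move=> cL cS; apply: (const_phi k0 Gg S1 SM SV phiM phiD cL cS).
move=> s m W h bs dM hW W1.
pose d t : autA := ((c s)^-1 * c t)%g.
have Lb := line_ringed b.
have dL : afam (line b) d by apply: (afam_mul Lb) => //; exact: afam_cst.
have ds : d s = 1%g by rewrite /d mulVg.
have dS t : b.[t] != 0 -> S (d t).
  by move=> bt; apply: SM; [apply: SV; exact: cS|exact: cS].
have [V dV] := afam_line k0 bs dL.
have V0 : \sum_l (V l)^`M(l) = 0.
  by apply: (velocity_div_free bs ds _ dV) => t bt; exact: dS.
have [J [a [u [U [uK VE]]]]] := div_free_kernel_fields i0 V0.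
pose a' (j : J + unit) := match j with inl i => a i | inr _ => - 1 end.
pose b' (j : J + unit) := match j with inl i => 1 | inr _ => b end.
pose s' (j : J + unit) := match j with inl i => 0 | inr _ => s end.
pose c' (j : J + unit) := match j with inl i => u i | inr _ => d end.
pose V' (j : J + unit) := match j with inl i => U i | inr _ => V end.
have C1 : carrier (G m) 1%g.
  by apply: (kopen_sub (ind_kspace Gi m)) W1; exact: (kreg_open (ind_kspace Gi m) hW).
have := @velocity_relation k n k0 gT G S phi _ a' b' s' c' V' Gi phiM S1.
move=> /(_ _ _ _ _ _ _ m W h).
have -> : \sum_j a' j * der (s' j) (h \o phi \o c' j) = - der s (fun t => h (phi (d t))).
  rewrite big_sumType /= (big_pred1 tt) => [|[] //]; rewrite mulN1r big1 ?add0r // => j _.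
  have [_ _ uP _] := uK j.
  have -> : (h \o phi \o u j) = fun=> h 1%g.
    by apply: funext => t /=; have [_ ->] := uP t.
  by rewrite (derE k0 (hasder_cst 0 _)) mulr0.
move=> H; apply/eqP; rewrite -oppr_eq0; apply/eqP; apply: H.
- by case=> [j|j] //=; have [] := uK j.
- by case=> [j t _|j t bt] /=; [have [_ _ /(_ t)[]] := uK j|exact: dS].
- by case=> [j|j] /=; [exact: one0|exact: bs].
- by case=> [j|j] /=; [have [] := uK j|exact: ds].
- by case=> [j|j] l /=; [have [_ _ _] := uK j; apply|exact: dV].
- by move=> l; rewrite big_sumType /= (big_pred1 tt) => [|[] //]; rewrite scaleN1r VE subrr.
- case=> [j|j] /=; last exact: dM.
  apply: (kmorphism_eq (ringed_space L1) (kmorphism_cst L1 C1)) => t _ /=.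
  by have [_ _ /(_ t)[_ ->]] := uK j.
- exact: hW.
- by rewrite phi_1.
Qed.

(* The coefficients of [s^-1 p(s x)], for [p] without constant term. *)
Definition dilate (s : k) (p : poly) : poly :=
  \sum_(m <- msupp p) (p@_m * s ^+ (mdeg m).-1) *: 'X_[m].

Lemma mcoeff_dilate s p m : (dilate s p)@_m = p@_m * s ^+ (mdeg m).-1.
Proof.
rewrite /dilate raddf_sum /=; have [mp|mp] := boolP (m \in msupp p); last first.
  rewrite memN_msupp_eq0 // mul0r big_seq big1 // => m' mp'.
  rewrite mcoeffZ mcoeffX (_ : _ == m = false) ?mulr0 //.
  by apply: contraNF mp => /eqP <-.
rewrite (bigD1_seq m) ?msupp_uniq //= mcoeffZ mcoeffX eqxx mulr1 big1 ?addr0 //.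
by move=> m' /negPf mm'; rewrite mcoeffZ mcoeffX mm' mulr0.
Qed.

Lemma dilate1 p : dilate 1 p = p.
Proof. by apply/mpolyP => m; rewrite mcoeff_dilate expr1n mulr1. Qed.

Definition homothety (s : k) : endo := [tuple s *: 'X_i | i < n].

Lemma dilateE s p : p@_0 = 0 -> s *: dilate s p = p \mPo homothety s.
Proof.
move=> p0; rewrite {2}(mpolyE p) (raddf_sum (comp_mpoly (homothety s))) /=.
rewrite /dilate scaler_sumr !big_seq.
apply: eq_bigr => m mp; have m0 : m != 0%MM.
  by apply: contraTneq mp => ->; rewrite mcoeff_msupp p0 eqxx.
rewrite comp_mpolyZ comp_mpolyX scalerA mulrCA -exprS prednK; last first.
  by rewrite lt0n mdeg_eq0.
under eq_bigr do rewrite tnth_mktuple exprZn.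
rewrite scaler_prod mpolyXE_id -scalerA; congr (_ *: (_ *: _)).
by rewrite mdegE expr_sum.
Qed.

Lemma rfam_dilate p : rfam (line 1) (fun s => dilate s p).
Proof.
apply: (rfam_sum L1) => m; apply: (rfam_coef L1); apply: (ringed_mul L1).
  by apply: (ringed_cst L1); exact: (kopenT (ringed_space L1)).
by apply: (ringed_exp L1); exact: line_coord.
Qed.

Lemma rfam_dense (p q : k -> poly) : rfam (line 1) p -> rfam (line 1) q ->
  (forall s, s != 0 -> p s = q s) -> p 0 = q 0.
Proof.
move=> [_ pr] [_ qr] pq; apply/mpolyP => m; apply/eqP; rewrite -subr_eq0; apply/eqP.
apply: (line_dense k0 (ringed_sub L1 (pr m) (qr m)) (one0 0)) => t _ t0.
by rewrite pq // subrr.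
Qed.

Section Contraction.
Variable f : autA.
Hypotheses (f0 : forall i, (tnth f.1 i)@_0 = 0) (f0' : forall i, (tnth f.2 i)@_0 = 0).
Hypothesis Sf : S f.

Let g1 s : endo := [tuple dilate s (tnth f.1 i) | i < n].
Let g2 s : endo := [tuple dilate s (tnth f.2 i) | i < n].

Let rfam_g1 i : rfam (line 1) (fun s => tnth (g1 s) i).
Proof.
apply: (rfam_eq L1 (rfam_dilate (tnth f.1 i))) => s _; by rewrite tnth_mktuple.
Qed.

Let rfam_g2 i : rfam (line 1) (fun s => tnth (g2 s) i).
Proof.
apply: (rfam_eq L1 (rfam_dilate (tnth f.2 i))) => s _; by rewrite tnth_mktuple.
Qed.

Lemma dilate_comp (p q : endo) s : endo_comp p q = endo_id k n ->
  (forall i, (tnth p i)@_0 = 0) -> (forall i, (tnth q i)@_0 = 0) -> s != 0 ->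
  endo_comp [tuple dilate s (tnth p i) | i < n] [tuple dilate s (tnth q i) | i < n]
    = endo_id k n.
Proof.
move=> pq p0 q0 s0; apply/eq_from_tnth => i; rewrite endo_compE tnth_mktuple.
apply: (scalerI s0); rewrite -comp_mpolyZ dilateE // comp_mpoly_comp.
have -> : endo_comp (homothety s) [tuple dilate s (tnth q i) | i < n] = endo_comp q (homothety s).
  apply/eq_from_tnth => j; rewrite !endo_compE tnth_mktuple comp_mpolyZ comp_mpolyXU.
  by rewrite -tnth_nth tnth_mktuple dilateE.
rewrite -comp_mpoly_comp -endo_compE pq !tnth_mktuple comp_mpolyXU -tnth_nth.
by rewrite tnth_mktuple.
Qed.

Let g12 s : endo_comp (g1 s) (g2 s) = endo_id k n.
Proof.
have H s' : s' != 0 -> endo_comp (g1 s') (g2 s') = endo_id k n.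
  by move=> s0; apply: dilate_comp => //; exact: autAr.
(* Conjugation by a homothety needs a nonzero [s]; the identity extends to 0 because both sides are
   families in [s]. *)
have [->|] := eqVneq s 0; last exact: H.
apply/eq_from_tnth => i; rewrite endo_compE.
apply: (rfam_dense (p := fun s => tnth (g1 s) i \mPo g2 s) (q := fun=> tnth (endo_id k n) i)).
- exact: (rfam_comp L1).
- exact: (rfam_cst L1).
- by move=> s' /H <-; rewrite endo_compE.
Qed.

Let g21 s : endo_comp (g2 s) (g1 s) = endo_id k n.
Proof.
have H s' : s' != 0 -> endo_comp (g2 s') (g1 s') = endo_id k n.
  by move=> s0; apply: dilate_comp => //; exact: autAl.
have [->|] := eqVneq s 0; last exact: H.
apply/eq_from_tnth => i; rewrite endo_compE.
apply: (rfam_dense (p := fun s => tnth (g2 s) i \mPo g1 s) (q := fun=> tnth (endo_id k n) i)).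
- exact: (rfam_comp L1).
- exact: (rfam_cst L1).
- by move=> s' /H <-; rewrite endo_compE.
Qed.

Let jac_g1 s : jacobian (g1 s) = 1.
Proof.
have H s' : s' != 0 -> jacobian (g1 s') = 1.
  move=> s0; have -> : jacobian (g1 s') = jacobian f.1 \mPo homothety s'.
    rewrite /jacobian -det_map_mx; congr (\det _); apply/matrixP => i j; rewrite !mxE.
    apply: (scalerI s0); rewrite -mderivZ tnth_mktuple dilateE // mderiv_comp.
    rewrite (bigD1 j) //= tnth_mktuple mderivZ mderivXU eqxx big1 ?addr0 => [|l /negPf lj].
      by rewrite -scalerAr mulr1.
    by rewrite tnth_mktuple mderivZ mderivXU lj scaler0 mulr0.
  by rewrite jacE Sf // mpolyC1 comp_mpoly1.
have [->|] := eqVneq s 0; last exact: H.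
apply: (rfam_dense (p := fun s => jacobian (g1 s)) (q := fun=> 1)) => //; last exact: (rfam_cst L1).
apply: (rfam_det L1 (A := fun s => \matrix_(i < n, j < n) (tnth (g1 s) i)^`M(j))) => i j.
by apply: (rfam_eq L1 (rfam_deriv L1 j (rfam_g1 i))) => t _; rewrite mxE.
Qed.

Let c_subproof s : (endo_comp (g1 s, g2 s).1 (g1 s, g2 s).2 == endo_id k n) &&
  (endo_comp (g1 s, g2 s).2 (g1 s, g2 s).1 == endo_id k n).
Proof. by rewrite /= g12 g21 !eqxx. Qed.

Let c s : autA := AutA (c_subproof s).

Lemma phi_contraction (i0 : 'I_n) : exists A : 'M[k]_n, \det A = 1 /\ phi f = phi (lin_aut A).
Proof.
pose A := \matrix_(i < n, j < n) (tnth f.1 i)@_(U_(j)).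
(* At [s = 0] the factor [0 ^+ (mdeg m).-1] is 1 in degree 1 and 0 in higher degrees, so only the
   linear part remains; there is no constant term by [f0]. *)
have E0 : (c 0).1 = lin_endo A.
  apply/eq_from_tnth => i; rewrite !tnth_mktuple; apply/mpolyP => m.
  rewrite mcoeff_dilate raddf_sum /=.
  under eq_bigr do rewrite mcoeffZ mcoeffX mxE.
  have [->|m0] := eqVneq m 0%MM.
    rewrite f0 mul0r big1 // => j _; by rewrite mnm1_eq0 mulr0.
  have [/mdeg1P[j /eqP ->]|m1] := boolP (mdeg m == 1%N).
    rewrite mdeg1 expr0 mulr1 (bigD1 j) //= eqxx mulr1 big1 ?addr0 // => l lj.
    by rewrite eq_mnm1 (negPf lj) mulr0.
  rewrite expr0n (_ : _ == 0%N = false) ?mulr0.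
    rewrite big1 // => j _; rewrite (_ : _ == m = false) ?mulr0 //.
    by apply: contraNF m1 => /eqP <-; rewrite mdeg1.
  have : mdeg m != 0%N by rewrite mdeg_eq0.
  by case: (mdeg m) m1 => [|[|]].
have dA : \det A = 1.
  apply: (can_inj (@mpolyCK n k)); rewrite -jacobian_lin -E0 /= jac_g1.
  by rewrite mpolyC1.
exists A; split => //.
have <- : c 0 = lin_aut A.
  by apply: autA_inj1; rewrite lin_aut1E // unitmxE dA unitr1.
have <- : c 1 = f.
  apply: autA_inj1; apply/eq_from_tnth => i; by rewrite tnth_mktuple dilate1.
apply: (phi_curve_const i0 (b := 1)) => //.
by move=> t _; apply/jac1_ifP => _; exact: jac_g1.
Qed.

End Contraction.

(** The determinant [P] of the segment from the identity to [A] is 1 at both ends. Dividing one row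
    by [P] gives a curve in SL_n with the same ends, defined where [P] is nonzero. *)
Lemma phi_linear (i0 : 'I_n) (A : 'M[k]_n) : \det A = 1 -> phi (lin_aut A) = 1%g.
Proof.
move=> dA.
pose L s : 'M[k]_n := (1 - s) *: 1%:M + s *: A.
pose PL : 'M[{poly k}]_n := \matrix_(i, j) ((1 - 'X) * (i == j)%:R%:P + 'X * (A i j)%:P).
pose P := \det PL.
have PE s : P.[s] = \det (L s).
  rewrite -[LHS]/(horner_eval s P) -det_map_mx; congr (\det _).
  by apply/matrixP => i j; rewrite !mxE /= /horner_eval !hornerE.
pose D s : 'rV[k]_n := \row_i (if i == i0 then P.[s]^-1 else 1).
pose B s := diag_mx (D s) *m L s.
have BE s i j : B s i j = (if i == i0 then P.[s]^-1 else 1) * L s i j.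
  by rewrite /B mul_diag_mx !mxE.
have dB s : P.[s] != 0 -> \det (B s) = 1.
  move=> Ps; rewrite det_mulmx det_diag -PE (bigD1 i0) //= mxE eqxx big1 ?mulr1.
    by rewrite mulVf.
  by move=> i /negPf ii; rewrite mxE ii.
have Lr := line_ringed P; have oP := kopenT (ringed_space Lr).
have cL : afam (line P) (fun s => lin_aut (B s)).
  apply: (afam_lin Lr) => [s /line_carrier Ps|i j].
    by rewrite unitmxE dB // unitr1.
  under eq_fun do rewrite BE !mxE.
  have := line_coord P; have := ringed_cst Lr.
  move=> cst x; apply: (ringed_mul Lr).
    case: (i == i0); last exact: cst.
    have := ringed_inv Lr (line_poly P P); congr kreg; apply/seteqP; split=> s; first by case.
    by move=> Cs; split => //; exact/line_carrier.
  apply: (ringed_add Lr); apply: (ringed_mul Lr) => //; try exact: cst.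
  by apply: (ringed_sub Lr) => //; exact: cst.
have P0 : P.[0] = 1 by rewrite PE /L subr0 scale1r scale0r addr0 det1.
have P1 : P.[1] = 1 by rewrite PE /L subrr scale0r scale1r add0r.
have := phi_curve_const i0 cL _ (s := 1) (t := 0).
rewrite P0 P1 oner_neq0.
have -> : B 0 = 1%:M.
  apply/matrixP => i j; rewrite BE P0 invr1 if_same mul1r /L subr0 scale1r scale0r.
  by rewrite addr0.
have -> : B 1 = A.
  by apply/matrixP => i j; rewrite BE P1 invr1 if_same mul1r /L subrr scale0r scale1r add0r.
rewrite lin_aut1 phi_1; apply => // t Pt _.
by apply: val_inj; apply: (etrans (jac_lin _)); rewrite ?unitmxE dB ?unitr1.
Qed.

Lemma phi_trivial (i0 : 'I_n) f : S f -> phi f = 1%g.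
Proof.
(* Translating by the opposite of the value at the origin makes the map, and with it its inverse,
   fix the origin. *)
move=> Sf; pose v i := - (tnth f.1 i)@_0.
have St w := jac1_if_translation (k := k) (n := n) (e := true) w.
pose g : autA := (translation v * f)%g.
have Sg : S g by apply: SM.
have <- : phi g = phi f by rewrite (phiD (St v) Sf) trivial_translation mul1g.
have g0 i : (tnth g.1 i)@_0 = 0.
  rewrite autA_mul1E translationE comp_mpolyD comp_mpolyXU comp_mpolyC -tnth_nth.
  by rewrite mcoeffD mcoeffC eqxx mulr1 subrr.
have meval0 (p : poly) : p@_0 = p.@[fun=> 0].
  rewrite {1}(mpolyE p) raddf_sum /= mevalE; apply: eq_bigr => m _.
  rewrite mcoeffZ mcoeffX; congr (_ * _); have [->|m0] := eqVneq m 0%MM.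
    by rewrite big1 // => i _; rewrite mnm0E expr0.
  have [i mi] : exists i, m i != 0%N.
    apply: contrapT => H; case/eqP: m0; apply/mnmP => i; rewrite mnm0E.
    by apply/eqP/negPn/negP => mi; apply: H; exists i.
  by rewrite (bigD1 i) //= expr0n (negPf mi) mul0r.
have g0' i : (tnth g.2 i)@_0 = 0.
  have E : tnth (endo_comp g.2 g.1) i = 'X_i by rewrite autAl tnth_mktuple.
  have := congr1 (meval (fun=> 0)) E.
  rewrite endo_compE comp_mpoly_meval mevalXU meval0 => H; rewrite -[RHS]H.
  by apply: meval_eq => j; rewrite -meval0 g0.
have [A [dA ->]] := phi_contraction g0 g0' Sg i0.
exact: phi_linear.
Qed.

End TrivialOnSAut.

(** * One-parameter unipotent groups *)

Section OneParameterGroups.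
Variable k : fieldType.
Hypothesis k0 : [pchar k] =i pred0.

(** Near [(x0, 0)] the function is a quotient of sums of terms f_i(y) g_i(s) with rational g_i.
    Clearing the denominators of all the g_i at once leaves fixed polynomials in s with coefficients
    f_i(y), so their sizes are bounded independently of y. *)
Lemma prod_line_ratio T (X : kspace k T) Om F x0 : is_ringed X ->
  kreg (kprod X (line 1)) Om F -> Om (x0, 0) ->
  exists U (A B : T -> {poly k}) N,
    [/\ kopen X U /\ U x0, forall y, (size (A y) <= N)%N /\ (size (B y) <= N)%N,
        forall i, kreg X U (fun y => (A y)`_i) /\ kreg X U (fun y => (B y)`_i),
        forall y, U y -> (B y).[0] != 0
      & forall y, U y -> exists2 c : {poly k}, c != 0 &
          forall s, c.[s] != 0 -> Om (y, s) -> F (y, s) = (A y).[s] / (B y).[s]].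
Proof.
move=> Xr FO Om0; have Xs := ringed_space Xr; have Lr := line_ringed (1 : {poly k}).
have [U [V [h [h' [oU oV [hT hT'] [[/= Ux V0] hx] H]]]]] := FO.2 _ Om0.
move: hT => [m [f [g [fg hE]]]]; move: hT' => [m' [f' [g' [fg' hE']]]].
have /choice[p /choice[q gP]] i : exists p q : {poly k}, q.[0] != 0 /\
    forall t, q.[t] != 0 -> V t /\ g i t = p.[t] / q.[t].
  by have [_ gV] := fg i; exact: (line_regP gV V0).
have /choice[p' /choice[q' gP']] i : exists p q : {poly k}, q.[0] != 0 /\
    forall t, q.[t] != 0 -> V t /\ g' i t = p.[t] / q.[t].
  by have [_ gV] := fg' i; exact: (line_regP gV V0).
have [qV [qV0 qVP]] := line_openP oV V0.
pose R := \prod_i q i; pose R' := \prod_i q' i.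
pose a i := p i * ((\prod_(j | j != i) q j) * R').
pose a' i := p' i * ((\prod_(j | j != i) q' j) * R).
have aE i s : (R * R').[s] != 0 -> (a i).[s] = (R * R').[s] * g i s.
  rewrite /R (bigD1 i) //= -/R' !hornerM !mulf_eq0 !negb_or -andbA => /and3P[qs Rs R's].
  have [_ /(_ s qs)[_ ->]] := gP i.
  by field.
have aE' i s : (R * R').[s] != 0 -> (a' i).[s] = (R * R').[s] * g' i s.
  rewrite /R' (bigD1 i) //= -/R !hornerM !mulf_eq0 !negb_or => /andP[Rs /andP[qs R's]].
  have [_ /(_ s qs)[_ ->]] := gP' i.
  by field.
pose A y := \sum_i f i y *: a i; pose B y := \sum_i f' i y *: a' i.
have AE y s : (R * R').[s] != 0 -> (A y).[s] = (R * R').[s] * h (y, s).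
  move=> Rs; rewrite hE horner_sum mulr_sumr; apply: eq_bigr => i _.
  by rewrite hornerZ aE // mulrCA.
have BE y s : (R * R').[s] != 0 -> (B y).[s] = (R * R').[s] * h' (y, s).
  move=> Rs; rewrite hE' horner_sum mulr_sumr; apply: eq_bigr => i _.
  by rewrite hornerZ aE' // mulrCA.
have R0 : (R * R').[0] != 0.
  rewrite hornerM !horner_prod mulf_neq0 //; apply/prodf_neq0 => i _.
    by have [] := gP i.
  by have [] := gP' i.
have reg d (u : 'I_d -> T -> k) (v : 'I_d -> {poly k}) W : kopen X W -> (forall i, kreg X W (u i)) ->
    forall i, kreg X W (fun y => (\sum_j u j y *: v j)`_i).
  move=> oW uW i; under eq_fun do rewrite coef_sum.
  apply: (ringed_sum Xr) => // j; under eq_fun do rewrite coefZ.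
  by apply: (ringed_mul Xr) => //; exact: (ringed_cst Xr).
have fU i : kreg X U (f i) by have [] := fg i.
have fU' i : kreg X U (f' i) by have [] := fg' i.
have B0r : kreg X U (fun y => (B y).[0]).
  by apply: (kreg_eq Xs (reg _ _ a' _ oU fU' 0%N)) => y _; rewrite horner_coef0.
have oU' := ringed_neq0 Xr B0r.
exists [set y | U y /\ (B y).[0] != 0], A, B, (\max_i size (a i) + \max_i size (a' i))%N.
split.
- by split => //; split => //; rewrite BE // mulf_neq0.
- move=> y; split.
    apply: leq_trans (leq_addr _ _); apply: leq_trans (size_sum _ _ _) _.
    apply/bigmax_leqP => i _; apply: leq_trans (size_scale_leq _ _) _.
    exact: (leq_bigmax (F := fun i => size (a i))).
  apply: leq_trans (leq_addl _ _); apply: leq_trans (size_sum _ _ _) _.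
  apply/bigmax_leqP => i _; apply: leq_trans (size_scale_leq _ _) _.
  exact: (leq_bigmax (F := fun i => size (a' i))).
- move=> i; split; [apply: (kreg_restr Xs (reg _ _ a _ oU fU i))|
    apply: (kreg_restr Xs (reg _ _ a' _ oU fU' i))] => //; by move=> y [].
- by move=> y [].
- move=> y [Uy By]; exists (R * R' * (qV * B y)).
    exact: (mulf_neq0 (horner_neq0 R0) (mulf_neq0 (horner_neq0 qV0) (horner_neq0 By))).
  move=> s; rewrite (hornerM (R * R')) (hornerM qV) !mulf_eq0 !negb_or.
  move=> /andP[Rs /andP[Vs Bs]] Os.
  have hs : h' (y, s) != 0.
    by move: Bs; rewrite BE // mulf_eq0 (negPf Rs).
  rewrite (H (y, s)) //; last by split => //; exact: qVP.
  by rewrite AE // BE // -mulf_div divff // mul1r.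
Qed.

Lemma coef_exp_XsubC (a : k) d : (('X - a%:P) ^+ d.+1)`_d = - a *+ d.+1.
Proof.
have lead e : (('X - a%:P) ^+ e)`_e = 1.
  have := monic_exp e (monicXsubC a); rewrite monicE lead_coefE size_exp_XsubC.
  by move/eqP.
elim: d => [|d IHd]; first by rewrite expr1 coefB coefX coefC sub0r.
rewrite exprSr mulrBr coefB coefMX /= IHd coefMC lead mul1r.
by rewrite [RHS]mulrSr.
Qed.

(** Only the two top terms of [p] contribute. In characteristic zero the result determines [t],
    which is how [shift_recovery] reads off the parameter. *)
Lemma coef_shift_pred (p : {poly k}) d t : size p = d.+2 ->
  (p \Po ('X + t%:P))`_d = p`_d + p`_d.+1 * (t *+ d.+1).
Proof.
move=> sp; rewrite (_ : 'X + t%:P = 'X - (- t)%:P); last by rewrite polyCN opprK.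
rewrite comp_polyE coef_sum sp big_ord_recr big_ord_recr /= big1 => [|i _].
  rewrite add0r !coefZ coef_exp_XsubC opprK; congr (_ + _).
  have := monic_exp d (monicXsubC (- t)); rewrite monicE lead_coefE size_exp_XsubC.
  by move/eqP => /= ->; rewrite mulr1.
by rewrite coefZ [X in _ * X]nth_default ?mulr0 // size_exp_XsubC.
Qed.

(* The translates [p (X + t)] and [q (X + t)] are determined up to a scalar by
   their ratio; solving the linear system [x * q_t = p_t * y] by Cramer's rule,
   where the leading coefficient of [p_t] is known, expresses the next
   coefficient of [p_t], hence [t], as a regular function of [x] and [y]. *)
Lemma shift_recovery T (X : kspace k T) U x0 (A B : T -> {poly k}) N p q
    (c : k -> T) : is_ringed X ->
  kopen X U -> U x0 -> (forall y, (size (A y) <= N)%N /\ (size (B y) <= N)%N) ->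
  (forall i, kreg X U (fun y => (A y)`_i) /\ kreg X U (fun y => (B y)`_i)) ->
  coprimep p q -> (1 < size p)%N -> A x0 * q = p * B x0 -> (A x0 != 0 \/ B x0 != 0) ->
  (forall t, U (c t) -> A (c t) * (q \Po ('X + t%:P)) = (p \Po ('X + t%:P)) * B (c t)) ->
  exists U' lam, [/\ kreg X U' lam, U' x0 & forall t, U' (c t) -> lam (c t) = t].
Proof.
move=> Xr oU Ux0 AB ABr pq sp E0 AB0 Et; have Xs := ringed_space Xr.
have [d sd] : exists d, size p = d.+2.
  by case: (size p) sp => [|[|d]] // _; exists d.
pose e := size q.
pose K := (N + d.+1 + e)%N.
(* [u *m band m F] lists the coefficients of [F] times the polynomial [u]. *)
pose band m (F : {poly k}) : 'M[k]_(m, K) := lin1_mx (poly_rV \o F \o* rVpoly).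
have bandE m (F : {poly k}) (v : 'rV_m) : v *m band m F = poly_rV (rVpoly v * F).
  by rewrite /band mul_rV_lin1.
have bandC m F i j : band m F i j = ('X^i * F)`_j.
  by rewrite /band !mxE /= rVpoly_delta.
pose M y := col_mx (band d.+1 (- B y)) (band e (A y)).
have ME y z w : row_mx z w *m M y = poly_rV (rVpoly w * A y - rVpoly z * B y).
  by rewrite mul_row_col !bandE mulrN addrC -linearD.
have sizeK m (F : {poly k}) (v : 'rV[k]_m) : (size F <= N)%N -> (m <= d.+1 + e)%N ->
    (size (rVpoly v * F)%R <= K)%N.
  move=> FN m_le; apply: leq_trans (size_polyMleq _ _) _; apply: leq_trans (leq_pred _) _.
  by rewrite /K -addnA addnC leq_add // (leq_trans (size_poly _ _)).
(* A relation [w * p = z * q] with [p] coprime to [q] makes [p] divide [z], whose size is at most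
   [d.+1], one less than that of [p]. So [z] and then [w] vanish. *)
have free0 : row_free (M x0).
  apply: inj_row_free => v; rewrite -[v]hsubmxK ME.
  move: (lsubmx v) (rsubmx v) => z w /(congr1 rVpoly); rewrite linear0 poly_rV_K; last first.
    apply: leq_trans (size_polyD _ _) _; rewrite geq_max size_polyN.
    by rewrite !sizeK ?(proj1 (AB x0)) ?(proj2 (AB x0)) ?leq_addr ?leq_addl.
  move/eqP; rewrite subr_eq0 => /eqP zw.
  have pA : p %| A x0.
    by rewrite -(Gauss_dvdpl _ pq) E0 dvdp_mulr.
  have [E EA] := dvdpP _ _ pA.
  have p0 : p != 0 by rewrite -size_poly_eq0 sd.
  have EB : B x0 = E * q.
    by apply: (mulfI p0); rewrite -E0 EA -mulrA mulrCA.
  have En0 : E != 0.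
    by case: AB0; rewrite ?EA ?EB mulf_eq0 negb_or => /andP[].
  have {}zw : rVpoly w * p = rVpoly z * q.
    by apply: (mulfI En0); rewrite mulrCA -EA zw EB mulrCA.
  have z0 : rVpoly z = 0.
    apply/eqP; apply: contraTT isT => zn0.
    have pz : p %| rVpoly z.
      by rewrite -(Gauss_dvdpl _ pq) -zw dvdp_mull.
    have := dvdp_leq zn0 pz; rewrite sd leqNgt ltnS.
    by rewrite (leq_trans (size_poly _ _)).
  have w0 : rVpoly w = 0.
    by move/eqP: zw; rewrite z0 mul0r mulf_eq0 (negPf p0) orbF => /eqP.
  by rewrite -(rVpolyK z) -(rVpolyK w) z0 w0 !linear0 row_mx0.
have full0 : row_full (M x0)^T by rewrite /row_full mxrank_tr.
(* [g] selects equations forming an invertible square system at [x0]; they still do so on a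
   neighbourhood. *)
pose g := fullrankfun full0.
pose Q y := rowsub g (M y)^T.
have Q0 : \det (Q x0) != 0.
  by have := fullrowsub_unit full0; rewrite unitmxE unitfE.
have Mr y r j : kreg X U (fun y => M y r j).
  rewrite /M; under eq_fun do rewrite mxE; case: (split r) => i; under eq_fun do rewrite bandC.
    under eq_fun do rewrite mulrN coefN coefXnM.
    case: (j < i)%N; first by under eq_fun do rewrite oppr0; exact: (ringed_cst Xr).
    by apply: (ringed_opp Xr); case: (ABr (j - i)%N).
  under eq_fun do rewrite coefXnM.
  by case: (j < i)%N; [exact: (ringed_cst Xr)|case: (ABr (j - i)%N)].
pose rhs y j := (lead_coef p *: ('X^(d.+1) * B y))`_j.
have rhsr j : kreg X U (fun y => rhs y j).
  rewrite /rhs; under eq_fun do rewrite coefZ coefXnM.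
  apply: (ringed_mul Xr); first exact: (ringed_cst Xr).
  by case: (j < d.+1)%N; [exact: (ringed_cst Xr)|case: (ABr (j - d.+1)%N)].
have Qr i j : kreg X U (fun y => Q y i j) by under eq_fun do rewrite mxE mxE; exact: Mr.
have Qd := ringed_det Xr oU Qr.
(* The unknowns are the coefficients of p_t below the leading one, followed by those of q_t; [r0] is
   the place of the coefficient of degree [d] of p_t. *)
pose r0 : 'I_(d.+1 + e) := lshift e ord_max.
pose num y := \sum_i (\adj (Q y)) r0 i * rhs y (g i).
have numr : kreg X U num.
  apply: (ringed_sum Xr) => // i; apply: (ringed_mul Xr) => //.
  exact: ringed_adj.
exists [set y | U y /\ \det (Q y) != 0].
(* Cramer's rule gives the coefficient of degree [d] of p_t, and the formula of [coef_shift_pred] is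
   solved for [t]. *)
exists (fun y => (num y / \det (Q y) - p`_d) / (lead_coef p * d.+1%:R)); split.
- have oU' := ringed_neq0 Xr Qd.
  apply: (ringed_mul Xr); last exact: (ringed_cst Xr).
  apply: (ringed_sub Xr); last exact: (ringed_cst Xr).
  exact: (ringed_div Xr).
- by [].
move=> t [Uc Qc].
have lp0 : lead_coef p != 0 by rewrite lead_coef_eq0 -size_poly_eq0 sd.
have szt (u : {poly k}) : size (u \Po ('X + t%:P)) = size u.
  rewrite size_comp_poly2 //.
  by rewrite (_ : 'X + t%:P = 'X - (- t)%:P) ?size_XsubC // polyCN opprK.
have {}Et := Et t Uc; set pt := p \Po _ in Et *; pose z : 'rV_d.+1 := poly_rV (pt - lead_coef p *: 'X^(d.+1)).
pose w : 'rV_e := poly_rV (q \Po ('X + t%:P)).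
have lpt : pt`_d.+1 = lead_coef p.
  have XtE : 'X + t%:P = 'X - (- t)%:P by rewrite polyCN opprK.
  have := @lead_coef_comp _ p ('X + t%:P).
  rewrite XtE size_XsubC lead_coefXsubC expr1n mulr1 => /(_ isT) <-.
  by rewrite -XtE lead_coefE szt sd.
have zK : rVpoly z = pt - lead_coef p *: 'X^(d.+1).
  rewrite poly_rV_K //; apply/leq_sizeP => j; rewrite leq_eqVlt => /predU1P[<-|dj].
    by rewrite coefB coefZ coefXn eqxx mulr1 lpt subrr.
  rewrite coefB coefZ coefXn gtn_eqF // mulr0 subr0 nth_default // szt sd.
  by [].
have wK : rVpoly w = q \Po ('X + t%:P) by rewrite poly_rV_K // szt.
have sol : row_mx z w *m M (c t) = \row_j rhs (c t) j.
  rewrite ME zK wK [_ * A _]mulrC Et mulrBl opprB addrC subrK.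
  by apply/rowP => j; rewrite !mxE /rhs -scalerAl.
have solQ : Q (c t) *m (row_mx z w)^T = \col_i rhs (c t) (g i).
  apply/colP => i; rewrite mxE.
  have := congr1 (fun v : 'rV_K => v ord0 (g i)) sol; rewrite !mxE => <-.
  by apply: eq_bigr => r _; rewrite !mxE mulrC.
have numE : num (c t) = \det (Q (c t)) * pt`_d.
  have adjE : \adj (Q (c t)) *m \col_i rhs (c t) (g i) = \det (Q (c t)) *: (row_mx z w)^T.
    by rewrite -solQ mulmxA mul_adj_mx mul_scalar_mx.
  have -> : num (c t) = (\adj (Q (c t)) *m \col_i rhs (c t) (g i)) r0 ord0.
    by rewrite mxE; apply: eq_bigr => i _; rewrite [X in _ = _ * X]mxE.
  rewrite adjE mxE mxE /r0 row_mxEl; congr (_ * _).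
  by rewrite mxE coefB coefZ coefXn ltn_eqF // mulr0 subr0.
rewrite numE mulrAC divff // mul1r coef_shift_pred // addrAC subrr add0r.
have -> : p`_d.+1 = lead_coef p by rewrite lead_coefE sd.
rewrite -[t *+ _]mulr_natl mulrA mulrAC divff ?mul1r //.
by rewrite mulf_neq0 // natr_neq0.
Qed.

End OneParameterGroups.

Section OneParameterSubgroups.
Variable k : fieldType.
Hypothesis k0 : [pchar k] =i pred0.
Variables (gT : groupType) (G : indspace k gT).
Hypothesis Gg : is_indgroup G.
Let Gi := indgroup_ind Gg.

(** [s0] is a parameter where some [h] has nonzero derivative along [rho]; it exists because [rho]
    is not constant. Using [rho (s + s0) * y] with [y] near 1 keeps [h] near [rho s0] and spares its
    transport to the identity. *)
Lemma one_parameter_log (rho : k -> gT) : imorphism G (line 1) rho ->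
  (forall s t, rho (s + t) = (rho s * rho t)%g) -> (exists t, rho t <> 1%g) ->
  forall m, carrier (G m) 1%g ->
  exists U lam, [/\ kreg (G m) U lam, U 1%g & forall t, U (rho t) -> lam (rho t) = t].
Proof.
move=> [m0 rM] rhoD nt m C1; have L1 := line_ringed (1 : {poly k}).
have Ls := ringed_space L1; have Xr := ind_ringed Gi m.
have one0 (t : k) : (1 : {poly k}).[t] != 0 by rewrite hornerC oner_neq0.
have rho0 : rho 0 = 1%g by apply: (mulgI (rho 0)); rewrite -rhoD addr0 mulg1.
have [s0 [W [h [hW Ws hd]]]] : exists s0 W h,
    [/\ kreg (G m0) W h, W (rho s0) & der s0 (h \o rho) != 0].
  apply: contrapT => H; case: nt => t; apply; rewrite -rho0.
  apply: (const_curve k0 (ind_variety Gi m0) rM) => // s W h _ hW Ws.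
  by apply/eqP/negPn/negP => d; apply: H; exists s, W, h.
have Pr := kprod_ringed Xr L1; have Ps := ringed_space Pr.
have sM := kmorphism_comp Ls (line_shift s0) rM.
have [M gM] : imorphism G (kprod (G m) (line 1)) (fun p => rho (p.2 + s0) * p.1)%g.
  apply: (imorphism_mul Gg Pr); last by exists m; exact: kmorphism_fst.
  by exists m0; exact: (kmorphism_comp Ps (kmorphism_snd Xr L1) sM).
have [W' [h' [hW' Ws' hh]]] := ind_extend Gi (leq_maxl m0 M) hW Ws.
have [_ _ gr] := kmorphism_le Gi Ps (leq_maxr m0 M) gM.
have Om1 : (carrier (kprod (G m) (line 1)) `&`
    (fun p => rho (p.2 + s0) * p.1)%g @^-1` W') (1%g, 0).
  by split; [split => //; exact/line_carrier|rewrite /preimage /= add0r mulg1].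
have [U [A [B [N [[oU U1] AB ABr B0 ratio]]]]] := prod_line_ratio Xr (gr _ _ hW') Om1.
have [_ _ sr] := kmorphism_le Gi Ls (leq_maxl m0 M) sM.
have Oms : (carrier (line 1) `&` (rho \o (fun t => t + s0)) @^-1` W') 0.
  by split; [exact/line_carrier|rewrite /preimage /= add0r].
have [p [q [q0 pq]]] := line_regP (sr _ _ hW') Oms.
have qn0 := horner_neq0 q0.
(* [shift_recovery] needs a fraction in lowest terms. *)
pose g := gcdp p q; pose p1 := p %/ g; pose q1 := q %/ g.
have pE : p = p1 * g by rewrite divpK ?dvdp_gcdl.
have qE : q = q1 * g by rewrite divpK ?dvdp_gcdr.
have cop : coprimep p1 q1 by rewrite coprimep_div_gcd ?qn0 ?orbT.
have pq1 t : q.[t] != 0 -> [/\ W' (rho (t + s0)), q1.[t] != 0 &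
    h' (rho (t + s0)) = p1.[t] / q1.[t]].
  move=> qt; have [[_ W't] /= ->] := pq t qt; move: qt.
  rewrite pE qE !hornerM mulf_eq0 negb_or => /andP[qt gt]; split => //.
  by rewrite -mulf_div divff // mulr1.
(* If numerator and denominator were both constant, [h \o rho] would be constant near [s0], against
   the choice of [s0]. *)
have nonconst : (1 < size p1)%N || (1 < size q1)%N.
  apply: contraR hd; rewrite negb_or -!leqNgt => /andP[/size1_polyC pc /size1_polyC qc].
  apply/eqP/(derE k0).
  apply: (hasder_local (c := q \Po ('X - s0%:P)) (r' := fun=> p1`_0 / q1`_0)).
  - by rewrite horner_comp !hornerE subrr.
  - move=> t; rewrite horner_comp !hornerE => qt; have [W't _ E] := pq1 _ qt.
    rewrite subrK in W't E; have [|_ hE] := hh (rho t) _ W't.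
      by have [rC _ _] := rM; apply: rC; exact/line_carrier.
    by rewrite /= hE E {1}pc {1}qc !hornerC.
  - exact: hasder_cst.
have E t : U (rho t) -> A (rho t) * (q1 \Po ('X + t%:P)) = (p1 \Po ('X + t%:P)) * B (rho t).
  move=> Ut; have [c cn0 cE] := ratio _ Ut.
  have qt0 : q \Po ('X + t%:P) != 0.
    apply: (@horner_neq0 _ _ (- t)); by rewrite horner_comp !hornerE addNr.
  have Bn0 := horner_neq0 (B0 _ Ut).
  apply: (@poly_eq_dense _ k0 _ _ (c * ((q \Po ('X + t%:P)) * B (rho t)))).
    by rewrite !mulf_neq0.
  move=> s; rewrite hornerM mulf_eq0 negb_or hornerM mulf_eq0 negb_or.
  rewrite horner_comp hornerD hornerX hornerC.
  move=> /andP[cs /andP[/pq1[W's q1s hs] Bs]].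
  have gE : (rho (s + s0) * rho t)%g = rho (s + t + s0) by rewrite -rhoD addrAC.
  have := cE s cs; rewrite /= gE hs => H.
  rewrite !hornerM !horner_comp hornerD hornerX hornerC.
  apply/eqP; rewrite -eqr_div // eq_sym; apply/eqP.
  apply: H; split; last exact: W's.
  by split => /=; [exact: (kopen_sub (ringed_space Xr) oU Ut)|exact/line_carrier].
have E1 : A 1%g * q1 = p1 * B 1%g.
  by have := E 0; rewrite rho0 addr0 !comp_polyXr; apply.
have Bn1 := horner_neq0 (B0 _ U1).
have [U' [lam [lr U1' lE]]] : exists U' lam, [/\ kreg (G m) U' lam, U' 1%g &
    forall t, U' (rho t) -> lam (rho t) = t].
  (* [shift_recovery] needs a nonconstant numerator; in the other case the fraction is inverted. *)
  case/orP: nonconst => sz.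
    by apply: (shift_recovery k0 Xr oU U1 AB ABr cop sz E1 _ E); right.
  apply: (shift_recovery k0 Xr oU U1 (N := N) (A := B) (B := A) (p := q1) (q := p1)).
  - by move=> y; have [] := AB y.
  - by move=> i; have [] := ABr i.
  - by rewrite coprimep_sym.
  - by [].
  - by rewrite mulrC -E1 mulrC.
  - by left.
  - by move=> t Ut; rewrite mulrC -E // mulrC.
by exists U', lam.
Qed.

End OneParameterSubgroups.

(** * The group [SAut] of the affine line *)

Section AffineLine.
Variable k : fieldType.
Hypothesis k0 : [pchar k] =i pred0.
Local Notation autA := (autA k 1).
Local Notation S := (@jac1_if k 1 true).

Lemma SAut1_translation (f : autA) : S f ->
  f = translation (fun=> (tnth f.1 ord0)@_0).
Proof.
move=> /jac1_ifP/(_ isT); rewrite /jacobian det_mx11 mxE => f1.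
apply: autA_inj1; apply/eq_from_tnth => i; rewrite translationE (ord1 i).
apply/eqP; rewrite addrC -subr_eq; apply/eqP.
rewrite [LHS](mderiv_eq0 k0) => [|j].
  by rewrite mcoeffB mcoeffX -mdeg_eq0 mdeg1 subr0.
by rewrite (ord1 j) mderivB f1 mderivXU eqxx subrr.
Qed.

Variables (gT : groupType) (G : indspace k gT).
Hypothesis Gg : is_indgroup G.
Variable phi : autA -> gT.
Hypothesis phiM : ind_morphism (ind_sub (Aut k 1) S) G phi.
Hypothesis phiD : forall f g, S f -> S g -> phi (f * g)%g = (phi f * phi g)%g.
Hypothesis nontrivial_translation : exists v, phi (translation v) <> 1%g.

Lemma closed_immersion_SAut1 : closed_immersion (ind_sub (Aut k 1) S) G phi.
Proof.
have Gi := indgroup_ind Gg; have L1 := line_ringed (1 : {poly k}).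
pose tau (t : k) : autA := translation (fun=> t).
have St t : S (tau t) by exact: jac1_if_translation.
have tauL : afam (line 1) tau.
  by apply: (afam_translation L1) => j; exact: line_coord.
have rhoM := imorphism_phi phiM L1 tauL (fun t _ => St t).
have rhoD s t : phi (tau (s + t)) = (phi (tau s) * phi (tau t))%g.
  by rewrite -phiD //; congr phi; exact: translationD.
have rho_nt : exists t, phi (tau t) <> 1%g.
  have [v vP] := nontrivial_translation; exists (v ord0).
  by rewrite (_ : tau _ = translation v) //; apply: translation_eq => i; rewrite (ord1 i).
apply: (closed_immersion_reconstruct Gg phiM phiD) => d.
  (* Every element is a translation, of degree 1, so a single piece contains the whole group. *)
  exists 1%N => f Sf _; apply/Aut_carrier => i; rewrite (SAut1_translation Sf).
  have X_le c : (msize ('X_i + c%:MP_[1] : {mpoly k[1]}) <= 2)%N.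
    by apply: leq_trans (msizeD_le _ _) _; rewrite geq_max msizeX mdeg1 msizeC (leqW (leq_b1 _)).
  by split; rewrite tnth_mktuple -?mpolyCN.
move=> C1; have [U [lam [lr U1 lE]]] := one_parameter_log k0 Gg rhoM rhoD rho_nt C1.
have Gr := ind_ringed Gi d; have Gs := ringed_space Gr.
have oU := kreg_open Gs lr.
have UE : carrier (ksub (G d) U) = U.
  by apply/seteqP; split=> y; [case|move=> Uy; split => //; exact: (kopen_sub Gs oU)].
have Ur : is_ringed (ksub (G d) U) by exact: kinduced_ringed.
have tX : afam (ksub (G d) U) (fun y => tau (lam y)).
  by apply: (afam_translation Ur) => j; rewrite UE; exact: (proj2 (kreg_sub_ksub _ _ Gs oU) (conj lr (fun _ Uy => Uy))).
exists U, (fun y => (tau (lam y)).1), (fun y => (tau (lam y)).2); split => //; split => //.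
- by move=> i; have [] := tX i.
- by move=> i; have [] := tX i.
- move=> f Sf; rewrite (SAut1_translation Sf) => Uf.
  by rewrite -/(tau _) lE.
Qed.

End AffineLine.

(** * Shears and factorization through the Jacobian determinant *)

Section Conclusion.
Variables (k : fieldType) (n : nat).
Hypothesis k0 : [pchar k] =i pred0.
Local Notation poly := {mpoly k[n]}.
Local Notation autA := (autA k n).
Local Notation jac1_if := (@jac1_if k n).

(** [Aut] and its subspace for the empty condition are different terms with the same underlying
    variety; the identity maps in both directions carry results across. *)
Lemma Aut_sub_false d : kmorphism (Aut k n d) (ind_sub (Aut k n) (jac1_if false) d) id.
Proof.
have As := ringed_space (Aut_ringed k n d).
by apply: kmorphism_sub => //; exact: kmorphism_id.
Qed.

Lemma ind_sub_Aut S d : kmorphism (ind_sub (Aut k n) S d) (Aut k n d) id.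
Proof. exact/ksub_incl/ringed_space/Aut_ringed. Qed.

Lemma SAutE : SAut k n = ind_sub (Aut k n) (jac1_if true).
Proof.
apply: funext => d; congr ksub; apply/seteqP.
by split=> f fj; [move=> _|exact: (fj isT)].
Qed.

Lemma shear_curve e (i j : 'I_n) : i != j -> exists (b0 : {poly k}) (u : k -> autA),
  [/\ b0.[0] != 0 /\ afam (line b0) u, u 0 = 1%g,
      forall t, b0.[t] != 0 -> jac1_if e (u t)
    & forall l, isder b0 0 (fun t => tnth (u t).1 l) ((l == i)%:R *: 'X_j)].
Proof.
move=> ij; have one0 (t : k) : (1 : {poly k}).[t] != 0 by rewrite hornerC oner_neq0.
have fX : free_of i ('X_j : poly) by apply: free_ofX; rewrite mnm1E eq_sym (negPf ij).
have L1 := line_ringed (1 : {poly k}).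
exists 1, (fun t => elem_aut i (t *: 'X_j)); split.
- by split; [exact: one0|apply: (afam_elem L1 fX); exact: line_coord].
- apply: autA_inj1; apply/eq_from_tnth => l; rewrite autA_one1E scale0r.
  by rewrite elem_aut1E ?scaler0 ?addr0 // -(scale0r 'X_j); exact: free_ofZ.
- by move=> t _; apply: jac1_if_elem; exact: free_ofZ.
- move=> l; rewrite -[_ *: _]add0r.
  have H := isderD (one0 0) (isder_cst (one0 0) ('X_l : poly))
              (isder_id (one0 0) ((l == i)%:R *: 'X_j)).
  apply: (isder_eq (one0 0) H) => t _.
  by rewrite elem_aut1E ?scalerA ?[t * _]mulrC //; exact: free_ofZ.
Qed.

Variables (gT : groupType) (G : indspace k gT).
Hypothesis Gg : is_indgroup G.

Lemma closed_immersion_Aut (phi : autA -> gT) :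
  closed_immersion (ind_sub (Aut k n) (jac1_if false)) G phi ->
  closed_immersion (Aut k n) G phi.
Proof.
have IC : ind_carrier (ind_sub (Aut k n) (jac1_if false)) = ind_carrier (Aut k n).
  apply/seteqP; split=> f _; first exact: Aut_ind_carrier.
  exact/ind_carrier_sub.
have As d := ringed_space (Aut_ringed k n d).
have from_sub (W : indspace k gT) : ind_morphism (ind_sub (Aut k n) (jac1_if false)) W phi ->
    ind_morphism (Aut k n) W phi.
  move=> pM d; have [m mM] := pM d; exists m.
  exact: (kmorphism_comp (As d) (Aut_sub_false d) mM).
rewrite /closed_immersion IC => -[? [[pM pD] [_ [g [gM gl gr]]]]].
split => //; split; first by split; [exact: from_sub|move=> x y Cx Cy; apply: pD; rewrite IC].
split; first exact: from_sub.
exists g; split => //; last by rewrite -IC.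
move=> d; have [m mM] := gM d; exists m.
apply: (kmorphism_comp _ mM (ind_sub_Aut _ m)).
exact/kinduced_kspace/ind_kspace/indgroup_ind.
Qed.

Section Diagonal.
Variable i0 : 'I_n.

(** A section of the determinant that is a group homomorphism; through [lin_aut] it becomes one of
    [jac]. *)
Definition diagonal (c : kstar k) : 'M[k]_n :=
  diag_mx (\row_i if i == i0 then val c else 1).

Lemma det_diagonal c : \det (diagonal c) = val c.
Proof.
rewrite det_diag (bigD1 i0) //= mxE eqxx big1 ?mulr1 // => i /negPf ii.
by rewrite mxE ii.
Qed.

Lemma diagonal_unit c : diagonal c \in unitmx.
Proof. by rewrite unitmxE det_diagonal unitfE; exact: kstar_neq0. Qed.

Lemma diagonalM c d : diagonal (c * d)%g = diagonal c *m diagonal d.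
Proof.
rewrite mulmx_diag; congr diag_mx; apply/rowP => i; rewrite !mxE.
by case: eqP => _ //; rewrite mulr1.
Qed.

Lemma afam_diagonal d : afam (Gm k d) (fun c => lin_aut (diagonal c)).
Proof.
have Xr : is_ringed (Gm k d) by apply: kinduced_ringed; exact: affine_ringed.
have Xs := ringed_space Xr; have oT := kopenT Xs.
have valr : kreg (Gm k d) (carrier (Gm k d)) val.
  split => // t Ct; exists setT, (fun v : {ffun 'I_1 -> k} => v ord0); split => //.
    exact: affine_coord.
  by move=> u _ _; rewrite ffunE.
apply: (afam_lin Xr) => [c _|i j]; first exact: diagonal_unit.
apply: (kreg_eq Xs (f := fun c =>
    if i == j then if i == i0 then val c else 1 else 0)) => [|c _]; last first.
  rewrite mxE mxE; by case: (i == j); rewrite ?mulr1n ?mulr0n.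
by case: eqP => _; [case: eqP => _ //|]; exact: (ringed_cst Xr).
Qed.

Variable phi : autA -> gT.
Hypothesis phiM : ind_morphism (ind_sub (Aut k n) (jac1_if false)) G phi.
Hypothesis phiD : forall f g, phi (f * g)%g = (phi f * phi g)%g.

(** [f] and the diagonal automorphism of the same Jacobian differ by an element of Jacobian 1, so
    [phi] is determined by its values on diagonal automorphisms. *)
Lemma factors_through_jac_trivial : (forall f, jac f = 1%g -> phi f = 1%g) ->
  factors_through_jac G phi.
Proof.
move=> phi_SAut; exists (fun c => phi (lin_aut (diagonal c))).
  split=> [d|c d _ _]; last first.
    by rewrite diagonalM (lin_autM (diagonal_unit c) (diagonal_unit d)); exact: phiD.
  apply: (imorphism_phi phiM _ (afam_diagonal d)) => //.
  by apply: kinduced_ringed; exact: affine_ringed.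
move=> f; set a := lin_aut _.
have ja : jac a = jac f.
  by apply: val_inj; apply: (etrans (jac_lin (diagonal_unit _))); exact: det_diagonal.
have <- : (phi (f * a^-1)%g * phi a)%g = phi f by rewrite -phiD mulgVK.
by rewrite phi_SAut ?mul1g // jacM jacV ja mulgV.
Qed.

End Diagonal.
End Conclusion.

Section AffineLineHomothety.
Variable k : fieldType.
Local Notation poly := {mpoly k[1]}.

(** With a single variable x the field is x d_x, and the curve is the homothety of ratio [1 + t],
    shifted so as to be the identity at 0; [b0] removes the ratio 0. *)
Lemma homothety_curve (j : 'I_1) : exists (i : 'I_1) (b0 : {poly k}) (u : k -> autA k 1),
  [/\ b0.[0] != 0 /\ afam (line b0) u, u 0 = 1%g,
      forall t, b0.[t] != 0 -> jac1_if false (u t)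
    & forall l, isder b0 0 (fun t => tnth (u t).1 l) ((l == i)%:R *: 'X_j)].
Proof.
pose b0 : {poly k} := 1 + 'X; pose A t : 'M[k]_1 := (1 + t)%:M.
have b0E t : b0.[t] = 1 + t by rewrite /b0 hornerD hornerX hornerC.
have Lr := line_ringed b0.
have uA t : b0.[t] != 0 -> A t \in unitmx.
  by move=> bt; rewrite unitmxE det_scalar1 unitfE -b0E.
have b00 : b0.[0] != 0 by rewrite b0E addr0 oner_neq0.
exists ord0, b0, (fun t => lin_aut (A t)); split => //.
- split => //; apply: (afam_lin Lr) => [t /line_carrier/uA //|i l].
  under eq_fun do rewrite mxE (ord1 i) (ord1 l) eqxx mulr1n -b0E.
  exact: line_poly.
- by rewrite /A addr0 lin_aut1.
- move=> l; rewrite (ord1 l) (ord1 j) eqxx scale1r -['X_ord0]add0r.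
  have H := isderD b00 (isder_cst b00 ('X_ord0 : poly)) (isder_id b00 ('X_ord0 : poly)).
  apply: (isder_eq b00 H) => t bt.
  by rewrite (lin_aut1E (uA t bt)) tnth_mktuple big_ord1 mxE eqxx mulr1n scalerDl scale1r.
Qed.

End AffineLineHomothety.

Theorem theorem1p4 (k : closedFieldType) (k_char0 : [pchar k]%R =i pred0)
    (n : nat) (n_ge1 : (1 <= n)%N)
    (gT : groupType) (G : indspace k gT) (G_indgroup : is_indgroup G) :
  (forall phi : autA k n -> gT, ind_hom (Aut k n) G phi ->
     factors_through_jac G phi \/ closed_immersion (Aut k n) G phi) /\
  (forall phi : autA k n -> gT, ind_hom (SAut k n) G phi ->
     nontrivial_hom (SAut k n) phi -> closed_immersion (SAut k n) G phi).
Proof.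
(* The hypothesis excludes exactly [SAut] of the affine line, where no curve has such a velocity. *)
have curve e : (n = 1%N -> e = false) -> forall j : 'I_n,
    exists (i : 'I_n) (b0 : {poly k}) (u : k -> autA k n),
    [/\ b0.[0] != 0 /\ afam (line b0) u, u 0 = 1%g,
        forall t, b0.[t] != 0 -> jac1_if e (u t)
      & forall l, isder b0 0 (fun t => tnth (u t).1 l) ((l == i)%:R *: 'X_j)].
  case: (n) n_ge1 => [|[|n']] // _ ef j; first by rewrite ef //; exact: homothety_curve.
  have [i ij] : exists i : 'I_n'.+2, i != j.
    by exists (if j == ord0 then ord_max else ord0); case: (eqVneq j ord0) => [->|]; rewrite // eq_sym.
  exists i; exact: shear_curve.
have i0 : 'I_n := Ordinal n_ge1.
split=> phi; last first.
  rewrite SAutE => -[phiM phiD] [f Cf phi_f].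
  have {}phiD g h : jac1_if true g -> jac1_if true h -> phi (g * h)%g = (phi g * phi h)%g.
    by move=> Sg Sh; apply: phiD; exact/ind_carrier_sub.
  have nt : exists v, phi (translation v) <> 1%g.
    (* If [phi] killed all translations, [phi_trivial] would make it trivial on the whole group. *)
    apply: contrapT => H; apply: phi_f.
    apply: (phi_trivial k_char0 G_indgroup phiM phiD _ i0) => [v|].
      by apply: contrapT => v1; apply: H; exists v.
    exact/ind_carrier_sub.
  have [n1|n1] := eqVneq n 1%N; last first.
    apply: (closed_immersion_nontrivial_translation k_char0 G_indgroup phiM phiD nt).
    by apply: curve => e1; rewrite e1 in n1.
  move: (n) n1 phi phiM phiD nt {n_ge1 curve i0 f Cf phi_f} => _ -> phi phiM phiD nt.
  exact: closed_immersion_SAut1.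
move=> [phiM phiD].
have subM S : ind_morphism (ind_sub (Aut k n) S) G phi.
  move=> d; have [m mM] := phiM d; exists m.
  apply: (kmorphism_comp _ (ind_sub_Aut S d) mM).
  exact/kinduced_kspace/ringed_space/Aut_ringed.
have {}phiD g h : phi (g * h)%g = (phi g * phi h)%g.
  by apply: phiD; exact: Aut_ind_carrier.
have [nt|H] := pselect (exists v, phi (translation v) <> 1%g); [right|left].
  apply: closed_immersion_Aut => //.
  apply: (closed_immersion_nontrivial_translation k_char0 G_indgroup (subM _) _ nt) => //.
  exact: curve.
apply: (factors_through_jac_trivial i0 (subM _) phiD) => f jf.
apply: (phi_trivial k_char0 G_indgroup (subM _) _ _ i0) => // v.
by apply: contrapT => v1; apply: H; exists v.
Qed.
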